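(* Let $n\in\mathbb{N}$, $I^n=[-1,1]^n$, and for $\delta\in(0,1/2)$ put $$\theta(\delta)=1-\frac{\delta}{a_{\mathbb{T}}([-\delta,\delta])},$$ where $a_{\mathbb{T}}([-\delta,\delta])$ is the value of the periodic Turán problem on $\mathbb{T}$ for the interval $[-\delta,\delta]$. Then for every $\delta\in(0,1/2)$ $$W_n(\delta I^n)\le 2^n(1-\theta(\delta))^n,$$ where (i) $\theta$ is continuous on $(0,1/2)$ and, moreover, $\theta(\delta)=O(\delta^2)$ as $\delta\to0$; (ii) $\theta(\delta)=0$ whenever $\delta^{-1}\in\mathbb{N}$; (iii) $0<\theta(\delta)<1$ whenever $\delta^{-1}\notin\mathbb{N}$.
   Context: $\mathbb{T}^n=\mathbb{R}^n/\mathbb{Z}^n$, identified with $[-1/2,1/2)^n$ and equipped with Lebesgue measure; $\mathbb{T}=\mathbb{T}^1$; $|D|$ is the volume of $D$. For $f\in L^1(\mathbb{T}^n)$ (complex-valued), $\widehat f_\nu=\int_{\mathbb{T}^n}f(x)e^{-2\pi i\nu x}\,dx$, $\nu\in\mathbb{Z}^n$. $L^1_+(\mathbb{T}^n)=\{f\in L^1(\mathbb{T}^n):\widehat f_\nu\ge 0\text{ for all }\nu\in\mathbb{Z}^n\}$. For an origin-symmetric convex body $D\subset\mathbb{T}^n$ (i.e. $D\subset[-1/2,1/2)^n$), the sharp Wiener constant is $$W_n(D)=\sup_{f\in L^1_+(\mathbb{T}^n)\setminus\{0\}}\frac{\int_{\mathbb{T}^n}|f|^2\,dx}{|D|^{-1}\int_D|f|^2\,dx},$$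 where functions with $\int_D|f|^2\,dx=\infty$ are disregarded and $c/0=+\infty$ for $c>0$; that is, $W_n(D)$ is the smallest constant $W$ with $\int_{\mathbb{T}^n}|f|^2\,dx\le W|D|^{-1}\int_D|f|^2\,dx$ for all $f\in L^1_+(\mathbb{T}^n)$. Periodic Turán problem: $a_{\mathbb{T}}([-\delta,\delta])=\sup\widehat g_0$, the supremum over all (continuous) $g\in L^1(\mathbb{T})$ with $\widehat g_\nu\ge0$ for all $\nu\in\mathbb{Z}$, $\operatorname{supp}g\subset[-\delta,\delta]$, and $g(0)=1$, where $\operatorname{supp}g$ is the closure of the set where $g$ is non-zero. *)

(* Defs.v *)
From HB Require Import structures.
From mathcomp Require Import all_boot all_order all_algebra.
From mathcomp Require Import all_classical all_reals all_analysis.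
From mathcomp Require Import complex.

Set Implicit Arguments.
Unset Strict Implicit.
Unset Printing Implicit Defensive.

Import Order.TTheory GRing.Theory Num.Theory.
Import numFieldNormedType.Exports.

Local Open Scope classical_set_scope.
Local Open Scope ring_scope.
Local Open Scope complex_scope.

(* Lebesgue measure on R^n, carried by the tuples [n.-tuple R] with their
   product sigma-algebra: the n-fold product of the one-dimensional measure. *)
Section tuple_lebesgue_measure.
Context {R : realType}.

Definition tuple_cons (n : nat) (p : R * n.-tuple R) : n.+1.-tuple R :=
  [tuple of p.1 :: p.2].

Lemma measurable_tuple_cons (n : nat) : measurable_fun setT (@tuple_cons n).
Proof. exact: measurable_cons. Qed.

Lemma measurable_tuple_uncons (n : nat) :
  measurable_fun setT (fun x : n.+1.-tuple R => (thead x, [tuple of behead x])).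
Proof.
apply: measurable_fun_pair; last exact: measurable_behead.
exact: measurable_tnth.
Qed.

Section step.
Context {n : nat} (m : {sigma_finite_measure set (n.-tuple R) -> \bar R}).

Definition tuple_lebesgue_step : set (n.+1.-tuple R) -> \bar R :=
  pushforward (@lebesgue_measure R \x m)%E (@tuple_cons n).

Let mc := @measurable_tuple_cons n.

Let step0 : tuple_lebesgue_step set0 = 0%E.
Proof. by rewrite /tuple_lebesgue_step /pushforward preimage_set0 measure0. Qed.

Let step_ge0 A : (0 <= tuple_lebesgue_step A)%E.
Proof. exact: (@measure_ge0 _ _ _ (pushforward _ _) _). Qed.

Let step_sigma_additive : semi_sigma_additive tuple_lebesgue_step.
Proof. exact: (@measure_semi_sigma_additive _ _ _ (pushforward _ _)). Qed.

HB.instance Definition _ := isMeasure.Build _ _ _ tuple_lebesgue_step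
  step0 step_ge0 step_sigma_additive.

Let step_sigma_finite : sigma_finite setT tuple_lebesgue_step.
Proof.
have /sigma_finiteP[F [TF ndF Foo]] := sigma_finiteT (@lebesgue_measure R).
have /sigma_finiteP[G [TG ndG Goo]] := sigma_finiteT m.
pose u (x : n.+1.-tuple R) : R * n.-tuple R := (thead x, [tuple of behead x]).
exists (fun i => u @^-1` (F i `*` G i)).
  rewrite -preimage_bigcup (_ : \bigcup_i _ = setT) ?preimage_setT//.
  apply/seteqP; split=> // -[x y] _.
  have [i _ Fx] : (\bigcup_i F i) x by rewrite -TF.
  have [k _ Gy] : (\bigcup_i G i) y by rewrite -TG.
  exists (maxn i k) => //; split => /=.
  - by move: x Fx; exact/subsetPset/ndF/leq_maxl.
  - by move: y Gy; exact/subsetPset/ndG/leq_maxr.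
move=> i; have [mF Fi] := Foo i; have [mG Gi] := Goo i; split.
  rewrite -[X in measurable X]setTI.
  by apply: measurable_tuple_uncons => //; exact: measurableX.
have uK : cancel (@tuple_cons n) u.
  by move=> [a t]; congr (_, _); exact: val_inj.
rewrite /tuple_lebesgue_step /pushforward -comp_preimage.
rewrite (_ : u \o _ = id); last exact/funext/uK.
by rewrite preimage_id product_measure1E// lte_mul_pinfty// ge0_fin_numE.
Qed.

HB.instance Definition _ := Measure_isSigmaFinite.Build _ _ _
  tuple_lebesgue_step step_sigma_finite.

End step.

Fixpoint tuple_lebesgue (n : nat) :
    {sigma_finite_measure set (n.-tuple R) -> \bar R} :=
  if n is n'.+1 then tuple_lebesgue_step (tuple_lebesgue n')
  else \d_ [tuple].

End tuple_lebesgue_measure.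

Section complex_valued.
Context {R : realType}.

Definition expi (t : R) : R[i] := cos t +i* sin t.

Definition complex_integrable d (T : measurableType d)
    (mu : {measure set T -> \bar R}) (D : set T) (f : T -> R[i]) : Prop :=
  mu.-integrable D (fun x => (complex.Re (f x))%:E) /\
  mu.-integrable D (fun x => (complex.Im (f x))%:E).

Definition complex_integral d (T : measurableType d)
    (mu : {measure set T -> \bar R}) (D : set T) (f : T -> R[i]) : R[i] :=
  (\int[mu]_(x in D) complex.Re (f x)) +i* (\int[mu]_(x in D) complex.Im (f x)).

Definition sq_integral d (T : measurableType d)
    (mu : {measure set T -> \bar R}) (D : set T) (f : T -> R[i]) : \bar R :=
  (\int[mu]_(x in D) (Normc.normc (f x) ^+ 2)%:E)%E.

End complex_valued.

(* Functions on the torus T^n = R^n / Z^n are Z^n-periodic functions on R^n,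
   integrated over the fundamental cell [-1/2, 1/2)^n. *)
Section wiener.
Context {R : realType} {n : nat}.
Implicit Types (f : n.-tuple R -> R[i]) (D : set (n.-tuple R)).

Definition torus_cell : set (n.-tuple R) :=
  [set x | forall i, tnth x i \in `[- 2^-1, 2^-1[].

Definition periodic f : Prop :=
  forall (x : n.-tuple R) (k : n.-tuple int),
    f [tuple tnth x i + (tnth k i)%:~R | i < n] = f x.

Definition fourier_coef f (nu : n.-tuple int) : R[i] :=
  complex_integral (tuple_lebesgue n) torus_cell
    (fun x => f x *
       expi (- (2 * pi * \sum_(i < n) (tnth nu i)%:~R * tnth x i))).

(* In R[i], 0 <= z means that z is real and nonnegative. *)
Definition L1plus f : Prop :=
  [/\ periodic f, complex_integrable (tuple_lebesgue n) torus_cell f &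
      forall nu, 0 <= fourier_coef f nu].

(* f = 0 as an element of L^1(T^n) *)
Definition torus_ae_zero f : Prop :=
  {ae tuple_lebesgue n, forall x, torus_cell x -> f x = 0}.

(* W_n(D), for D contained in the cell. Inversion in \bar R satisfies
   0^-1 = +oo, which gives the convention c / 0 = +oo for c > 0. *)
Definition wiener_constant D : \bar R :=
  ereal_sup [set r | exists f,
    [/\ L1plus f, ~ torus_ae_zero f,
        (sq_integral (tuple_lebesgue n) D f < +oo)%E &
        r = (sq_integral (tuple_lebesgue n) torus_cell f /
             ((tuple_lebesgue n D)^-1 *
              sq_integral (tuple_lebesgue n) D f))%E]].

Definition scaled_cube (delta : R) : set (n.-tuple R) :=
  [set x | forall i, tnth x i \in `[- delta, delta]].

End wiener.

Arguments torus_cell {R} n.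
Arguments scaled_cube {R} n delta.

Section turan.
Context {R : realType}.
Implicit Types (g : R -> R[i]) (delta : R).

Definition fourier_coef1 g (nu : int) : R[i] :=
  complex_integral (@lebesgue_measure R) `[- 2^-1, 2^-1[
    (fun x => g x * expi (- (2 * pi * (nu%:~R * x)))).

(* The functions g on T = R / Z, i.e. 1-periodic functions on R, admissible
   for [-delta, delta]. Integrability over T follows from continuity. The
   closed support in T, pulled back to R, is the closure in R of the set where
   g is nonzero; it has to lie in [-delta, delta] + Z. *)
Definition turan_admissible delta g : Prop :=
  [/\ forall x, g (x + 1) = g x,
      continuous (g : R -> (R[i] : numFieldType)),
      forall nu, 0 <= fourier_coef1 g nu,
      closure [set x | g x != 0] `<=`
        [set x | exists m : int, x - m%:~R \in `[- delta, delta]] &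
      g 0 = 1].

Definition turan delta : R :=
  sup [set complex.Re (fourier_coef1 g 0) | g in turan_admissible delta].

Definition theta delta : R := 1 - delta / turan delta.

End turan.

(* Main.v *)
Require Import Defs.
From HB Require Import structures.
From mathcomp Require Import all_boot all_order all_algebra.
From mathcomp Require Import all_classical all_reals all_analysis.
From mathcomp Require Import complex.
From mathcomp Require Import measurable_realfun.
From mathcomp Require Import ring lra zify.

(* If [g] is admissible for the periodic Turan problem, it is a uniform limit of
   cosine polynomials with nonnegative coefficients.  Hence, when the Fourier
   coefficients of [f] are nonnegative, expanding [|f|^2] term by term gives
   [ghat_0^n int |f|^2 <= int |f(x)|^2 g(x_1) ... g(x_n) dx <= int_D |f|^2],
   the last step because [|g| <= g(0) = 1]; optimising over [g] bounds the Wiener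
   constant.  Since [f] is only in [L^1], this is applied to trigonometric
   polynomials obtained by smoothing [f] with product kernels, on a slightly smaller
   cube, and [int |f|^2] is recovered by lower semicontinuity.

   The triangle function gives [turan dl >= dl].  If [dl = 1/q], positive
   definiteness at the points [j/q] gives equality; otherwise the triangle can be
   perturbed.  Sampling on a fine grid gives [turan dl <= dl + O(dl^3)].  Left
   continuity follows by interpolating piecewise linearly on a grid, right
   continuity by compactness. *)

Set Implicit Arguments.
Unset Strict Implicit.
Unset Printing Implicit Defensive.

Import Order.TTheory GRing.Theory Num.Theory.
Import numFieldNormedType.Exports.

Local Open Scope classical_set_scope.
Local Open Scope ring_scope.

(** * Cosine polynomials, positive definiteness and its quadratic form *)

Section cosine_polynomials.
Context {R : realType}.
Implicit Types (s : seq (R * int)) (x y m : R) (k l : int) (g t : R -> R).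

(** Two obstacles shape the argument. Square integrability of [f] outside the cube is part of the
    conclusion, so nothing beyond [L^1] may be assumed there: the smoothings converge to [f] in
    [L^1] only, and their energies are compared before the limit. Smoothing also spreads mass over a
    small distance, which a gap between a cube of half-width [d] and the given [dl] absorbs; left
    continuity of [turan] makes the loss from [dl] to [d] negligible, so continuity feeds the Wiener
    bound as well. On the Turan side the quantitative upper bounds evaluate the positive definite
    quadratic form at finitely many points, arranged so that many differences leave the support. For
    [dl = 1/q] the translates by multiples of [1/q] close up around the circle and the bound is
    sharp; in general a slowly varying weight replaces the missing periodicity, at the price of its
    Dirichlet energy, and this price is the cubic error. *)

Definition cosi k x : R := cos (2 * pi * (k%:~R * x)).
Definition sini k x : R := sin (2 * pi * (k%:~R * x)).

Lemma cosi0 x : cosi 0 x = 1.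
Proof. by rewrite /cosi mul0r mulr0 cos0. Qed.

Lemma sini0 x : sini 0 x = 0.
Proof. by rewrite /sini mul0r mulr0 sin0. Qed.

Lemma cosix0 k : cosi k 0 = 1.
Proof. by rewrite /cosi !mulr0 cos0. Qed.

Lemma cosi_le1 k x : `|cosi k x| <= 1.
Proof. exact: cos_max. Qed.

Lemma sini_le1 k x : `|sini k x| <= 1.
Proof. exact: sin_max. Qed.

Lemma cosiNk k x : cosi (- k) x = cosi k x.
Proof. by rewrite /cosi rmorphN mulNr mulrN cosN. Qed.

Lemma siniNk k x : sini (- k) x = - sini k x.
Proof. by rewrite /sini rmorphN mulNr mulrN sinN. Qed.

Lemma cosiN k x : cosi k (- x) = cosi k x.
Proof. by rewrite /cosi !mulrN cosN. Qed.

Lemma siniN k x : sini k (- x) = - sini k x.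
Proof. by rewrite /sini !mulrN sinN. Qed.

Lemma cosiD k x y :
  cosi k (x + y) = cosi k x * cosi k y - sini k x * sini k y.
Proof. by rewrite /cosi (mulrDr k%:~R) (mulrDr (2 * pi)) cosD. Qed.

Lemma cosiB k x y :
  cosi k (x - y) = cosi k x * cosi k y + sini k x * sini k y.
Proof. by rewrite cosiD cosiN siniN mulrN opprK. Qed.

Lemma siniD k x y :
  sini k (x + y) = sini k x * cosi k y + cosi k x * sini k y.
Proof. by rewrite /sini /cosi (mulrDr k%:~R) (mulrDr (2 * pi)) sinD. Qed.

Lemma cosi_addk k l x :
  cosi (k + l) x = cosi k x * cosi l x - sini k x * sini l x.
Proof. by rewrite /cosi rmorphD (mulrDl k%:~R) (mulrDr (2 * pi)) cosD. Qed.

Lemma sini_addk k l x :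
  sini (k + l) x = sini k x * cosi l x + cosi k x * sini l x.
Proof. by rewrite /sini rmorphD (mulrDl k%:~R) (mulrDr (2 * pi)) sinD. Qed.

Lemma cosi_mul k l x :
  cosi k x * cosi l x = 2^-1 * cosi (k + l) x + 2^-1 * cosi (k - l) x.
Proof. by rewrite !cosi_addk cosiNk siniNk; field. Qed.

Lemma cosi_mul_sini k l x :
  cosi k x * sini l x = 2^-1 * sini (k + l) x - 2^-1 * sini (k - l) x.
Proof. by rewrite !sini_addk cosiNk siniNk; field. Qed.

Lemma cos_sin_2pi_int k :
  cos (2 * pi * k%:~R) = 1 :> R /\ sin (2 * pi * k%:~R) = 0 :> R.
Proof.
have H (n : nat) : cos (2 * pi * n%:R) = 1 :> R /\ sin (2 * pi * n%:R) = 0 :> R.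
  have -> : 2 * pi * n%:R = 0 + (pi *+ 2) *+ n :> R.
    by rewrite add0r -[in RHS]mulr_natr -[pi *+ 2]mulr_natl.
  by split; [rewrite (periodicn (@cosD2pi R)) cos0
            |rewrite (periodicn (@sinD2pi R)) sin0].
case: k => n; first exact: H.
have [c s] := H n.+1.
by rewrite NegzE rmorphN mulrN cosN sinN; split; [|rewrite s oppr0].
Qed.

Lemma cosi_int k l : cosi k l%:~R = 1.
Proof. by rewrite /cosi -intrM; case: (cos_sin_2pi_int (k * l)). Qed.

Lemma sini_int k l : sini k l%:~R = 0.
Proof. by rewrite /sini -intrM; case: (cos_sin_2pi_int (k * l)). Qed.

Lemma cosi_per k x l : cosi k (x + l%:~R) = cosi k x.
Proof. by rewrite cosiD cosi_int sini_int mulr1 mulr0 subr0. Qed.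

Lemma sini_per k x l : sini k (x + l%:~R) = sini k x.
Proof. by rewrite siniD cosi_int sini_int mulr1 mulr0 addr0. Qed.

Lemma continuous_cosi k : continuous (cosi k).
Proof.
move=> x; apply: continuous_comp; last exact: continuous_cos.
by apply: cvgM; [exact: cvg_cst|apply: cvgM; [exact: cvg_cst|exact: cvg_id]].
Qed.

Lemma continuous_sini k : continuous (sini k).
Proof.
move=> x; apply: continuous_comp; last exact: continuous_sin.
by apply: cvgM; [exact: cvg_cst|apply: cvgM; [exact: cvg_cst|exact: cvg_id]].
Qed.

Definition cospoly s x := \sum_(p <- s) p.1 * cosi p.2 x.
Definition nnegp s := all (fun p => 0 <= p.1) s.
Definition ctp s : R := \sum_(p <- s | p.2 == 0) p.1.

Lemma continuous_cospoly s : continuous (cospoly s).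
Proof.
elim: s => [|p s ih] x.
  rewrite /cospoly; under eq_fun do rewrite big_nil.
  exact: cvg_cst.
rewrite /cospoly; under eq_fun do rewrite big_cons.
apply: cvgD; last exact: ih.
by apply: cvgM; [exact: cvg_cst|exact: continuous_cosi].
Qed.

Lemma cospoly_per s x k : cospoly s (x + k%:~R) = cospoly s x.
Proof. by apply: eq_bigr => p _; rewrite cosi_per. Qed.

Lemma cospolyN s x : cospoly s (- x) = cospoly s x.
Proof. by apply: eq_bigr => p _; rewrite cosiN. Qed.

(** The frequency [k] contributes its coefficient times the squared modulus of the exponential sum
    of the [c i] at the [x i]: nonnegative for every [k], and exactly the square of the sum of the
    [c i] when [k = 0]. *)
Lemma cospoly_ineq s (I : finType) (c x : I -> R) : nnegp s ->
  ctp s * (\sum_i c i) ^+ 2 <=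
  \sum_i \sum_j c i * c j * cospoly s (x i - x j).
Proof.
move=> /allP s0.
have E (p : R * int) :
   \sum_i \sum_j c i * c j * (p.1 * cosi p.2 (x i - x j)) =
   p.1 * ((\sum_i c i * cosi p.2 (x i)) ^+ 2 +
          (\sum_i c i * sini p.2 (x i)) ^+ 2).
  rewrite !expr2 !mulr_suml -big_split mulr_sumr; apply: eq_bigr => i _ /=.
  rewrite !mulr_sumr -big_split mulr_sumr; apply: eq_bigr => j _ /=.
  by rewrite cosiB; ring.
have -> : \sum_i \sum_j c i * c j * cospoly s (x i - x j) =
   \sum_(p <- s) \sum_i \sum_j c i * c j * (p.1 * cosi p.2 (x i - x j)).
  rewrite [RHS]exchange_big; apply: eq_bigr => i _ /=.
  by rewrite [RHS]exchange_big; apply: eq_bigr => j _; rewrite mulr_sumr.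
rewrite /ctp mulr_suml big_mkcond /= big_seq [leRHS]big_seq.
apply: ler_sum => p /s0 p0; rewrite E; case: eqP => [->|_]; last first.
  by rewrite mulr_ge0 // addr_ge0 // sqr_ge0.
rewrite [X in _ <= _ * (X ^+ 2 + _)](eq_bigr c) => [|i _]; last first.
  by rewrite cosi0 mulr1.
by rewrite ler_wpM2l // lerDl sqr_ge0.
Qed.

(* The mean of a continuous function with nonnegative Fourier coefficients is
   its constant term; [m] only needs to be a lower bound for it. *)
Definition posdef m g : Prop := forall e : R, 0 < e ->
  exists s, [/\ nnegp s, m <= ctp s & forall x, `|g x - cospoly s x| <= e].

(** Passing to the limit in [cospoly_ineq] costs at most the uniform error times the sum of the
    [|c i * c j|]. Bounds on the Turan value come from this inequality by choosing points whose
    differences mostly leave the support. *)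
Lemma posdef_ineq m g (I : finType) (c x : I -> R) : posdef m g ->
  m * (\sum_i c i) ^+ 2 <= \sum_i \sum_j c i * c j * g (x i - x j).
Proof.
move=> pg; apply/ler_addgt0Pr => e e0.
pose A := \sum_i \sum_j `|c i * c j|.
have A0 : 0 <= A by apply: sumr_ge0 => i _; apply: sumr_ge0.
have A1 : 0 < A + 1 by rewrite ltr_wpDl.
have [s [s0 ms gs]] := pg (e / (A + 1)) (divr_gt0 e0 A1).
apply: (@le_trans _ _ (ctp s * (\sum_i c i) ^+ 2)).
  by rewrite ler_wpM2r // sqr_ge0.
apply: (le_trans (cospoly_ineq c x s0)).
rewrite -lerBlDl -sumrB.
under eq_bigr do rewrite -sumrB.
apply: (@le_trans _ _ (\sum_i \sum_j `|c i * c j| * (e / (A + 1)))).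
  apply: ler_sum => i _; apply: ler_sum => j _; rewrite -mulrBr.
  apply: (le_trans (ler_norm _)); rewrite normrM ler_wpM2l //.
  by rewrite distrC.
under eq_bigr do rewrite -mulr_suml.
rewrite -mulr_suml mulrCA ler_piMr ?(ltW e0) // ler_pdivrMr // mul1r -/A.
by rewrite lerDl.
Qed.

Lemma posdef_le m m' g : m' <= m -> posdef m g -> posdef m' g.
Proof.
move=> mm' pg e /pg[s [s0 ms gs]]; exists s; split => //.
exact: le_trans ms.
Qed.

Lemma posdef_per m g x k : posdef m g -> g (x + k%:~R) = g x.
Proof.
move=> pg; apply/eqP; rewrite -subr_eq0 -normr_le0; apply/ler_addgt0Pr => e e0; rewrite add0r.
have e2 : 0 < e / 2 by rewrite divr_gt0.
have [s [_ _ gs]] := pg _ e2.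
have := gs x; have := gs (x + k%:~R); rewrite cospoly_per !ler_norml.
by lra.
Qed.

Lemma posdef_even m g x : posdef m g -> g (- x) = g x.
Proof.
move=> pg; apply/eqP; rewrite -subr_eq0 -normr_le0; apply/ler_addgt0Pr => e e0; rewrite add0r.
have e2 : 0 < e / 2 by rewrite divr_gt0.
have [s [_ _ gs]] := pg _ e2.
have := gs x; have := gs (- x); rewrite cospolyN !ler_norml.
by lra.
Qed.

Lemma posdef_continuous m g : posdef m g -> continuous g.
Proof.
move=> pg x; apply/cvgrPdist_le => e e0.
have e3 : 0 < e / 3 by rewrite divr_gt0.
have [s [_ _ gs]] := pg (e / 3) e3.
have /cvgrPdist_le /(_ _ e3) := @continuous_cospoly s x.
apply: filterS => y; have := gs x; have := gs y.
by rewrite !ler_norml; lra.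
Qed.

Lemma posdef_le0 m g : posdef m g -> m <= g 0.
Proof.
move=> /(posdef_ineq (fun _ : 'I_1 => 1) (fun=> 0)).
by rewrite !big_ord1 expr1n !mulr1 mul1r subr0.
Qed.

(** The quadratic form at the two points [0] and [x] with weights [1] and [a], for [a = 1] and
    [a = -1]; evenness merges the two cross terms. *)
Lemma posdef_bound m g x : 0 <= m -> posdef m g -> `|g x| <= g 0.
Proof.
move=> m0 pg.
have H (a : R) : 0 <= (1 + a ^+ 2) * g 0 + 2 * a * g x.
  have := posdef_ineq (fun i : 'I_2 => if i == 0 then 1 else a)
                      (fun i : 'I_2 => if i == 0 then x else 0) pg.
  rewrite !big_ord_recl !big_ord0 /= !addr0 !subrr subr0 sub0r (posdef_even _ pg).
  have := mulr_ge0 m0 (sqr_ge0 (1 + a)).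
  lra.
by have := H 1; have := H (-1); rewrite ler_norml; lra.
Qed.

Lemma posdef_scale m g a : 0 <= a -> posdef m g ->
  posdef (a * m) (fun x => a * g x).
Proof.
move=> a0 pg e e0.
have a1 : 0 < a + 1 by rewrite ltr_wpDl.
have [s [s0 ms gs]] := pg (e / (a + 1)) (divr_gt0 e0 a1).
exists [seq (a * p.1, p.2) | p <- s]; split.
- rewrite /nnegp all_map; apply/allP => p /(allP s0) p0 /=.
  exact: mulr_ge0.
- by rewrite /ctp big_map /= -mulr_sumr ler_wpM2l.
- move=> x; rewrite /cospoly big_map /=.
  under eq_bigr do rewrite -mulrA.
  rewrite -mulr_sumr -mulrBr normrM (ger0_norm a0).
  apply: (le_trans (ler_wpM2l a0 (gs x))).
  by rewrite mulrCA ler_piMr ?(ltW e0) // ler_pdivrMr // mul1r lerDl.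
Qed.

(** * Sampling on the grid of step 1/P *)

Section grid.
Variable P : nat.
Hypothesis P0 : (0 < P)%N.
Let gp (j : nat) : R := j%:R / P%:R.

Let gridC k := \sum_(j < P) cosi k (gp j).
Let gridS k := \sum_(j < P) sini k (gp j).

Let P0r : P%:R != 0 :> R. Proof. by rewrite pnatr_eq0 -lt0n. Qed.

Lemma grid_shift (f : R -> R) : f (gp P) = f (gp 0) ->
  \sum_(j < P) f (gp j.+1) = \sum_(j < P) f (gp j).
Proof.
case: P P0 gp => // P' _ gp' E; rewrite big_ord_recr /= E.
by rewrite [RHS]big_ord_recl /= addrC.
Qed.

(* The sum of e(kj/P) over j is invariant under multiplication by e(k/P). *)
Lemma grid_sums k : gridS k = 0 /\ 0 <= gridC k.
Proof.
pose c := cosi k (gp 1); pose s := sini k (gp 1).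
have gS j : gp j.+1 = gp j + gp 1 by rewrite /gp -mulrDl -natr1.
have gP : gp P = 1%:~R by rewrite /gp divff.
have g0 : gp 0 = 0%:~R by rewrite /gp mul0r.
have EC : gridC k = gridC k * c - gridS k * s.
  rewrite {1}/gridC -grid_shift; last by rewrite gP g0 !cosi_int.
  by rewrite !mulr_suml -sumrB; apply: eq_bigr => j _; rewrite gS cosiD.
have ES : gridS k = gridS k * c + gridC k * s.
  rewrite {1}/gridS -grid_shift; last by rewrite gP g0 !sini_int.
  by rewrite !mulr_suml -big_split; apply: eq_bigr => j _; rewrite gS siniD.
have cs : c ^+ 2 + s ^+ 2 = 1 by exact: cos2Dsin2.
have [c1|c1] := eqVneq c 1.
  have s1 : s = 0.
    by apply/eqP; rewrite -sqrf_eq0; apply/eqP; move: cs; rewrite c1; lra.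
  have H j : cosi k (gp j) = 1 /\ sini k (gp j) = 0.
    elim: j => [|j [IC IS]]; first by rewrite g0 cosi_int sini_int.
    by rewrite gS cosiD siniD IC IS -/c -/s c1 s1; split; ring.
  split; first by rewrite /gridS big1 // => j _; case: (H j).
  by apply: sumr_ge0 => j _; case: (H j) => ->.
have Z : (1 - c) * (gridC k ^+ 2 + gridS k ^+ 2) = 0.
  transitivity (gridC k * (gridC k - gridC k * c) +
                gridS k * (gridS k - gridS k * c)); first by ring.
  have -> : gridC k - gridC k * c = - (gridS k * s) by lra.
  have -> : gridS k - gridS k * c = gridC k * s by lra.
  by ring.
move/eqP: Z; rewrite mulf_eq0 subr_eq0 eq_sym (negbTE c1) /=.
rewrite paddr_eq0 ?sqr_ge0 // !sqrf_eq0 => /andP[/eqP -> /eqP ->].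
by split.
Qed.

(** Discrete convolution on the grid maps a cosine to a multiple of itself: the sine term that could
    appear has as coefficient a grid sum of products of a cosine and a sine, which is zero. *)
Lemma grid_cospoly k l x :
  \sum_(j < P) cosi k (gp j) * cosi l (x - gp j) =
  (\sum_(j < P) cosi k (gp j) * cosi l (gp j)) * cosi l x.
Proof.
transitivity (\sum_(j < P) (cosi k (gp j) * cosi l (gp j)) * cosi l x +
              \sum_(j < P) (cosi k (gp j) * sini l (gp j)) * sini l x).
  by rewrite -big_split; apply: eq_bigr => j _; rewrite cosiB /=; ring.
rewrite -!mulr_suml [X in _ + X * _](_ : _ = 0) ?mul0r ?addr0 //.
under eq_bigr do rewrite cosi_mul_sini.
by rewrite sumrB -!mulr_sumr -!/(gridS _) !(grid_sums _).1 !mulr0 subrr.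
Qed.

Lemma grid_coef_ge0 k l : 0 <= \sum_(j < P) cosi k (gp j) * cosi l (gp j).
Proof.
under eq_bigr do rewrite cosi_mul.
rewrite big_split -!mulr_sumr -!/(gridC _) addr_ge0 // mulr_ge0 ?invr_ge0 //;
  exact: (grid_sums _).2.
Qed.

(** Sampling [g] on the grid and convolving with [t] sends each pair of frequencies to the frequency
    of [t], with a nonnegative weight. The factor [P] in the mean is that weight at the pair
    [(0, 0)]; aliasing can only add more. *)
Lemma posdef_grid m m' g t : 0 <= m -> 0 <= m' -> posdef m g -> posdef m' t ->
  posdef (P%:R * m * m') (fun x => \sum_(j < P) g (gp j) * t (x - gp j)).
Proof.
move=> m0 m'0 pg pt e e0.
have g0 : 0 <= g 0 by apply: le_trans (posdef_le0 pg).
have t0 : 0 <= t 0 by apply: le_trans (posdef_le0 pt).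
pose B := P%:R * (g 0 + t 0 + 1).
have B0 : 0 < B by rewrite mulr_gt0 ?ltr0n // ltr_wpDl // addr_ge0.
(* The cap at [1] bounds the approximant of [t] by [t 0 + 1], so the errors of both factors are
   multiplied by known constants. *)
pose e1 := Num.min 1 (e / B).
have e1_gt0 : 0 < e1 by rewrite lt_min ltr01 divr_gt0.
have [s [s0 ms gs]] := pg _ e1_gt0.
have [s' [s'0 ms' ts]] := pt _ e1_gt0.
pose E k l := \sum_(j < P) cosi k (gp j) * cosi l (gp j).
exists [seq (p.1 * q.1 * E p.2 q.2, q.2) | p <- s, q <- s']; split.
- apply/allP => _ /allpairsP[[p q] /= [/(allP s0) p0 /(allP s'0) q0 ->]] /=.
  by rewrite !mulr_ge0 // grid_coef_ge0.
- rewrite /ctp big_mkcond big_allpairs_dep /=.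
  apply: (@le_trans _ _ (P%:R * ctp s * ctp s')).
    by rewrite ler_pM // ?mulr_ge0 // ?ler_wpM2l.
  rewrite -mulrA mulrCA mulr_suml big_mkcond /= big_seq [leRHS]big_seq.
  apply: ler_sum => p /(allP s0) p0.
  rewrite -big_mkcond /=.
  have [p2|_] := eqVneq p.2 0; last first.
    rewrite big_seq_cond; apply: sumr_ge0 => q /andP[/(allP s'0) q0 _].
    by rewrite !mulr_ge0 // grid_coef_ge0.
  rewrite /ctp !mulr_sumr le_eqVlt; apply/orP; left; apply/eqP.
  apply: eq_bigr => q /eqP q2; rewrite p2 q2 /E.
  under eq_bigr do rewrite cosi0 mulr1.
  by rewrite sumr_const card_ord; ring.
- move=> x.
  have -> : cospoly [seq (p.1 * q.1 * E p.2 q.2, q.2) | p <- s, q <- s'] x =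
     \sum_(j < P) cospoly s (gp j) * cospoly s' (x - gp j).
    rewrite /cospoly big_allpairs_dep /=.
    under [RHS]eq_bigr do rewrite mulr_suml.
    rewrite [RHS]exchange_big; apply: eq_bigr => p _.
    under [RHS]eq_bigr do rewrite mulr_sumr.
    rewrite [RHS]exchange_big; apply: eq_bigr => q _.
    rewrite -mulrA -grid_cospoly mulr_sumr.
    by apply: eq_bigr => j _; ring.
  rewrite -sumrB; apply: (le_trans (ler_norm_sum _ _ _)).
  apply: (@le_trans _ _ (\sum_(j < P) (g 0 + t 0 + 1) * e1)).
    apply: ler_sum => j _.
    set a := g _; set b := t _; set p := cospoly s _; set q := cospoly s' _.
    have -> : a * b - p * q = a * (b - q) + q * (a - p) by ring.
    apply: (le_trans (ler_normD _ _)); rewrite !normrM.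
    have Ha : `|a| <= g 0 by exact: posdef_bound pg.
    have Hq : `|q| <= t 0 + 1.
      have -> : q = b - (b - q) by ring.
      apply: (le_trans (ler_normB _ _)); apply: lerD.
        exact: posdef_bound pt.
      by apply: (le_trans (ts _)); rewrite ge_min lexx.
    by rewrite -addrA mulrDl lerD // ler_pM // (gs, ts).
  rewrite sumr_const card_ord -mulr_natl mulrA -/B.
  by rewrite -ler_pdivlMl // mulrC ge_min lexx orbT.
Qed.

End grid.
End cosine_polynomials.

(** * The distance to the nearest integer *)

Section distance_to_integers.
Context {R : realType}.
Implicit Types (x y : R) (k : int).

Definition rnd x : int := Num.floor (x + 2^-1).
Definition dZ x : R := `|x - (rnd x)%:~R|.

Lemma rnd_itv x : - 2^-1 <= x - (rnd x)%:~R < 2^-1.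
Proof.
have := floor_itv (x + 2^-1); rewrite -/(rnd x) intrD => /andP[].
set r := (rnd x)%:~R; move=> A B; rewrite (_ : 1%:~R = 1) // in B.
by lra.
Qed.

Lemma dZ_le_half x : dZ x <= 2^-1.
Proof. by have := rnd_itv x; rewrite /dZ ler_norml; lra. Qed.

Lemma dZ_ge0 x : 0 <= dZ x. Proof. exact: normr_ge0. Qed.

Lemma dZ_le x k : dZ x <= `|x - k%:~R|.
Proof.
have [->|nk] := eqVneq k (rnd x); first by [].
have h := rnd_itv x.
have : (1 <= `|k - rnd x|)%R by rewrite -gtz0_ge1 normr_gt0 subr_eq0.
rewrite -(ler_int R) intr_norm rmorphB /= => H.
apply: (le_trans (dZ_le_half x)).
rewrite (_ : 1%:~R = 1) // in H.
have -> : x - k%:~R = - ((k%:~R - (rnd x)%:~R) - (x - (rnd x)%:~R)) :> R by ring.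
rewrite normrN; move: H h.
set a := _ - _; set b := _ - _ => H h.
have := lerB_dist a b; have : `|b| <= 2^-1 by rewrite ler_norml; lra.
lra.
Qed.

Lemma dZ_norm x : `|x| <= 2^-1 -> dZ x = `|x|.
Proof.
move=> hx; apply/eqP; rewrite eq_le; apply/andP; split.
  by have := dZ_le x 0; rewrite subr0.
rewrite /dZ; have [->|nk] := eqVneq (rnd x) 0; first by rewrite subr0.
apply: (le_trans hx).
have : (1 <= `|rnd x|)%R by rewrite -gtz0_ge1 normr_gt0.
rewrite -(ler_int R) intr_norm (_ : 1%:~R = 1) // distrC => H.
have := lerB_dist (rnd x)%:~R x; lra.
Qed.

Lemma dZ_addz x k : dZ (x + k%:~R) = dZ x.
Proof.
apply/eqP; rewrite eq_le; apply/andP; split.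
  have := dZ_le (x + k%:~R) (rnd x + k); rewrite intrD.
  by rewrite (_ : _ - _ = x - (rnd x)%:~R) //; ring.
have := dZ_le x (rnd (x + k%:~R) - k); rewrite rmorphB /=.
by rewrite (_ : x - _ = x + k%:~R - (rnd (x + k%:~R))%:~R) //; ring.
Qed.

Lemma dZN x : dZ (- x) = dZ x.
Proof.
have H y : dZ (- y) <= dZ y.
  have := dZ_le (- y) (- rnd y); rewrite rmorphN /=.
  by rewrite -opprD normrN.
by apply/eqP; rewrite eq_le H -{1}(opprK x) H.
Qed.

Lemma dZD x y : dZ (x + y) <= dZ x + dZ y.
Proof.
have := dZ_le (x + y) (rnd x + rnd y); rewrite intrD.
rewrite (_ : _ - _ = (x - (rnd x)%:~R) + (y - (rnd y)%:~R)); last by ring.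
by move/le_trans; apply; exact: ler_normD.
Qed.

Lemma dZ_dist x y : `|dZ x - dZ y| <= `|x - y|.
Proof.
have H a b : dZ a - dZ b <= `|a - b|.
  rewrite lerBlDr (le_trans _ (lerD (_ : dZ (a - b) <= _) (lexx _))) //.
    by rewrite -[in leLHS](subrK b a) dZD.
  by have := dZ_le (a - b) 0; rewrite subr0.
by rewrite ler_norml H lerNl opprB distrC H.
Qed.

Lemma continuous_dZ : continuous dZ.
Proof.
move=> x; apply/cvgrPdist_le => e e0; near=> y.
apply: (le_trans (dZ_dist _ _)); near: y.
exact: cvgr_dist_le.
Unshelve. all: end_near. Qed.

Lemma cosi_dZ k x : cosi k (dZ x) = cosi k x.
Proof.
rewrite /dZ; set y := x - _.
have -> : cosi k `|y| = cosi k y.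
  by case: (ger0P y) => _; rewrite ?cosiN.
by rewrite /y -rmorphN cosi_per.
Qed.

Lemma cosi1_lt x y : 0 <= x <= 2^-1 -> 0 <= y <= 2^-1 ->
  (cosi 1 x < cosi 1 y) = (y < x).
Proof.
move=> hx hy; have pi0 := pi_gt0 R.
have H (z : R) : 0 <= z <= 2^-1 -> 2 * pi * (1%:~R * z) \in `[0, pi].
  move=> /andP[z0 z1]; rewrite in_itv /= mul1r.
  have := mulr_ge0 (ltW pi0) z0; have := ler_wpM2l (ltW pi0) z1.
  by lra.
by rewrite /cosi ltr_cos ?H // !mul1r ltr_pM2l // mulr_gt0.
Qed.

Lemma cosi1_le_dZ x (h : R) : 0 <= h -> h <= dZ x -> cosi 1 x <= cosi 1 h.
Proof.
move=> h0 hd; rewrite -cosi_dZ leNgt cosi1_lt -?leNgt //.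
  by rewrite h0 (le_trans hd) ?dZ_le_half.
by rewrite dZ_ge0 dZ_le_half.
Qed.

End distance_to_integers.

(** * Integration over the unit cell *)

Section unit_cell.
Context {R : realType}.
Notation mu := (@lebesgue_measure R).
Implicit Types (f g F : R -> R).
Local Notation cell := (`[(- 2^-1)%R, 2^-1%R[ : set R).

Definition int1 f : R := \int[mu]_(x in `[- 2^-1, 2^-1[) f x.

Lemma cell_measure : mu `[- 2^-1, 2^-1[ = 1%E.
Proof.
rewrite lebesgue_measure_itv /= lte_fin.
have -> : (- 2^-1 < 2^-1 :> R) by lra.
by rewrite -EFinB; congr EFin; lra.
Qed.

Lemma continuous_integrable f (a b : R) : continuous f ->
  mu.-integrable `[a, b] (EFin \o f).
Proof.
move=> cf; apply: continuous_compact_integrable.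
  exact: segment_compact.
exact: continuous_subspaceT.
Qed.

Lemma cell_integrable f : continuous f ->
  mu.-integrable `[- 2^-1, 2^-1[ (EFin \o f).
Proof.
move=> cf; apply: (integrableS _ _ _ (continuous_integrable (- 2^-1) 2^-1 cf)) => //.
by apply: subset_itvl; rewrite bnd_simp.
Qed.

Lemma cell_integrableS f (i : interval R) : continuous f ->
  ([set` i] `<=` (`[- 2^-1, 2^-1[ : set R))%classic ->
  mu.-integrable [set` i] (EFin \o f).
Proof. by move=> cf sub; apply: (integrableS _ _ _ (cell_integrable cf)) => //. Qed.

Lemma int1_cst (c : R) : int1 (fun=> c) = c.
Proof. by rewrite /int1 Rintegral_cst // [X in fine X]cell_measure mulr1. Qed.

Lemma int1D f g : continuous f -> continuous g ->
  int1 (fun x => f x + g x) = int1 f + int1 g.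
Proof. by move=> cf cg; rewrite /int1 RintegralD //; exact: cell_integrable. Qed.

Lemma int1B f g : continuous f -> continuous g ->
  int1 (fun x => f x - g x) = int1 f - int1 g.
Proof. by move=> cf cg; rewrite /int1 RintegralB //; exact: cell_integrable. Qed.

Lemma int1Z f (c : R) : continuous f -> int1 (fun x => c * f x) = c * int1 f.
Proof. by move=> cf; rewrite /int1 RintegralZl //; exact: cell_integrable. Qed.

Lemma le_int1 f g : continuous f -> continuous g ->
  (forall x, `|x| <= 2^-1 -> f x <= g x) -> int1 f <= int1 g.
Proof.
move=> cf cg fg; apply: le_Rintegral => //; try exact: cell_integrable.
by move=> x /=; rewrite in_itv /= => hx; apply: fg; rewrite ler_norml; lra.
Qed.

Lemma eq_int1 f g : (forall x, `|x| <= 2^-1 -> f x = g x) -> int1 f = int1 g.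
Proof.
move=> fg; apply: eq_Rintegral => x; rewrite inE /= in_itv /= => hx.
by apply: fg; rewrite ler_norml; lra.
Qed.

Lemma int1_norm_le f (c : R) : continuous f ->
  (forall x, `|x| <= 2^-1 -> `|f x| <= c) -> `|int1 f| <= c.
Proof.
move=> cf fc; rewrite ler_norml; apply/andP; split.
  rewrite -(int1_cst (- c)); apply: le_int1 => //.
    by move=> ?; exact: cvg_cst.
  by move=> x /fc; rewrite ler_norml => /andP[].
rewrite -(int1_cst c); apply: le_int1 => //.
  by move=> ?; exact: cvg_cst.
by move=> x /fc; rewrite ler_norml => /andP[].
Qed.

Lemma continuous_sum (I : Type) (r : seq I) (F : I -> R -> R) :
  (forall i, continuous (F i)) -> continuous (fun x => \sum_(i <- r) F i x).
Proof.
move=> cF; elim: r => [|i r ih] x.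
  by under eq_fun do rewrite big_nil; exact: cvg_cst.
by under eq_fun do rewrite big_cons; apply: cvgD; [exact: cF|exact: ih].
Qed.

Lemma continuous_mul f g : continuous f -> continuous g ->
  continuous (fun x => f x * g x).
Proof. by move=> cf cg x; apply: cvgM; [exact: cf|exact: cg]. Qed.

Lemma continuous_Z f (c : R) : continuous f -> continuous (fun x => c * f x).
Proof. by move=> cf x; apply: cvgM; [exact: cvg_cst|exact: cf]. Qed.

Lemma continuous_add f g : continuous f -> continuous g ->
  continuous (fun x => f x + g x).
Proof. by move=> cf cg x; apply: cvgD; [exact: cf|exact: cg]. Qed.

Lemma continuous_sub f g : continuous f -> continuous g ->
  continuous (fun x => f x - g x).
Proof. by move=> cf cg x; apply: cvgB; [exact: cf|exact: cg]. Qed.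

Lemma continuous_cstf (c : R) : continuous (fun _ : R => c).
Proof. by move=> x; exact: cvg_cst. Qed.

Lemma int1_sum (I : Type) (r : seq I) (F : I -> R -> R) :
  (forall i, continuous (F i)) ->
  int1 (fun x => \sum_(i <- r) F i x) = \sum_(i <- r) int1 (F i).
Proof.
move=> cF; elim: r => [|i r ih].
  rewrite big_nil -[RHS](int1_cst 0).
  by apply: eq_int1 => x _; rewrite big_nil.
rewrite big_cons -ih -int1D //; last exact: continuous_sum.
by apply: eq_int1 => x _; rewrite big_cons.
Qed.

Lemma Rintegral_FTC f F (a b : R) : a < b -> continuous f ->
  (forall x : R, is_derive x 1 F (f x)) ->
  \int[mu]_(x in `[a, b]) f x = F b - F a.
Proof.
move=> ab cf dF.
have cF : continuous F.
  move=> x; apply/differentiable_continuous/derivable1_diffP.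
  by have [] := dF x.
rewrite /Rintegral (@continuous_FTC2 _ f F) //.
- exact: continuous_subspaceT.
- split.
  + by move=> x _; have [] := dF x.
  + by apply: cvg_at_right_filter; exact: cF.
  + by apply: cvg_at_left_filter; exact: cF.
- by move=> x _; rewrite derive1E; have [] := dF x.
Qed.

Lemma int1_FTC f F : continuous f -> (forall x : R, is_derive x 1 F (f x)) ->
  int1 f = F 2^-1 - F (- 2^-1).
Proof.
move=> cf dF; rewrite /int1 Rintegral_itv_bndo_bndc; last exact: cell_integrable.
by apply: Rintegral_FTC => //; lra.
Qed.

Lemma int1_cosi k : int1 (cosi k) = (k == 0)%:R.
Proof.
have [->|k0] := eqVneq k 0.
  by rewrite -[RHS](int1_cst 1); apply: eq_int1 => x _; rewrite cosi0.
pose c : R := 2 * pi * k%:~R.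
have c0 : c != 0.
  by rewrite !mulf_neq0 ?intr_eq0 // gt_eqF ?pi_gt0.
have E x : cosi k x = cos (c * x) by rewrite /cosi /c !mulrA.
have D (x : R) : is_derive x 1 (fun x => c^-1 * sin (c * x)) (cosi k x).
  rewrite E; apply: is_derive_eq.
  by rewrite /GRing.scale /= mulr1 mulrCA mulVf ?mulr1.
rewrite (int1_FTC (@continuous_cosi _ k) D).
have ES x : sin (c * x) = sini k x by rewrite /sini /c !mulrA.
rewrite !ES -(sini_per k (- 2^-1) 1) (_ : - 2^-1 + 1%:~R = 2^-1) ?subrr //.
by rewrite (_ : 1%:~R = 1) //; lra.
Qed.

Lemma int1_sini k : int1 (sini k) = 0.
Proof.
have [->|k0] := eqVneq k 0.
  by rewrite -[RHS](int1_cst 0); apply: eq_int1 => x _; rewrite sini0.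
pose c : R := 2 * pi * k%:~R.
have c0 : c != 0.
  by rewrite !mulf_neq0 ?intr_eq0 // gt_eqF ?pi_gt0.
have E x : sini k x = sin (c * x) by rewrite /sini /c !mulrA.
have D (x : R) : is_derive x 1 (fun x => - c^-1 * cos (c * x)) (sini k x).
  rewrite E; apply: is_derive_eq.
  rewrite /GRing.scale /= mulr1 mulNr -mulrN mulNr opprK mulrCA mulVf ?mulr1 //.
rewrite (int1_FTC (@continuous_sini _ k) D).
by rewrite mulrN cosN subrr.
Qed.

End unit_cell.

(** * Cosine kernels and the Fourier characterisation of positive definiteness *)

Section cosine_kernels.
Context {R : realType}.
Notation mu := (@lebesgue_measure R).
Implicit Types (s : seq (R * int)) (x y : R) (k : int) (f u : R -> R).

Lemma int1_cospoly s : int1 (cospoly s) = ctp s.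
Proof.
rewrite /cospoly int1_sum => [|p]; last by apply: continuous_Z; exact: continuous_cosi.
rewrite /ctp [RHS]big_mkcond; apply: eq_bigr => p _.
rewrite int1Z; last exact: continuous_cosi.
by rewrite int1_cosi; case: eqP => _; rewrite ?mulr1 ?mulr0.
Qed.

Lemma cospolyM s t : nnegp s -> nnegp t ->
  exists2 r, nnegp r & forall x, cospoly r x = cospoly s x * cospoly t x.
Proof.
move=> s0 t0.
exists (flatten [seq [:: (2^-1 * (p.1 * q.1), p.2 + q.2);
                         (2^-1 * (p.1 * q.1), p.2 - q.2)] | p <- s, q <- t]).
  apply/allP => z /flattenP[l /allpairsP[[p q] /= [ps qt ->]]].
  have /(allP s0) p0 := ps; have /(allP t0) q0 := qt.
  by rewrite !inE => /orP[] /eqP -> /=; rewrite !mulr_ge0.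
move=> x; rewrite /cospoly big_flatten /= big_allpairs_dep /=.
rewrite mulr_suml; apply: eq_bigr => p _; rewrite mulr_sumr.
apply: eq_bigr => q _; rewrite !big_cons big_nil addr0 /=.
rewrite [RHS]mulrACA cosi_mul; ring.
Qed.

Lemma cospolyX s n : nnegp s ->
  exists2 r, nnegp r & forall x, cospoly r x = cospoly s x ^+ n.
Proof.
move=> s0; elim: n => [|n [r r0 rE]].
  exists [:: (1, 0%Z)]; first by rewrite /nnegp /= ler01.
  by move=> x; rewrite /cospoly big_seq1 /= cosi0 mulr1 expr0.
have [q q0 qE] := cospolyM s0 r0; exists q => // x.
by rewrite qE rE exprS.
Qed.

Lemma int1_ge f (a c : R) : 0 < a <= 2^-1 -> 0 <= c -> continuous f ->
  (forall x, 0 <= f x) -> (forall x, `|x| < a -> c <= f x) ->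
  c * a <= int1 f.
Proof.
move=> /andP[a0 a1] c0 cf f0 fc.
have sub : (`[0, a[ `<=` (`[- 2^-1, 2^-1[ : set R))%classic.
  by move=> x /=; rewrite !in_itv /=; lra.
apply: (@le_trans _ _ (\int[mu]_(x in `[0, a[) f x)).
  have -> : c * a = \int[mu]_(x in `[0, a[) c.
    rewrite Rintegral_cst //; congr (_ * _).
    rewrite [X in fine X](lebesgue_measure_itv `[0, a[) /= lte_fin a0.
    by rewrite -EFinB subr0.
  apply: le_Rintegral => //.
  - by apply: (@cell_integrableS _ (fun=> c)) => // x; exact: cvg_cst.
  - exact: cell_integrableS.
  - move=> x; rewrite /= in_itv /= => /andP[x0 xa].
    by apply: fc; rewrite ger0_norm.
rewrite /int1 /Rintegral fine_le //.
- by apply: integrable_fin_num => //; exact: cell_integrableS.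
- by apply: integrable_fin_num => //; exact: cell_integrable.
- apply: ge0_subset_integral => //.
    exact: (measurable_int mu (cell_integrable cf)).
  by move=> x _; rewrite lee_fin.
Qed.

(* The kernels [((1 + cos (2 pi x)) / 2) ^+ N], normalised to have mean 1. *)
Lemma cosine_kernel (n : nat) (h e : R) : 0 < h -> 0 < e ->
  exists s M, [/\ nnegp s, ctp s = 1, forall x, 0 <= cospoly s x <= M &
    forall x, h <= dZ x -> cospoly s x * M ^+ n <= e].
Proof.
move=> h0 e0.
pose b0 : seq (R * int) := [:: (2^-1, 0%Z); (2^-1, 1%Z)].
have b00 : nnegp b0 by rewrite /nnegp /= invr_ge0 ler0n.
pose b := cospoly b0.
have bE x : b x = (1 + cosi 1 x) / 2.
  by rewrite /b /cospoly !big_cons big_nil cosi0 /=; field.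
have b_ge0 x : 0 <= b x by rewrite bE; have := cos_geN1 (2 * pi * (1%:~R * x)); rewrite /cosi; lra.
have b_le1 x : b x <= 1 by rewrite bE; have := cos_le1 (2 * pi * (1%:~R * x)); rewrite /cosi; lra.
have cb : continuous b := @continuous_cospoly _ b0.
pose h' := Num.min h 2^-1.
have h'0 : 0 < h' by rewrite lt_min h0 invr_gt0 ltr0n.
have h'1 : h' <= 2^-1 by rewrite ge_min lexx orbT.
pose r1 := b h'.
have r10 : 0 <= r1 := b_ge0 _.
have r11 : r1 < 1.
  rewrite /r1 bE; have : cosi 1 h' < cosi 1 0.
    by rewrite cosi1_lt // ?lexx ?invr_ge0 ?ler0n // ltW //= h'1.
  by rewrite cosix0; lra.
(* [r1] bounds the base function above away from the integers, [r2] bounds it below near [0]. After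
   normalisation the tail times [M ^+ n] is at most a constant times [(r1 / r2 ^+ n.+1) ^+ N], so
   [r1 < r2 ^+ n.+1] is needed; Bernoulli's inequality gives it for this [r2]. *)
pose r2 := 1 - (1 - r1) / (2 * n.+1%:R).
have n0 : 0 < 2 * n.+1%:R :> R by rewrite mulr_gt0 ?ltr0n.
have n2 : 2 <= 2 * n.+1%:R :> R by rewrite ler_peMr // ler1n.
have r20 : 0 < r2.
  rewrite /r2 subr_gt0 ltr_pdivrMr // mul1r; lra.
have r21 : r2 < 1 by rewrite /r2 ltrBlDr ltrDl divr_gt0 // subr_gt0.
have bern (m : nat) : 1 - m%:R * (1 - r2) <= r2 ^+ m.
  elim: m => [|m ih]; first by rewrite mul0r subr0 expr0.
  rewrite exprS; apply: (le_trans _ (ler_wpM2l (ltW r20) ih)).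
  rewrite -natr1; have : 0 <= m%:R * (1 - r2) ^+ 2 by rewrite mulr_ge0 ?sqr_ge0.
  lra.
have r12 : r1 < r2 ^+ n.+1.
  apply: (lt_le_trans _ (bern _)).
  have -> : n.+1%:R * (1 - r2) = (1 - r1) / 2.
    have k0 : n.+1%:R != 0 :> R by rewrite pnatr_eq0.
    by rewrite /r2; move: n.+1%:R k0 => k k0; field.
  by lra.
have [a /andP[a0 a1] ba] : exists2 a : R, 0 < a <= 2^-1 &
    forall x, `|x| < a -> r2 <= b x.
  have b01 : b 0 = 1 by rewrite bE cosix0; field.
  have : \forall x \near 0, r2 <= b x.
    have r20' : 0 < 1 - r2 by rewrite subr_gt0.
    have /cvgrPdist_lt /(_ _ r20') := cb 0; apply: filterS => x /=.
    by rewrite -/b b01 ltr_norml; lra.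
  move=> /nbhs_ballP[a /= a0 Ha].
  exists (Num.min a 2^-1).
    by rewrite lt_min a0 invr_gt0 ltr0n ge_min lexx orbT.
  move=> x; rewrite lt_min => /andP[xa _]; apply: Ha.
  by rewrite /ball /= sub0r normrN.
pose q := r1 / r2 ^+ n.+1.
have q0 : 0 <= q by rewrite divr_ge0 // exprn_ge0 // ltW.
have q1 : `|q| < 1 by rewrite ger0_norm // ltr_pdivrMr ?mul1r // exprn_gt0.
have [N qN] : exists N : nat, q ^+ N <= e * a ^+ n.+1.
  have ea : 0 < e * a ^+ n.+1 by rewrite mulr_gt0 // exprn_gt0.
  have /cvgrPdist_le /(_ _ ea) [N _ HN] := cvg_expr q1.
  exists N; have := HN N (leqnn N) => /=.
  by rewrite sub0r normrN ger0_norm // exprn_ge0.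
have [s s0 sE] := cospolyX N b00.
have cs : continuous (cospoly s) := @continuous_cospoly _ s.
pose c := ctp s.
have ca : r2 ^+ N * a <= c.
  rewrite /c -int1_cospoly; apply: int1_ge => //.
  - by rewrite a0 a1.
  - by rewrite exprn_ge0 // ltW.
  - by move=> x; rewrite sE exprn_ge0 // b_ge0.
  - by move=> x /ba bx; rewrite sE lerXn2r // nnegrE ?b_ge0 ?ltW.
have ra0 : 0 < r2 ^+ N * a by rewrite mulr_gt0 // exprn_gt0.
have c0 : 0 < c := lt_le_trans ra0 ca.
exists [seq (c^-1 * p.1, p.2) | p <- s], c^-1.
have E x : cospoly [seq (c^-1 * p.1, p.2) | p <- s] x = c^-1 * b x ^+ N.
  rewrite -sE /cospoly big_map mulr_sumr; apply: eq_bigr => p _ /=.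
  by rewrite mulrA.
split.
- by apply/allP => _ /mapP[p /(allP s0) p0 ->] /=; rewrite mulr_ge0 // invr_ge0 ltW.
- by rewrite /ctp big_map /= -mulr_sumr -/(ctp s) mulVf // gt_eqF.
- move=> x; rewrite E mulr_ge0 ?invr_ge0 ?(ltW c0) ?exprn_ge0 ?b_ge0 //=.
  by rewrite ler_piMr ?invr_ge0 ?(ltW c0) // exprn_ile1 // b_ge0.
- move=> x hx; rewrite E mulrAC -exprS.
  apply: (@le_trans _ _ ((r2 ^+ N * a)^-1 ^+ n.+1 * r1 ^+ N)).
    apply: ler_pM.
    + by rewrite exprn_ge0 // invr_ge0 ltW.
    + by rewrite exprn_ge0 // b_ge0.
    + by apply: lerXn2r; rewrite ?nnegrE ?invr_ge0 ?(ltW c0) ?(ltW ra0) // lef_pV2 ?posrE.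
    + rewrite lerXn2r ?nnegrE ?b_ge0 // /r1 !bE.
      rewrite ler_pM2r ?invr_gt0 ?ltr0n // lerD2l cosi1_le_dZ ?(ltW h'0) //.
      by rewrite (le_trans _ hx) // ge_min lexx.
  have -> : (r2 ^+ N * a)^-1 ^+ n.+1 * r1 ^+ N = q ^+ N / a ^+ n.+1.
    rewrite /q expr_div_n -exprM exprVn exprMn -exprM (mulnC N).
    by field; rewrite !expf_neq0 // gt_eqF.
  by rewrite ler_pdivrMr // exprn_gt0.
Qed.

Lemma periodic_int f k x : (forall x, f (x + 1) = f x) -> f (x + k%:~R) = f x.
Proof.
move=> fp.
have H (m : nat) y : f (y + m%:R) = f y.
  elim: m y => [|m ih] y; first by rewrite addr0.
  by rewrite -natr1 addrA fp ih.
case: k => m; first exact: H.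
by rewrite NegzE rmorphN /= -[in RHS](subrK (m.+1%:R) x) H.
Qed.

Lemma periodic_unif_continuous f (e : R) : continuous f ->
  (forall x, f (x + 1) = f x) -> 0 < e ->
  exists2 h, 0 < h & forall x y, dZ (x - y) < h -> `|f x - f y| <= e.
Proof.
move=> cf fp e0.
pose P (h x : R) := forall y, `|x - y| < h -> `|f x - f y| <= e.
have /compact_near_coveringP/(_ R (0^'+) P) := @segment_compact R (- 2^-1) 2^-1.
move=> H; have {H} : \forall h \near 0^'+, (`[- 2^-1, 2^-1] `<=` P h)%classic.
  apply: H => x _.
  have e2 : 0 < e / 2 by rewrite divr_gt0.
  have /cvgrPdist_le /(_ _ e2) := cf x.
  move=> /nbhs_ballP[d /= d0 Hd].
  exists (ball x (d / 2), [set h | 0 < h < d / 2]%classic) => /=.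
    split; first by apply: nbhsx_ballx; rewrite divr_gt0.
    near=> h; rewrite /=; apply/andP; split; near: h.
      exact: nbhs_right_gt.
    by apply: nbhs_right_lt; rewrite divr_gt0.
  move=> [z h] /= [xz /andP[h0 hd]] y zy.
  have A : `|f x - f z| <= e / 2.
    by apply: Hd; apply: (@le_ball _ _ _ (d / 2)) => //; move: d0; lra.
  have B : `|f x - f y| <= e / 2.
    apply: Hd; rewrite /ball /=; rewrite /ball /= in xz.
    have -> : x - y = (x - z) + (z - y) by ring.
    apply: (le_lt_trans (ler_normD _ _)).
    by have := ltrD xz (lt_trans zy hd); rewrite -splitr.
  have -> : f z - f y = (f x - f y) - (f x - f z) by ring.
  apply: (le_trans (ler_normB _ _)).
  by rewrite [e]splitr lerD.
rewrite /at_right => /nbhs_ballP[d /= d0 Hd].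
exists (d / 2); first by rewrite divr_gt0.
move=> x y xy.
have Pd : (`[- 2^-1, 2^-1] `<=` P (d / 2))%classic.
  apply: Hd; last by rewrite divr_gt0.
  by rewrite /ball /= sub0r normrN gtr0_norm ?divr_gt0 //; move: d0; lra.
(* Integer translations bring [x] into the cell and make [x' - y'] the representative of [x - y]
   closest to [0], so the compactness statement applies. *)
pose x' := x - (rnd x)%:~R; pose y' := y + (rnd (x - y))%:~R - (rnd x)%:~R.
have -> : f x = f x' by rewrite /x' -rmorphN periodic_int.
have -> : f y = f y' by rewrite /y' -rmorphN !periodic_int.
apply: Pd.
  by rewrite /= in_itv /=; have := rnd_itv x; rewrite -/x'; lra.
by move: xy; rewrite /dZ /x' /y'; congr (`|_| < _); ring.
Unshelve. all: end_near. Qed.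

Lemma periodic_bounded f : continuous f -> (forall x, f (x + 1) = f x) ->
  exists2 B, 0 < B & forall x, `|f x| <= B.
Proof.
move=> cf fp.
have cn : {within `[- 2^-1, 2^-1], continuous (fun x => `|f x|)}.
  by apply: continuous_subspaceT => x; apply: cvg_norm; exact: cf.
have [|c _ Hc] := @EVT_max R (fun x => `|f x|) (- 2^-1) 2^-1 _ cn; first by lra.
exists (`|f c| + 1); first by rewrite ltr_wpDl.
move=> x; have -> : f x = f (x - (rnd x)%:~R) by rewrite -rmorphN periodic_int.
apply: (@le_trans _ _ `|f c|); last by rewrite lerDl.
by apply: Hc; rewrite in_itv /=; have := rnd_itv x; lra.
Qed.

Lemma continuous_reflection f x : continuous f -> continuous (fun y => f (x - y)).
Proof.
move=> cf y; apply: continuous_comp; last exact: cf.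
by apply: cvgB; [exact: cvg_cst|exact: cvg_id].
Qed.

Lemma int1_convolution u s x : continuous u ->
  int1 (fun y => u y * cospoly s (x - y)) =
  \sum_(p <- s) p.1 * (cosi p.2 x * int1 (fun y => u y * cosi p.2 y) +
                       sini p.2 x * int1 (fun y => u y * sini p.2 y)).
Proof.
move=> cu.
have cc k : continuous (fun y => u y * cosi k y).
  by apply: continuous_mul => //; exact: continuous_cosi.
have cs k : continuous (fun y => u y * sini k y).
  by apply: continuous_mul => //; exact: continuous_sini.
transitivity (int1 (fun y => \sum_(p <- s) p.1 *
   (cosi p.2 x * (u y * cosi p.2 y) + sini p.2 x * (u y * sini p.2 y)))).
  apply: eq_int1 => y _; rewrite /cospoly mulr_sumr; apply: eq_bigr => p _.
  by rewrite cosiB; ring.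
have cD (p : R * int) : continuous (fun y => cosi p.2 x * (u y * cosi p.2 y) +
                                 sini p.2 x * (u y * sini p.2 y)).
  by apply: continuous_add; apply: continuous_Z.
rewrite int1_sum => [|p]; last exact: continuous_Z.
apply: eq_bigr => p _; rewrite int1Z // int1D; try exact: continuous_Z.
by rewrite !int1Z.
Qed.

Lemma int1_kernel s x : int1 (fun y => cospoly s (x - y)) = ctp s.
Proof.
transitivity (int1 (fun y => 1 * cospoly s (x - y))).
  by apply: eq_int1 => y _; rewrite mul1r.
rewrite int1_convolution; last exact: continuous_cstf.
rewrite /ctp [RHS]big_mkcond; apply: eq_bigr => p _.
have -> : int1 (fun y : R => 1 * cosi p.2 y) = int1 (cosi p.2).
  by apply: eq_int1 => y _; rewrite mul1r.
have -> : int1 (fun y : R => 1 * sini p.2 y) = int1 (sini p.2).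
  by apply: eq_int1 => y _; rewrite mul1r.
rewrite int1_cosi int1_sini mulr0 addr0.
by have [->|] := eqVneq; rewrite ?cosi0 ?mulr1 ?mulr0.
Qed.

(** Near the diagonal the kernel sees only the modulus of continuity of [u]; the rest is at most
    [2 * B] times the tail. One kernel meets two requirements, approximation of [u] and smallness
    beyond distance [d]; the latter locates the support of a limit in [adm_closed]. *)
Lemma convolution_approx u (d e : R) : continuous u ->
  (forall x, u (x + 1) = u x) -> 0 < d -> 0 < e ->
  exists s, [/\ nnegp s, ctp s = 1, forall x, 0 <= cospoly s x,
    forall x, d <= dZ x -> cospoly s x <= e &
    forall x, `|u x - int1 (fun y => u y * cospoly s (x - y))| <= e].
Proof.
move=> cu up d0 e0.
have e2 : 0 < e / 2 by rewrite divr_gt0.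
have [h h0 uh] := periodic_unif_continuous cu up e2.
have [B B0 uB] := periodic_bounded cu up.
have e4 : 0 < e / (4 * B) by rewrite divr_gt0 // mulr_gt0.
have dh : 0 < Num.min d h by rewrite lt_min d0 h0.
have ee : 0 < Num.min e (e / (4 * B)) by rewrite lt_min e0 e4.
have [s [M [s0 s1 sM st']]] := cosine_kernel 0 dh ee.
have sd x : d <= dZ x -> cospoly s x <= e.
  move=> hx; have := st' x; rewrite expr0 mulr1 ge_min hx /= le_min => /(_ isT).
  by case/andP.
have st x : h <= dZ x -> cospoly s x <= e / (4 * B).
  move=> hx; have := st' x; rewrite expr0 mulr1 ge_min hx orbT le_min => /(_ isT).
  by case/andP.
exists s; split => // [x|x]; first by case/andP: (sM x).
have cK : continuous (fun y => cospoly s (x - y)).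
  by apply: continuous_reflection; exact: continuous_cospoly.
have -> : u x - int1 (fun y => u y * cospoly s (x - y)) =
  int1 (fun y => u x * cospoly s (x - y) - u y * cospoly s (x - y)).
  by rewrite int1B ?int1Z ?int1_kernel ?s1 ?mulr1 //; [exact: continuous_Z|exact: continuous_mul].
have key y : `|u x * cospoly s (x - y) - u y * cospoly s (x - y)| <=
             e / 2 * cospoly s (x - y) + e / 2.
  have /andP[K0 _] := sM (x - y).
  rewrite -mulrBl normrM (ger0_norm K0).
  have [hxy|hxy] := ltP (dZ (x - y)) h.
    by rewrite (le_trans (ler_wpM2r K0 (uh _ _ hxy))) // lerDl ltW.
  apply: (@le_trans _ _ (e / 2)); last by rewrite lerDr mulr_ge0 // ltW.
  apply: (@le_trans _ _ ((2 * B) * (e / (4 * B)))).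
    apply: ler_pM => //; last exact: st.
    by apply: (le_trans (ler_normB _ _)); rewrite mulr_natl mulr2n lerD.
  by rewrite le_eqVlt; apply/orP; left; apply/eqP; field; rewrite gt_eqF.
have ck : continuous (fun y => e / 2 * cospoly s (x - y) + e / 2).
  by apply: continuous_add; [exact: continuous_Z|exact: continuous_cstf].
have cd : continuous (fun y => u x * cospoly s (x - y) - u y * cospoly s (x - y)).
  by apply: continuous_sub; [exact: continuous_Z|exact: continuous_mul].
have Ik : int1 (fun y => e / 2 * cospoly s (x - y) + e / 2) = e.
  rewrite int1D; [|exact: continuous_Z|exact: continuous_cstf].
  by rewrite int1Z // int1_kernel s1 int1_cst mulr1 -splitr.
rewrite ler_norml; apply/andP; split.
  rewrite lerNl -Ik -mulN1r -int1Z //; apply: le_int1 => //.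
    exact: continuous_Z.
  by move=> y _; have := key y; rewrite ler_norml; lra.
by rewrite -[leRHS]Ik; apply: le_int1 => // y _; have := key y; rewrite ler_norml; lra.
Qed.

(** Convolution with a kernel of mean one and nonnegative coefficients multiplies the coefficients
    of [u] by nonnegative numbers and keeps its mean. The convolutions are therefore the required
    cosine polynomials, and no convergence of the Fourier series of [u] is involved. *)
Lemma posdef_of_coefs u : continuous u -> (forall x, u (x + 1) = u x) ->
  (forall k, 0 <= int1 (fun y => u y * cosi k y)) ->
  (forall k, int1 (fun y => u y * sini k y) = 0) ->
  posdef (int1 u) u.
Proof.
move=> cu up uc us e e0.
have [s [s0 s1 sp _ Hs]] := convolution_approx cu up ltr01 e0.
exists [seq (p.1 * int1 (fun y => u y * cosi p.2 y), p.2) | p <- s]; split.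
- by apply/allP => _ /mapP[p /(allP s0) p0 ->] /=; rewrite mulr_ge0.
- rewrite /ctp big_map /= -[leLHS]mul1r -s1 /ctp mulr_suml.
  rewrite le_eqVlt; apply/orP; left; apply/eqP; apply: eq_bigr => p /eqP ->.
  by congr (_ * _); apply: eq_int1 => y _; rewrite cosi0 mulr1.
- move=> x; have := Hs x; rewrite int1_convolution //.
  congr (`|_ - _| <= _); rewrite /cospoly big_map; apply: eq_bigr => p _ /=.
  by rewrite us mulr0 addr0; ring.
Qed.

Lemma int1_cospoly_cosi s k : int1 (fun x => cospoly s x * cosi k x) =
  \sum_(p <- s) p.1 * (2^-1 * (p.2 + k == 0)%:R + 2^-1 * (p.2 - k == 0)%:R).
Proof.
transitivity (int1 (fun x => \sum_(p <- s) p.1 *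
     (2^-1 * cosi (p.2 + k) x + 2^-1 * cosi (p.2 - k) x))).
  apply: eq_int1 => x _; rewrite mulr_suml; apply: eq_bigr => p _.
  by rewrite -cosi_mul mulrA.
have cc l : continuous (fun x : R => 2^-1 * cosi l x).
  by apply: continuous_Z; exact: continuous_cosi.
have cD (p : R * int) :
    continuous (fun x => 2^-1 * cosi (p.2 + k) x + 2^-1 * cosi (p.2 - k) x).
  by apply: continuous_add; exact: cc.
rewrite int1_sum => [|p]; last exact: continuous_Z.
apply: eq_bigr => p _; rewrite int1Z // int1D // !int1Z ?int1_cosi //;
  exact: continuous_cosi.
Qed.

Lemma int1_cospoly_sini s k : int1 (fun x => cospoly s x * sini k x) = 0.
Proof.
transitivity (int1 (fun x => \sum_(p <- s) p.1 *
     (2^-1 * sini (p.2 + k) x - 2^-1 * sini (p.2 - k) x))).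
  apply: eq_int1 => x _; rewrite mulr_suml; apply: eq_bigr => p _.
  by rewrite -cosi_mul_sini mulrA.
have cc l : continuous (fun x : R => 2^-1 * sini l x).
  by apply: continuous_Z; exact: continuous_sini.
have cD (p : R * int) :
    continuous (fun x => 2^-1 * sini (p.2 + k) x - 2^-1 * sini (p.2 - k) x).
  by apply: continuous_sub; exact: cc.
rewrite int1_sum => [|p]; last exact: continuous_Z.
rewrite big1 // => p _; rewrite int1Z // int1B // !int1Z ?int1_sini;
  try exact: continuous_sini.
by rewrite !mulr0 subrr mulr0.
Qed.

Lemma int1_mul_approx u s f (e : R) : continuous u -> continuous f ->
  (forall x, `|f x| <= 1) -> (forall x, `|u x - cospoly s x| <= e) ->
  `|int1 (fun x => u x * f x) - int1 (fun x => cospoly s x * f x)| <= e.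
Proof.
move=> cu cf f1 us.
have cs : continuous (cospoly s) := @continuous_cospoly _ s.
rewrite -int1B; try exact: continuous_mul.
apply: int1_norm_le => [|x _].
  by apply: continuous_sub; exact: continuous_mul.
rewrite -mulrBl normrM -[leRHS]mulr1.
by apply: ler_pM.
Qed.

(** The approximating cosine polynomials have nonnegative coefficients, and integration against a
    bounded function respects uniform limits; with its sine companion this is the converse of
    [posdef_of_coefs]. *)
Lemma posdef_int1_cosi m u k : posdef m u -> 0 <= int1 (fun x => u x * cosi k x).
Proof.
move=> pu; apply/ler_addgt0Pr => e e0.
have [s [s0 _ us]] := pu e e0.
have := int1_mul_approx (posdef_continuous pu) (@continuous_cosi _ k)
  (@cosi_le1 _ k) us.
rewrite int1_cospoly_cosi; set S := \sum_(p <- s) _.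
have : 0 <= S.
  rewrite /S big_seq; apply: sumr_ge0 => p /(allP s0) p0.
  by rewrite mulr_ge0 // addr_ge0 // mulr_ge0 // ?invr_ge0 ?ler0n.
by rewrite ler_norml; lra.
Qed.

Lemma posdef_int1_sini m u k : posdef m u -> int1 (fun x => u x * sini k x) = 0.
Proof.
move=> pu; apply/eqP; rewrite -normr_le0; apply/ler_addgt0Pr => e e0.
have [s [s0 _ us]] := pu e e0; rewrite add0r.
have := int1_mul_approx (posdef_continuous pu) (@continuous_sini _ k)
  (@sini_le1 _ k) us.
by rewrite int1_cospoly_sini subr0.
Qed.

Lemma posdef_le_int1 m u : posdef m u -> m <= int1 u.
Proof.
move=> pu; apply/ler_addgt0Pr => e e0.
have [s [s0 ms us]] := pu e e0.
have one : forall x : R, `|1 : R| <= 1 by move=> _; rewrite normr1.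
have := int1_mul_approx (posdef_continuous pu) (@continuous_cstf _ 1) one us.
have E f : int1 (fun x : R => f x * 1) = int1 f.
  by apply: eq_int1 => x _; rewrite mulr1.
by rewrite !E int1_cospoly ler_norml => {one E us}; lra.
Qed.

End cosine_kernels.

(** * The triangle function and its Fourier coefficients *)

Section triangle.
Context {R : realType}.
Notation mu := (@lebesgue_measure R).
Implicit Types (w x : R) (k : int) (f F : R -> R).

Definition tri w x : R := Num.max 0 (w - dZ x).

Lemma continuous_tri w : continuous (tri w).
Proof.
move=> x; apply: (@continuous_max R R (fun=> 0) (fun x => w - dZ x)).
  exact: cvg_cst.
by apply: cvgB; [exact: cvg_cst|exact: continuous_dZ].
Qed.

Lemma tri_per w x : tri w (x + 1) = tri w x.
Proof. by rewrite /tri -[1]/(1%:~R) dZ_addz. Qed.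

Lemma tri_eq0 w x : w <= dZ x -> tri w x = 0.
Proof. by move=> h; apply/max_idPl; rewrite subr_le0. Qed.

Lemma tri0 w : 0 <= w -> tri w 0 = w.
Proof.
move=> w0; rewrite /tri dZ_norm ?normr0 ?subr0; last by rewrite invr_ge0 ler0n.
exact/max_idPr.
Qed.

Lemma Rintegral_split f (a b c : R) : continuous f -> a <= b -> b <= c ->
  \int[mu]_(x in `[a, c]) f x =
  \int[mu]_(x in `[a, b]) f x + \int[mu]_(x in `[b, c]) f x.
Proof.
move=> cf ab bc.
have := @Rintegral_itvB R f (BLeft a) (BRight c) b (continuous_integrable a c cf).
rewrite !bnd_simp ab bc => /(_ isT isT) /eqP; rewrite subr_eq => /eqP ->.
rewrite addrC; congr (_ + _).
rewrite Rintegral_itv_obnd_cbnd //.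
apply: (integrableS _ _ _ (continuous_integrable b c cf)) => //.
by apply: subset_itvr; rewrite bnd_simp.
Qed.

Lemma Rintegral_eq0 f (a b : R) : (forall x, a <= x <= b -> f x = 0) ->
  \int[mu]_(x in `[a, b]) f x = 0.
Proof.
move=> f0; rewrite (@eq_Rintegral _ _ _ mu `[a, b]%classic (fun=> 0)).
  by rewrite Rintegral_cst // mul0r.
by move=> x; rewrite inE /= in_itv /= => /f0.
Qed.

(** The cell is cut at [- w], [0] and [w]; only the two inner pieces contribute, and there the
    integrand has the antiderivatives [F1] and [F2]. The mean and all Fourier coefficients of the
    triangle are read off from this formula. *)
Lemma int1_tri w f F1 F2 : 0 < w <= 2^-1 -> continuous f ->
  (forall x : R, is_derive x 1 F1 ((w + x) * f x)) ->
  (forall x : R, is_derive x 1 F2 ((w - x) * f x)) ->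
  int1 (fun x => tri w x * f x) = F1 0 - F1 (- w) + (F2 w - F2 0).
Proof.
move=> /andP[w0 w1] cf d1 d2.
have ct : continuous (fun x => tri w x * f x).
  by apply: continuous_mul => //; exact: continuous_tri.
have c1 : continuous (fun x => (w + x) * f x).
  by apply: continuous_mul => // x; apply: cvgD; [exact: cvg_cst|exact: cvg_id].
have c2 : continuous (fun x => (w - x) * f x).
  by apply: continuous_mul => // x; apply: cvgB; [exact: cvg_cst|exact: cvg_id].
rewrite /int1 Rintegral_itv_bndo_bndc; last exact: (cell_integrable ct).
rewrite (Rintegral_split ct (_ : _ <= - w)); [|lra|lra].
rewrite (Rintegral_split ct (_ : - w <= 0)); [|lra|lra].
rewrite (Rintegral_split ct (_ : 0 <= w)); [|lra|lra].
rewrite [X in X + _]Rintegral_eq0 ?add0r; last first.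
  move=> x hx; rewrite tri_eq0 ?mul0r // dZ_norm; last by rewrite ler_norml; lra.
  by rewrite ler0_norm; lra.
rewrite [X in _ + (_ + X)]Rintegral_eq0 ?addr0; last first.
  move=> x hx; rewrite tri_eq0 ?mul0r // dZ_norm; last by rewrite ler_norml; lra.
  by rewrite ger0_norm; lra.
congr (_ + _).
- rewrite -(Rintegral_FTC _ c1 d1); last by rewrite oppr_lt0.
  apply: eq_Rintegral => x; rewrite inE /= in_itv /= => hx; congr (_ * _).
  rewrite /tri dZ_norm; last by rewrite ler_norml; lra.
  by rewrite ler0_norm ?opprK; [apply/max_idPr; lra|lra].
- rewrite -(Rintegral_FTC w0 c2 d2).
  apply: eq_Rintegral => x; rewrite inE /= in_itv /= => hx; congr (_ * _).
  rewrite /tri dZ_norm; last by rewrite ler_norml; lra.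
  by rewrite ger0_norm; [apply/max_idPr; lra|lra].
Qed.

Lemma int1_tri_cst w : 0 < w <= 2^-1 -> int1 (tri w) = w ^+ 2.
Proof.
move=> w0.
have d1 (x : R) : is_derive x 1 (fun x => w * x + 2^-1 * (x * x)) ((w + x) * 1).
  by apply: is_derive_eq; rewrite /GRing.scale /=; field.
have d2 (x : R) : is_derive x 1 (fun x => w * x - 2^-1 * (x * x)) ((w - x) * 1).
  by apply: is_derive_eq; rewrite /GRing.scale /=; field.
have := int1_tri w0 (@continuous_cstf _ 1) d1 d2.
rewrite (_ : int1 _ = int1 (tri w)); last by apply: eq_int1 => x _; rewrite mulr1.
by move=> ->; field.
Qed.

Lemma int1_tri_cosi w k : 0 < w <= 2^-1 -> k != 0 ->
  int1 (fun x => tri w x * cosi k x) =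
  (1 - cosi k w) / (2 * (pi * k%:~R) ^+ 2).
Proof.
move=> w0 k0; pose c : R := 2 * pi * k%:~R.
have pk : pi * k%:~R != 0 :> R by rewrite mulf_neq0 ?intr_eq0 // gt_eqF ?pi_gt0.
have c0 : c != 0 by rewrite /c -mulrA mulf_neq0.
have E x : cosi k x = cos (c * x) by rewrite /cosi /c !mulrA.
have d1 (x : R) : is_derive x 1
    (fun x => c^-1 * ((w + x) * sin (c * x)) + c^-1 * (c^-1 * cos (c * x)))
    ((w + x) * cosi k x).
  by rewrite E; apply: is_derive_eq; rewrite /GRing.scale /=; field.
have d2 (x : R) : is_derive x 1
    (fun x => c^-1 * ((w - x) * sin (c * x)) - c^-1 * (c^-1 * cos (c * x)))
    ((w - x) * cosi k x).
  by rewrite E; apply: is_derive_eq; rewrite /GRing.scale /=; field.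
rewrite (int1_tri w0 (@continuous_cosi _ k) d1 d2).
rewrite !mulr0 sin0 cos0 !mulrN cosN E.
have -> : pi * k%:~R = c / 2 by rewrite /c; field.
by field.
Qed.

Lemma int1_tri_sini w k : 0 < w <= 2^-1 ->
  int1 (fun x => tri w x * sini k x) = 0.
Proof.
move=> w0; have [->|k0] := eqVneq k 0.
  by rewrite -[RHS](int1_cst 0); apply: eq_int1 => x _; rewrite sini0 mulr0.
pose c : R := 2 * pi * k%:~R.
have c0 : c != 0 by rewrite !mulf_neq0 ?intr_eq0 // gt_eqF ?pi_gt0.
have E x : sini k x = sin (c * x) by rewrite /sini /c !mulrA.
have d1 (x : R) : is_derive x 1
    (fun x => c^-1 * (c^-1 * sin (c * x)) - c^-1 * ((w + x) * cos (c * x)))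
    ((w + x) * sini k x).
  by rewrite E; apply: is_derive_eq; rewrite /GRing.scale /=; field.
have d2 (x : R) : is_derive x 1
    (fun x => - c^-1 * (c^-1 * sin (c * x)) - c^-1 * ((w - x) * cos (c * x)))
    ((w - x) * sini k x).
  by rewrite E; apply: is_derive_eq; rewrite /GRing.scale /=; field.
rewrite (int1_tri w0 (@continuous_sini _ k) d1 d2).
rewrite !mulr0 sin0 cos0 !mulrN sinN cosN.
by field.
Qed.

Lemma posdef_tri w : 0 < w <= 2^-1 -> posdef (w ^+ 2) (tri w).
Proof.
move=> w0; rewrite -int1_tri_cst //; apply: posdef_of_coefs.
- exact: continuous_tri.
- exact: tri_per.
- move=> k; have [->|k0] := eqVneq k 0.
    have -> : int1 (fun y => tri w y * cosi 0 y) = int1 (tri w).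
      by apply: eq_int1 => x _; rewrite cosi0 mulr1.
    by rewrite int1_tri_cst ?sqr_ge0.
  rewrite int1_tri_cosi // divr_ge0 //; last by rewrite mulr_ge0 // sqr_ge0.
  by rewrite subr_ge0; exact: cos_le1.
- by move=> k; exact: int1_tri_sini.
Qed.

End triangle.

(** * Real competitors of the Turan problem *)

Section admissible_functions.
Context {R : realType}.
Implicit Types (dl m w x : R) (g : R -> R).

(** Competitors are taken real, with [m] only a lower bound for the mean, a form that survives
    enlarging the support and passing to limits. Vanishing at distance exactly [dl] costs nothing,
    by continuity. *)
Definition adm m dl g : Prop :=
  [/\ posdef m g, g 0 = 1 & forall x, dl <= dZ x -> g x = 0].

(** Distances from grid points to the integers are again grid values, which turns support conditions
    at grid points into inequalities between integers. *)
Lemma dZ_frac (P : nat) (k : int) : (0 < P)%N ->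
  exists2 l : nat, dZ (k%:~R / P%:R : R) = l%:R / P%:R &
    exists j : int, l = absz (k - j * P%:Z)%R.
Proof.
move=> P0; have Pr : P%:R != 0 :> R by rewrite pnatr_eq0 -lt0n.
pose r := rnd (k%:~R / P%:R : R).
exists (absz (k - r * P%:Z)%R); last by exists r.
rewrite /dZ -/r natr_absz intr_norm rmorphB rmorphM /=.
have {2}-> : P%:R = `|P%:R| :> R by rewrite ger0_norm.
rewrite -normf_div; congr `|_|.
by rewrite mulrBl mulfK.
Qed.

Lemma dZ_frac_ge (P M : nat) (k : int) : (0 < P)%N ->
  (forall j : int, (M <= absz (k - j * P%:Z)%R)%N) -> M%:R / P%:R <= dZ (k%:~R / P%:R : R).
Proof.
move=> P0 H; have [l -> [j ->]] := dZ_frac k P0.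
by rewrite ler_pM2r ?invr_gt0 ?ltr0n // ler_nat H.
Qed.

Lemma adm_tri dl : 0 < dl <= 2^-1 -> adm dl dl (fun x => dl^-1 * tri dl x).
Proof.
move=> d0; have /andP[d1 d2] := d0; split.
- have := posdef_scale (_ : 0 <= dl^-1) (posdef_tri d0).
  by rewrite expr2 mulKf ?gt_eqF //; apply; rewrite invr_ge0 ltW.
- by rewrite tri0 ?ltW // mulVf // gt_eqF.
- by move=> x dx; rewrite tri_eq0 // mulr0.
Qed.

Lemma adm_le1 m dl g : adm m dl g -> m <= 1.
Proof. by case=> /posdef_le0 + g0 _; rewrite g0. Qed.

Lemma adm_norm_le1 m dl g x : 0 <= m -> adm m dl g -> `|g x| <= 1.
Proof. by move=> m0 [pg g0 _]; rewrite -g0; exact: posdef_bound pg. Qed.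

Lemma adm_le m m' dl dl' g : m' <= m -> dl <= dl' -> adm m dl g -> adm m' dl' g.
Proof.
move=> mm dd [pg g0 gs]; split => //; first exact: posdef_le pg.
by move=> x dx; apply: gs; apply: le_trans dx.
Qed.

(** The points [i/q] are pairwise at distance at least [1/q] on the circle, so the matrix of values
    of [g] is the identity and the quadratic form with unit weights reads [m * q ^+ 2 <= q]. *)
Lemma adm_le_inv (q : nat) m g : (0 < q)%N -> adm m (q%:R^-1) g -> m <= q%:R^-1.
Proof.
move=> q0 [pg g0 gs]; have qr : 0 < q%:R :> R by rewrite ltr0n.
have := posdef_ineq (fun _ : 'I_q => 1) (fun i : 'I_q => i%:R / q%:R) pg.
rewrite [X in _ <= X](eq_bigr (fun=> 1)) => [|i _]; last first.
  rewrite (bigD1 i) //= subrr g0 !mulr1 big1 ?addr0 // => j ji.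
  rewrite gs ?mulr0 // -mulrBl.
  have := @dZ_frac_ge q 1 (i%:Z - j%:Z) q0; rewrite mul1r rmorphB /=; apply.
  move=> l; rewrite absz_gt0 subr_eq0; apply: contra_neq ji => E.
  apply: val_inj => /=; have := ltn_ord i; have := ltn_ord j.
  have [l0|[l0|l0]] : l = 0 \/ l <= -1 \/ 1 <= l by lia.
  - by rewrite l0 in E; lia.
  - by nia.
  - by nia.
rewrite !sumr_const card_ord -ler_pdivlMr ?exprn_gt0 //.
by rewrite expr2 invfM mulrA divff ?gt_eqF // mul1r.
Qed.

(** Since [1 - cos (2 y) = 2 * sin y ^+ 2], this is the square of [|sin (n y)| <= n * |sin y|],
    which follows by induction from the addition formula. *)
Lemma cosi_diff_le (n : nat) x : 1 - cosi n x <= n%:R ^+ 2 * (1 - cosi 1 x).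
Proof.
have half (k : int) : 1 - cosi k x = 2 * sin (pi * (k%:~R * x)) ^+ 2.
  have -> : cosi k x = cos ((pi * (k%:~R * x)) *+ 2).
    by rewrite /cosi mulr2n; congr cos; ring.
  by rewrite cos_mulr2n sin2cos2; ring.
rewrite !half; set y := pi * x.
have -> : pi * (n%:~R * x) = n%:R * y by rewrite /y; ring.
have -> : pi * (1%:~R * x) = y by rewrite /y mul1r.
have H : `|sin (n%:R * y)| <= n%:R * `|sin y|.
  elim: n => [|n ih]; first by rewrite !mul0r sin0 normr0.
  rewrite -natr1 !mulrDl !mul1r sinD.
  apply: (le_trans (ler_normD _ _)); rewrite !normrM; apply: lerD.
    by apply: le_trans ih; rewrite ler_piMr // cos_max.
  by rewrite ler_piMl // cos_max.
move: (sin (n%:R * y)) (sin y) H => s t H.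
have : `|s| ^+ 2 <= (n%:R * `|t|) ^+ 2.
  by apply: lerXn2r => //; rewrite nnegrE mulr_ge0.
by rewrite exprMn !real_normK ?num_real //; lra.
Qed.

(* With [q = floor (1/dl)] and [r = 1 - q dl], the even function that is
   piecewise linear with nodes [0, r, dl] and values [0, 1, 0] there has
   Fourier coefficients bounded by a multiple of those of [tri dl], because
   [cos (2 pi k r) = cos (2 pi k q dl)]; a small multiple of it can be added. *)
Lemma adm_gt dl : 0 < dl -> dl < 2^-1 -> dl^-1 \isn't a Num.nat ->
  exists2 m, dl < m & exists g, adm m dl g.
Proof.
move=> d0 d1 dN; pose q := Num.truncn dl^-1.
have /andP[q1 q2] : q%:R <= dl^-1 < q.+1%:R.
  by apply: truncn_itv; rewrite invr_ge0 ltW.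
have {}q1 : q%:R < dl^-1.
  rewrite lt_neqAle q1 andbT; apply/eqP => E.
  by move/negP: dN; apply; rewrite -E natr_nat.
pose r := 1 - q%:R * dl.
have r0 : 0 < r by rewrite /r subr_gt0 -ltr_pdivlMr // mul1r.
have rd : r < dl.
  have : 1 < q.+1%:R * dl by rewrite -ltr_pdivrMr // div1r.
  by rewrite -natr1 mulrDl mul1r /r; lra.
(* [A * tri dl - B * tri r] is the piecewise linear bump: its slope on [[r, dl]] is [- A], it
   vanishes at [0] by [AE], and [AB] computes its mean, which is [dl]. *)
pose A := (dl - r)^-1; pose B := r^-1 + A.
have A0 : 0 < A by rewrite invr_gt0 subr_gt0.
have B0 : 0 < B by rewrite addr_gt0 // invr_gt0.
have AE : A * dl - B * r = 0.
  by rewrite /B /A; field; rewrite subr_eq0 !gt_eqF.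
have AB : A * dl ^+ 2 - B * r ^+ 2 = dl.
  by rewrite /B /A; field; rewrite subr_eq0 !gt_eqF.
have qpos : 0 < q%:R ^+ 2 + 1 :> R by rewrite ltr_wpDl // sqr_ge0.
(* This size gives [b * q%:R ^+ 2 <= dl^-1 <= a], so that the coefficients of [a * tri dl] dominate
   those subtracted with [b * tri r]. *)
pose e := dl^-1 / (B * (q%:R ^+ 2 + 1)).
have e0 : 0 < e by rewrite divr_gt0 ?invr_gt0 // mulr_gt0.
pose a := dl^-1 + e * A; pose b := e * B.
have b0 : 0 < b by rewrite mulr_gt0.
have bq : b * q%:R ^+ 2 <= a.
  apply: (@le_trans _ _ dl^-1); last by rewrite lerDl ltW // mulr_gt0.
  have -> : b * q%:R ^+ 2 = dl^-1 * (q%:R ^+ 2 / (q%:R ^+ 2 + 1)).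
    by rewrite /b /e; field; rewrite !gt_eqF //.
  by rewrite ler_piMr ?invr_ge0 ?ltW // ltr_pdivrMr // mul1r ltrDl.
have dh : 0 < dl <= 2^-1 by rewrite d0 ltW.
have rh : 0 < r <= 2^-1 by rewrite r0 ltW // (lt_trans rd).
pose g x := a * tri dl x - b * tri r x.
have ct w : continuous (tri w : R -> R) := @continuous_tri _ w.
have cg : continuous g by apply: continuous_sub; exact: continuous_Z.
have gE (f : R -> R) : continuous f -> int1 (fun x => g x * f x) =
    a * int1 (fun x => tri dl x * f x) - b * int1 (fun x => tri r x * f x).
  move=> cf; have cm w : continuous (fun x => tri w x * f x) by exact: continuous_mul.
  rewrite -!int1Z // -int1B; try exact: continuous_Z.
  by apply: eq_int1 => x _; rewrite /g; ring.
have gI : int1 g = dl + e * dl.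
  rewrite int1B ?int1Z //; try exact: continuous_Z.
  rewrite !int1_tri_cst //.
  transitivity (dl^-1 * dl ^+ 2 + e * (A * dl ^+ 2 - B * r ^+ 2)).
    by rewrite /a /b; ring.
  by rewrite AB expr2 mulKf // gt_eqF.
exists (int1 g); first by rewrite gI ltrDl mulr_gt0.
exists g; split.
- apply: posdef_of_coefs => //.
  + by move=> x; rewrite /g !tri_per.
  + move=> k; have [->|k0] := eqVneq k 0.
      have -> : int1 (fun y => g y * cosi 0 y) = int1 g.
        by apply: eq_int1 => x _; rewrite cosi0 mulr1.
      by rewrite gI ltW // addr_gt0 // mulr_gt0.
    rewrite gE; last exact: continuous_cosi.
    rewrite !int1_tri_cosi // (mulrA a) (mulrA b) -mulrBl divr_ge0 //; last first.
      by rewrite mulr_ge0 // sqr_ge0.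
    have -> : cosi k r = cosi q (k%:~R * dl).
      have -> : cosi q (k%:~R * dl) = cosi k (q%:R * dl).
        by rewrite /cosi; congr cos; ring.
      by rewrite /r addrC -[1]/(1%:~R) cosi_per cosiN.
    have -> : cosi k dl = cosi 1 (k%:~R * dl) by rewrite /cosi mul1r.
    set y := k%:~R * dl; rewrite subr_ge0.
    apply: (le_trans (ler_wpM2l (ltW b0) (cosi_diff_le q y))).
    rewrite mulrA ler_wpM2r // subr_ge0; exact: cos_le1.
  + move=> k; rewrite gE; last exact: continuous_sini.
    by rewrite !int1_tri_sini // !mulr0 subrr.
- rewrite /g !tri0 ?ltW //.
  transitivity (dl^-1 * dl + e * (A * dl - B * r)); first by rewrite /a /b; ring.
  by rewrite AE mulr0 addr0 mulVf // gt_eqF.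
- move=> x dx; rewrite /g !tri_eq0 ?mulr0 ?subrr //.
  by apply: le_trans dx; apply: ltW.
Qed.

(** Hats of half-width [w] are placed at the grid points, with the values of [g] as heights. They
    are too narrow to reach the next node, so the value at [0] stays [1]; nodes at distance [M/P] or
    more carry height [0], so the support ends at the last active node plus [w]. *)
Lemma adm_grid (P M : nat) m dl g w : (0 < P)%N -> 0 <= m -> adm m dl g ->
  dl <= M%:R / P%:R -> 0 < w -> w <= P%:R^-1 -> w <= 2^-1 ->
  exists g', adm (P%:R * m * w) (M.-1%:R / P%:R + w) g'.
Proof.
move=> P0 m0 [pg g0 gs] dM w0 wP w2.
have Pr : 0 < P%:R :> R by rewrite ltr0n.
have w02 : 0 < w <= 2^-1 by rewrite w0.
have pt : posdef w (fun x => w^-1 * tri w x) by case: (adm_tri w02).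
exists (fun x => \sum_(j < P) g (j%:R / P%:R) * (w^-1 * tri w (x - j%:R / P%:R))).
split; first by apply: (posdef_grid P0 m0 (ltW w0) pg pt).
- case: P P0 wP Pr dM => // P _ wP Pr dM.
  rewrite big_ord_recl mul0r g0 subrr tri0 ?ltW // mulVf ?gt_eqF // mulr1.
  rewrite big1 ?addr0 // => j _; rewrite tri_eq0 ?mulr0 // sub0r dZN.
  apply: (le_trans wP).
  have := @dZ_frac_ge P.+1 1 (lift ord0 j)%:Z isT; rewrite mul1r; apply => l.
  rewrite absz_gt0 subr_eq0 /= /bump /=; have := ltn_ord j.
  move=> jP; apply/eqP => E.
  have [l0|[l0|l0]] : l = 0 \/ l <= -1 \/ 1 <= l by lia.
  + by rewrite l0 in E; lia.
  + by nia.
  + by nia.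
- move=> x hx; rewrite big1 // => j _.
  have [h|h] := leP dl (dZ (j%:R / P%:R)); first by rewrite gs ?mul0r.
  rewrite tri_eq0 ?mulr0 //.
  (* A node inside the support of [g] is at grid distance [l < M], hence at most [M.-1]: this gain
     of one step is what lets the support shrink. *)
  have [l lE _] := dZ_frac j%:Z P0.
  have lM : (l < M)%N.
    rewrite -(ltr_nat R) -(ltr_pM2r (_ : 0 < P%:R^-1)) ?invr_gt0 // -lE.
    exact: lt_le_trans dM.
  have := dZD (j%:R / P%:R) (x - j%:R / P%:R).
  rewrite addrC subrK [X in _ <= X + _]lE => hd.
  have : l%:R / P%:R <= M.-1%:R / P%:R :> R.
    by rewrite ler_pM2r ?invr_gt0 // ler_nat -ltnS prednK // (leq_trans _ lM).
  by move: hx hd; lra.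
Qed.

End admissible_functions.

(** * A quantitative upper bound by sampling *)

Section second_order_bound.
Context {R : realType}.
Implicit Types (dl m w x : R) (g : R -> R).

(** The grid is invariant under translation by its points, so all row sums of the matrix
    [g (x u - x v)] agree; the quadratic form with unit weights then bounds each of them. *)
Lemma posdef_grid_mean (P : nat) m g (u : nat) : (0 < P)%N -> posdef m g ->
  m * P%:R <= \sum_(v < P) g (u%:R / P%:R - v%:R / P%:R).
Proof.
move=> P0 pg; have Pr : 0 < P%:R :> R by rewrite ltr0n.
pose f (u : nat) := \sum_(v < P) g (u%:R / P%:R - v%:R / P%:R).
have fS (w : nat) : f w.+1 = f w.
  rewrite /f; have := @grid_shift R P P0 (fun y => g (w.+1%:R / P%:R - y)).
  rewrite mul0r subr0 divff ?gt_eqF // => /(_ _) <-.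
    apply: eq_bigr => v _; congr g; rewrite -!natr1; field; exact: lt0r_neq0.
  by rewrite -[1]/(1%:~R) -rmorphN (posdef_per _ _ pg).
have f0 (w : nat) : f w = f 0 by elim: w => // w <-; exact: fS.
have := posdef_ineq (fun _ : 'I_P => 1) (fun i : 'I_P => i%:R / P%:R) pg.
rewrite [X in _ <= X](eq_bigr (fun=> f 0)) => [|i _]; last first.
  by rewrite -(f0 i); apply: eq_bigr => j _; rewrite !mul1r.
rewrite !sumr_const card_ord -[X in _ <= X -> _]mulr_natr expr2 mulrA ler_pM2r //.
by rewrite -/(f u) f0.
Qed.

(** Polarised variance identity, meant for indicators of residue classes. *)
Lemma sum_sq_diff (I : finType) (a b : I -> R) :
  \sum_r \sum_s (a r - a s) * (b r - b s) =
  2 * (#|I|%:R * (\sum_r a r * b r) - (\sum_r a r) * (\sum_r b r)).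
Proof.
transitivity (\sum_r \sum_s ((a r * b r + a s * b s) - (a r * b s + a s * b r))).
  by apply: eq_bigr => r _; apply: eq_bigr => s _; ring.
under eq_bigr do rewrite sumrB !big_split /= sumr_const.
rewrite sumrB !big_split /= sumrMnl sumr_const.
have -> : \sum_r \sum_s a r * b s = (\sum_r a r) * (\sum_r b r).
  by rewrite mulr_suml; apply: eq_bigr => r _; rewrite mulr_sumr.
have -> : \sum_r \sum_s a s * b r = (\sum_r a r) * (\sum_r b r).
  by rewrite exchange_big mulr_suml; apply: eq_bigr => r _; rewrite mulr_sumr.
by rewrite -[X in X + _ - _]mulr_natl -[X in _ + X - _]mulr_natl; ring.
Qed.

Lemma count_near (L M u : nat) :
  (#|[pred v : 'I_L | (u < v + M)%N && (v < u + M)%N]| <= 2 * M)%N.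
Proof.
rewrite cardE -(size_map val) -[X in (_ <= X)%N](size_iota (u.+1 - M)).
apply: uniq_leq_size.
  by rewrite map_inj_uniq ?enum_uniq //; exact: val_inj.
move=> i /mapP[v]; rewrite mem_enum inE => /andP[h1 h2] ->.
by rewrite mem_iota; apply/andP; split => /=; lia.
Qed.

(* Sampling on the grid (1/8K)Z, the points of a long block that are congruent
   modulo [M] have [g]-orthogonal translates; comparing the sums over residue
   classes, weighted by the tent [b], with the sum over the whole block costs
   only the discrete Dirichlet energy of [b]. *)
Lemma adm_tent_bound (K M : nat) m dl g : (0 < M)%N -> (M <= K)%N -> 0 <= m ->
  adm m dl g -> dl <= M%:R / (8 * K)%:R ->
  m * (8 * K)%:R <= M%:R + 3 * M%:R ^+ 3 / K%:R ^+ 2.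
Proof.
move=> M0 MK m0 ag dM; have [pg g0 gs] := ag.
have K0 : (0 < K)%N by lia.
set P := (8 * K)%N in dM *; have P0 : (0 < P)%N by rewrite muln_gt0.
(* The weight [bn] is a tent; truncated subtraction makes it vanish within [M] of both ends, so the
   [M]-neighbourhood of an active point stays in the block. The block plus [M] fits into one period,
   hence its points are close on the circle only if their indices are close. *)
pose L := (2 * M + 4 * K)%N.
pose bn (u : nat) := minn (u - M) (L - M - u).
pose b (u : 'I_L) : R := (bn u)%:R.
pose x (u : nat) : R := u%:R / P%:R.
have gz (u v : nat) : (u < P)%N -> (v < P)%N -> (M <= absz (u%:Z - v%:Z)%R)%N ->
    (absz (u%:Z - v%:Z)%R + M <= P)%N -> g (x u - x v) = 0.
  move=> uP vP h1 h2; apply: gs; apply: (le_trans dM).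
  rewrite /x -mulrBl; have := @dZ_frac_ge R P M (u%:Z - v%:Z) P0.
  rewrite rmorphB /=; apply => j.
  have [->|[h|h]] : j = 0 \/ j <= -1 \/ 1 <= j by lia.
  - by rewrite mul0r subr0.
  - by nia.
  - by nia.
have LP : (L + M <= P)%N by rewrite /L /P; lia.
have g1 y : `|g y| <= 1 by exact: adm_norm_le1 m0 ag.
have ge y : g (- y) = g y by exact: posdef_even pg.
pose S2 := \sum_u b u ^+ 2.
pose Q := \sum_u \sum_v b u * b v * g (x u - x v).
(* For residues [r] and [s] the test weights are [b] on the class of [r] and [- b] on that of [s].
   Summed over all [r] and [s], a diagonal term has weight [2 * (M - 1)] and a pair in different
   classes has weight [- 2], while [g] vanishes at the difference of two distinct points of one
   class. *)
have step1 : Q <= M%:R * S2.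
  pose a (u : 'I_L) (r : 'I_M) : R := (u %% M == r)%N%:R.
  have a1 u : \sum_r a u r = 1.
    rewrite (bigD1 (Ordinal (ltn_pmod u M0))) //= big1 ?addr0 /a /= ?eqxx // => r hr.
    by apply/eqP; rewrite pnatr_eq0 eqb0; apply: contra hr => /eqP E; apply/eqP/val_inj.
  have pos (r s : 'I_M) : 0 <= \sum_u \sum_v
     (b u * (a u r - a u s)) * (b v * (a v r - a v s)) * g (x u - x v).
    apply: le_trans (posdef_ineq (fun u => b u * (a u r - a u s)) (fun u => x u) pg).
    by rewrite mulr_ge0 // sqr_ge0.
  have tot : 0 <= \sum_r \sum_s \sum_u \sum_v
     (b u * (a u r - a u s)) * (b v * (a v r - a v s)) * g (x u - x v).
    by apply: sumr_ge0 => r _; apply: sumr_ge0 => s _; exact: pos.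
  have E : \sum_r \sum_s \sum_u \sum_v
     (b u * (a u r - a u s)) * (b v * (a v r - a v s)) * g (x u - x v) =
     2 * (M%:R * S2 - Q).
    transitivity (\sum_u \sum_v b u * b v * g (x u - x v) *
       \sum_r \sum_s (a u r - a u s) * (a v r - a v s)).
      under eq_bigr do rewrite exchange_big /=.
      rewrite exchange_big /=; apply: eq_bigr => u _.
      under eq_bigr do rewrite exchange_big /=.
      rewrite exchange_big /=; apply: eq_bigr => v _.
      rewrite mulr_sumr; apply: eq_bigr => r _.
      by rewrite mulr_sumr; apply: eq_bigr => s _; ring.
    rewrite mulrBr mulrCA -[S2]mulr1 /S2 /Q mulr_suml !mulr_sumr -sumrB.
    apply: eq_bigr => u _.
    rewrite (bigD1 u) //= [X in _ = _ - _ * X](bigD1 u) //=.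
    rewrite subrr g0 mulr1 sum_sq_diff !a1 card_ord.
    have -> : \sum_r a u r * a u r = 1.
      rewrite -[RHS](a1 u); apply: eq_bigr => r _.
      by rewrite /a; case: eqP => _; rewrite ?mulr0 ?mulr1.
    rewrite (eq_bigr (fun v => - 2 * (b u * b v * g (x u - x v)))) => [|v vu].
      by rewrite -mulr_sumr; ring.
    rewrite sum_sq_diff !a1 card_ord.
    have [uv|uv] := eqVneq (u %% M)%N (v %% M)%N.
      rewrite gz ?mulr0 ?mul0r //.
      - by have := ltn_ord u; lia.
      - by have := ltn_ord v; lia.
      - have nuv : (u : nat) <> v by move=> E; case/eqP: vu; apply: val_inj; rewrite /= E.
        have := divn_eq u M; have := divn_eq v M; rewrite uv.
        move: (_ %/ _)%N (_ %/ _)%N (_ %% _)%N => c d e Ev Eu.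
        case: (ltngtP c d) => [h|h|h]; last by case: nuv; rewrite Eu Ev h.
          have : (c.+1 * M <= d * M)%N by rewrite leq_mul2r h orbT.
          by rewrite mulSn; lia.
        have : (d.+1 * M <= c * M)%N by rewrite leq_mul2r h orbT.
        by rewrite mulSn; lia.
      - by have := ltn_ord u; have := ltn_ord v; lia.
    have -> : \sum_r a u r * a v r = 0.
      rewrite big1 // => r _; rewrite /a -natrM mulnb.
      have [Eu|_] /= := eqVneq (u %% M)%N r => //.
      by rewrite -Eu eq_sym (negbTE uv).
    by ring.
  move: tot; rewrite E; lra.
(* [b u * b v] is half of [b u ^+ 2 + b v ^+ 2] minus half of [(b u - b v) ^+ 2]. The first part
   gives at least [m * P] times [S2]; in the second, each [u] has at most [2 * M] relevant
   neighbours, with difference of weights at most [M]. *)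
have step3 : m * P%:R * S2 - L%:R * M%:R ^+ 3 <= Q.
  have -> : Q = \sum_(u < L) \sum_(v < L) b u ^+ 2 * g (x u - x v) -
     2^-1 * \sum_(u < L) \sum_(v < L) (b u - b v) ^+ 2 * g (x u - x v).
    have sw : \sum_(u < L) \sum_(v < L) b v ^+ 2 * g (x u - x v) =
              \sum_(u < L) \sum_(v < L) b u ^+ 2 * g (x u - x v).
      rewrite exchange_big; apply: eq_bigr => u _; apply: eq_bigr => v _.
      by rewrite -ge opprB.
    transitivity (2^-1 * (\sum_(u < L) \sum_(v < L) b u ^+ 2 * g (x u - x v) +
       \sum_(u < L) \sum_(v < L) b v ^+ 2 * g (x u - x v)) -
     2^-1 * \sum_(u < L) \sum_(v < L) (b u - b v) ^+ 2 * g (x u - x v)); last first.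
      by rewrite sw; field.
    rewrite -mulrBr -big_split -sumrB /Q mulr_sumr; apply: eq_bigr => u _ /=.
    by rewrite -big_split -sumrB mulr_sumr; apply: eq_bigr => v _ /=; field.
  apply: lerB.
    rewrite /S2 mulr_sumr; apply: ler_sum => u _; rewrite mulrC -mulr_sumr.
    have [bu|bu] := leqP (bn u) 0.
      have -> : b u = 0 by rewrite /b; move: bu; rewrite leqn0 => /eqP ->.
      by rewrite expr0n /= !mul0r.
    apply: ler_wpM2l; first exact: sqr_ge0.
    apply: (le_trans (posdef_grid_mean u P0 pg)).
    have LP' : (L <= P)%N by lia.
    rewrite (big_ord_widen P (fun v => g (x u - x v)) LP') [leRHS]big_mkcond /=.
    rewrite le_eqVlt; apply/orP; left; apply/eqP; apply: eq_bigr => v _.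
    case: ltnP => // Lv; apply: gz.
    - by have := ltn_ord u; lia.
    - exact: ltn_ord.
    - by move: bu; rewrite /bn; have := ltn_ord v; lia.
    - by move: bu; rewrite /bn; have := ltn_ord v; lia.
  have inner (u : 'I_L) : \sum_v (b u - b v) ^+ 2 * g (x u - x v) <=
      (2 * M)%:R * M%:R ^+ 2.
    apply: (@le_trans _ _ (\sum_(v in [pred v : 'I_L | (u < v + M)%N && (v < u + M)%N])
       M%:R ^+ 2)); last first.
      rewrite sumr_const -[leLHS]mulr_natl ler_wpM2r ?sqr_ge0 // ler_nat.
      exact: count_near.
    rewrite [leRHS]big_mkcond /=; apply: ler_sum => v _; rewrite inE.
    have lu := ltn_ord u; have lv := ltn_ord v.
    case: ifPn => h; last first.
      by rewrite gz ?mulr0 //; lia.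
    apply: (@le_trans _ _ ((b u - b v) ^+ 2)).
      by rewrite ler_piMr ?sqr_ge0 // (le_trans (ler_norm _)).
    rewrite -[leLHS]real_normK ?num_real // lerXn2r // ?nnegrE //.
    rewrite /b; have [buv|buv] := leqP (bn u) (bn v).
      rewrite distrC ger0_norm ?subr_ge0 ?ler_nat // lerBlDr -natrD ler_nat.
      by rewrite /bn; lia.
    rewrite ger0_norm ?subr_ge0 ?ler_nat 1?ltnW // lerBlDr -natrD ler_nat.
    by rewrite /bn; lia.
  apply: (@le_trans _ _ (2^-1 * \sum_(u < L) (2 * M)%:R * M%:R ^+ 2)).
    rewrite ler_wpM2l ?invr_ge0 //; apply: ler_sum => u _; exact: inner.
  rewrite sumr_const card_ord -[X in _ * X]mulr_natl natrM le_eqVlt.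
  by apply/orP; left; apply/eqP; field.
(* On the middle half of the tent, which has [2 * K] indices, the height is at least [K]. *)
have S2K : 2 * K%:R ^+ 3 <= S2.
  rewrite /S2 /b -(big_mkord xpredT (fun u => (bn u)%:R ^+ 2 : R)).
  rewrite (@big_cat_nat _ _ _ (M + K)) //=; last by rewrite /L; lia.
  rewrite (@big_cat_nat _ _ _ (M + 3 * K) (M + K)) //=; [|lia|by rewrite /L; lia].
  apply: (@le_trans _ _ (\sum_(M + K <= u < M + 3 * K) (bn u)%:R ^+ 2)); last first.
    have s0 i j : 0 <= \sum_(i <= u < j) ((bn u)%:R ^+ 2 : R).
      by apply: sumr_ge0 => u _; exact: sqr_ge0.
    by rewrite -[leLHS]add0r lerD // lerDl.
  apply: (@le_trans _ _ (\sum_(M + K <= u < M + 3 * K) K%:R ^+ 2)).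
    rewrite sumr_const_nat -[leRHS]mulr_natl.
    have -> : (M + 3 * K - (M + K))%N = (2 * K)%N by lia.
    by rewrite natrM -mulrA -exprS.
  rewrite big_nat_cond [leRHS]big_nat_cond; apply: ler_sum => u.
  rewrite andbT => /andP[h1 h2].
  by rewrite lerXn2r ?nnegrE // ler_nat /bn /L; lia.
have Kr : 0 < K%:R :> R by rewrite ltr0n.
rewrite -lerBlDl; have [neg|pos] := leP (m * P%:R - M%:R) 0.
  by apply: (le_trans neg); rewrite divr_ge0 // mulr_ge0.
rewrite ler_pdivlMr ?exprn_gt0 //.
have L6 : L%:R <= 6 * K%:R :> R by rewrite -natrM ler_nat /L; lia.
have H1 : (m * P%:R - M%:R) * (2 * K%:R ^+ 3) <= 6 * K%:R * M%:R ^+ 3.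
  apply: (le_trans (ler_wpM2l (ltW pos) S2K)).
  apply: (@le_trans _ _ (L%:R * M%:R ^+ 3)); last by rewrite ler_wpM2r // exprn_ge0.
  by move: (le_trans step3 step1); lra.
rewrite -(ler_pM2r (_ : 0 < 2 * K%:R)) ?mulr_gt0 //.
move: H1; rewrite !exprS !expr0; lra.
Qed.

End second_order_bound.

(** * Summability of the Fourier coefficients *)

Section closedness.
Context {R : realType}.
Implicit Types (dl m w x : R) (g : R -> R).

(** Coefficients are indexed by [k >= 0]; the frequencies [k] and [- k] share one cosine, whence the
    factor [2]. *)
Definition fweight (k : nat) : R := if k == 0%N then 1 else 2.

Lemma sum_eq_nat_le1 (K l : nat) : \sum_(k < K) (l == k)%:R <= 1 :> R.
Proof.
have [lK|lK] := ltnP l K; last first.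
  by rewrite big1 // => k _; rewrite gtn_eqF // (leq_trans (ltn_ord k)).
rewrite (bigD1 (Ordinal lK)) //= eqxx big1 ?addr0 // => k kl.
by apply/eqP; rewrite pnatr_eq0 eqb0; apply: contra kl => /eqP E; apply/eqP/val_inj.
Qed.

(** For an approximating polynomial the sum of all coefficients is its value at [0], and finitely
    many of them sum to no more. The uniform error is divided in advance by the total weight [W]. *)
Lemma fourier_sum_le (K : nat) m g : posdef m g ->
  \sum_(k < K) fweight k * int1 (fun x => g x * cosi k x) <= g 0.
Proof.
move=> pg; apply/ler_addgt0Pr => e e0.
pose W := \sum_(k < K) fweight k + 1.
have W1 : 0 < W.
  by rewrite ltr_wpDl // sumr_ge0 // => k _; rewrite /fweight; case: eqP.
have eW : 0 < e / (2 * W) by rewrite divr_gt0 // mulr_gt0.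
have eW2 : e / (2 * W) <= e / 2.
  rewrite ler_pM2l // lef_pV2 ?posrE ?mulr_gt0 // ler_peMr //.
  by rewrite /W lerDr sumr_ge0 // => k _; rewrite /fweight; case: eqP.
have [s [s0 _ us]] := pg _ eW.
have H (k : 'I_K) : fweight k * int1 (fun x => g x * cosi k x) <=
    \sum_(p <- s) p.1 * (absz p.2 == k)%:R + fweight k * (e / (2 * W)).
  have f0 : 0 <= fweight k by rewrite /fweight; case: eqP.
  have := int1_mul_approx (posdef_continuous pg) (@continuous_cosi _ k)
    (@cosi_le1 _ k) us.
  rewrite ler_norml => /andP[_ h].
  have -> : \sum_(p <- s) p.1 * (absz p.2 == k)%:R =
     fweight k * int1 (fun x => cospoly s x * cosi k x).
    rewrite int1_cospoly_cosi mulr_sumr; apply: eq_bigr => p _.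
    rewrite mulrCA; congr (_ * _); rewrite /fweight.
    case: (k : nat) => [|j] /=.
      by rewrite oppr0 !addr0 absz_eq0 mul1r -mulrDl (_ : 2^-1 + 2^-1 = 1) ?mul1r //; lra.
    have -> : (absz p.2 == j.+1) = (p.2 + j.+1%:Z == 0) || (p.2 - j.+1%:Z == 0).
      by apply/idP/idP; lia.
    case: eqP => h1; case: eqP => h2 /=; rewrite ?mulr0 ?mulr1 ?addr0 ?add0r ?mulfV ?mulr0 //.
    by exfalso; lia.
  by rewrite -mulrDr ler_wpM2l //; lra.
apply: (@le_trans _ _ (\sum_(k < K) (\sum_(p <- s) p.1 * (absz p.2 == k)%:R +
   fweight k * (e / (2 * W))))).
  by apply: ler_sum => k _; exact: H.
rewrite big_split /= -mulr_suml exchange_big /=.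
rewrite [X in _ <= _ + X]splitr.
rewrite addrA; apply: lerD; last first.
  rewrite -(ler_pM2r (_ : 0 < 2 * W)) ?mulr_gt0 //.
  rewrite -mulrA divfK ?mulf_neq0 ?gt_eqF //.
  have -> : e / 2 * (2 * W) = W * e by field.
  by rewrite ler_wpM2r ?ltW // /W ltrDl.
apply: (@le_trans _ _ (cospoly s 0)); last first.
  by have := us 0; rewrite ler_norml => /andP[h _]; lra.
rewrite /cospoly big_seq [leRHS]big_seq; apply: ler_sum => p /(allP s0) p0.
rewrite cosix0 -mulr_sumr ler_wpM2l //; exact: sum_eq_nat_le1.
Qed.

End closedness.

(** * Closedness of the competitors under shrinking supports *)

Section right_continuity.
Context {R : realType}.
Implicit Types (dl m w x : R) (g : R -> R).

Lemma natz_add_neq0 (j : nat) (k : int) : j != absz k -> (j%:Z + k == 0) = false.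
Proof. by move=> h; apply: contraNF h => /eqP h; apply/eqP; lia. Qed.

Lemma natz_sub_neq0 (j : nat) (k : int) : j != absz k -> (j%:Z - k == 0) = false.
Proof. by move=> h; apply: contraNF h => /eqP h; apply/eqP; lia. Qed.

Lemma fweight_half (k : int) :
  fweight (absz k) * (2^-1 * ((absz k)%:Z + k == 0)%:R +
    2^-1 * ((absz k)%:Z - k == 0)%:R) = 1 :> R.
Proof.
rewrite /fweight; case: (intP k) => [|n|n].
- by rewrite mul1r oppr0 !addr0 eqxx /=; lra.
- rewrite absz_nat subrr eqxx (_ : (_ + _ == 0) = false); last by apply/eqP; lia.
  by rewrite /=; lra.
- rewrite abszN absz_nat addrN eqxx (_ : (_ - _ == 0) = false); last by apply/eqP; lia.
  by rewrite /=; lra.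
Qed.

(** Since [dl < 2^-1], a point at distance exactly [dl] is a limit of points farther from the
    integers, where [u] vanishes. *)
Lemma support_closed (u : R -> R) dl : continuous u -> (forall x, u (x + 1) = u x) ->
  0 <= dl -> dl < 2^-1 -> (forall x, dl < dZ x -> u x = 0) ->
  forall x, dl <= dZ x -> u x = 0.
Proof.
move=> cu up d0 d1 us x; rewrite le_eqVlt => /orP[/eqP dx|]; last exact: us.
apply/eqP; rewrite -normr_le0; apply/ler_addgt0Pr => e e0; rewrite add0r.
have /cvgrPdist_le /(_ _ e0) := cu x.
move=> /nbhs_ballP[t /= t0 Ht].
pose s := Num.min (t / 2) (2^-1 - dl).
have s0 : 0 < s by rewrite lt_min divr_gt0 // subr_gt0.
have sh : s <= 2^-1 - dl by rewrite ge_min lexx orbT.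
have st : s < t by rewrite gt_min; apply/orP; left; move: t0; lra.
have [y xy dy] : exists2 y, `|x - y| = s & dl < dZ y.
  pose z := x - (rnd x)%:~R; have zE : `|z| = dl by rewrite dx.
  have [z0|z0] := leP 0 z.
    exists (x + s); first by rewrite opprD addNKr normrN gtr0_norm.
    rewrite -(subrK (rnd x)%:~R (x + s)) dZ_addz addrAC -/z.
    by rewrite ger0_norm // in zE; rewrite dZ_norm ger0_norm; lra.
  exists (x - s); first by rewrite opprB addrC subrK gtr0_norm.
  rewrite -(subrK (rnd x)%:~R (x - s)) dZ_addz addrAC -/z.
  by rewrite ltr0_norm // in zE; rewrite dZ_norm ler0_norm; lra.
by have := Ht y; rewrite (us _ dy) subr0; apply; rewrite /ball /= xy.
Qed.

(* A pointwise limit of the Fourier coefficients, along an ultrafilter, of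
   admissible functions for supports shrinking to [[-dl, dl]] gives the Fourier
   coefficients of an admissible function for [dl]: convolution with a
   concentrated kernel only sees finitely many of them. *)
Lemma adm_closed m dl : 0 < m -> 0 < dl -> dl < 2^-1 ->
  (forall d, dl < d -> exists g, adm m d g) -> exists g, adm m dl g.
Proof.
move=> m0 dl0 dl1 /= ex.
have ex' d : exists g, dl < d -> adm m d g.
  have [dd|] := ltP dl d; first by have [g hg] := ex _ dd; exists g.
  by exists (fun=> 0).
have [G HG] := choice ex'.
pose C (k : int) (d : R) := int1 (fun x => G d x * cosi k x).
have C01 k d : dl < d -> 0 <= C k d <= 1.
  move=> dd; have ag := HG _ dd; have [pg g0 gs] := ag.
  rewrite /C (posdef_int1_cosi k pg) /=.
  apply: le_trans (ler_norm _) _; apply: int1_norm_le => [|x _].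
    by apply: continuous_mul; [exact: posdef_continuous pg|exact: continuous_cosi].
  rewrite normrM mulr_ile1 // ?cosi_le1 //.
  exact: adm_norm_le1 (ltW m0) ag.
(* Along an ultrafilter containing the right neighbourhoods of [dl] all the bounded coefficients
   converge at once, which replaces a diagonal extraction. *)
have [U [UU FU]] := @ultraFilterLemma R (dl^'+) _.
have PU : ProperFilter U by exact: ultra_proper.
have nearU (Q : R -> Prop) : (\forall d \near dl^'+, Q d) -> \forall d \near U, Q d.
  by move=> h; apply: FU.
have nearU_gt : \forall d \near U, dl < d by apply: nearU; exact: nbhs_right_gt.
have cvgC k : exists c : R, C k @ U --> c.
  have UC : (C k @ U) `[0, 1]%classic.
    by apply: filterS nearU_gt => d /(C01 k) h /=; rewrite in_itv.
  have [c [_ clc]] := @segment_compact R 0 1 (C k @ U) _ UC.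
  exists c => V Vc; have [//|h] := in_ultra_setVsetC (C k @^-1` V)%classic UU.
  by have [y []] := clc (~` V)%classic V h Vc.
have [c cC] := choice cvgC.
have c01 k : 0 <= c k <= 1.
  have := @closed_cvg _ _ U _ (C k) `[0, 1]%classic _ _ _ (cC k).
  rewrite /= in_itv; apply; first exact: itv_closed.
  by apply: filterS nearU_gt => d /(C01 k) h /=; rewrite in_itv.
have mc0 : m <= c 0.
  have := @closed_cvg _ _ U _ (C 0) [set x | m <= x]%classic _ _ _ (cC 0).
  apply; first exact: closed_ge.
  apply: filterS nearU_gt => d /HG [pg _ _] /=.
  rewrite /C (_ : int1 _ = int1 (G d)); last by apply: eq_int1 => x _; rewrite cosi0 mulr1.
  exact: posdef_le_int1 pg.
(* The limits inherit the bound of [fourier_sum_le], so the cosine series with coefficients [a]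
   converges uniformly; its sum is the limit competitor, up to normalisation. *)
pose a (k : nat) := fweight k * c k.
have w0 k : 0 <= fweight k :> R by rewrite /fweight; case: eqP.
have a0 k : 0 <= a k by rewrite mulr_ge0 //; case/andP: (c01 k).
have a_sum K : series a K <= 1.
  rewrite /series /=.
  have H : (fun d => \sum_(0 <= k < K) fweight k * C k d) @ U --> \sum_(0 <= k < K) a k.
    apply: cvg_big => [|k _]; last by apply: cvgM; [exact: cvg_cst|exact: cC].
    exact: add_continuous.
  have := @closed_cvg _ _ U _ _ (fun x : R => x <= 1) _ _ _ H.
  apply; first exact: closed_le.
  apply: filterS nearU_gt => d /HG [pg g0 _] /=.
  by rewrite big_mkord -g0; exact: fourier_sum_le pg.
have nda : {homo series a : p q / (p <= q)%N >-> p <= q}.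
  move=> p q pq; rewrite /series /= (big_cat_nat _ pq) //= lerDl.
  by apply: sumr_ge0 => k _; exact: a0.
have cva : cvgn (series a).
  apply: nondecreasing_is_cvgn => //.
  by exists 1 => _ [K _ <-]; exact: a_sum.
pose A := limn (series a).
have leA K : series a K <= A by apply: nondecreasing_cvgn_le.
have tailA (e : R) : 0 < e -> exists2 N : nat, (0 < N)%N & A - series a N <= e.
  move=> e0; have /cvgrPdist_le /(_ _ e0) [N _ HN] := cva.
  exists N.+1 => //; have := HN N.+1 (leqnSn N).
  by rewrite /= ger0_norm // subr_ge0 leA.
pose u x (k : nat) := a k * cosi k x.
have nu x k : `|u x k| <= a k.
  by rewrite /u normrM (ger0_norm (a0 k)) ler_piMr // cosi_le1.
have cvu x : cvgn (series (u x)).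
  apply: normed_cvg; apply: (series_le_cvg _ _ _ cva) => k //=; exact: nu.
pose g x := limn (series (u x)).
have gN x N : `|g x - series (u x) N| <= A - series a N.
  have H : (fun K => `|series (u x) K - series (u x) N|) @ \oo --> `|g x - series (u x) N|.
    by apply: cvg_norm; apply: cvgB; [exact: cvu|exact: cvg_cst].
  apply: (@closed_cvg _ _ \oo _ _ (fun y : R => y <= A - series a N) _ _ _ H).
    exact: closed_le.
  exists N => // K /= NK.
  rewrite /series /= (big_cat_nat _ NK) //= addrAC subrr add0r.
  apply: (le_trans (ler_norm_sum _ _ _)).
  apply: (@le_trans _ _ (\sum_(N <= k < K) a k)); first by apply: ler_sum => k _; exact: nu.
  have := leA K; rewrite /series /= (big_cat_nat _ NK) //= => h.
  by rewrite lerBrDl.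
pose sN N := [seq (a k, k%:Z) | k <- iota 0 N].
have sNE N x : cospoly (sN N) x = series (u x) N.
  by rewrite /cospoly big_map /series /= /index_iota subn0.
have sN0 N : nnegp (sN N) by apply/allP => _ /mapP[k _ ->] /=.
have a00 : a 0 = c 0 by rewrite /a /fweight mul1r.
have pg : posdef m g.
  move=> e e0; have [N N0 HN] := tailA e e0; exists (sN N); split => //.
    rewrite /ctp big_map -(prednK N0) big_cons /= a00.
    apply: (le_trans mc0); rewrite lerDl big_seq_cond.
    by apply: sumr_ge0 => k _; exact: a0.
  by move=> x; rewrite sNE; apply: le_trans (gN x N) HN.
have g0 : g 0 <= 1.
  apply: limr_le; first exact: cvu.
  apply: nearW => K; apply: le_trans (a_sum K); rewrite /series /=.
  by apply: ler_sum => k _; rewrite /u cosix0 mulr1.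
have cg := posdef_continuous pg.
have C_opp k d : C (- k) d = C k d by apply: eq_int1 => x _; rewrite cosiNk.
have c_opp k : c (- k) = c k.
  have H := cC (- k); rewrite (_ : C (- k) = C k) in H; last by apply/funext => d.
  exact: (cvg_unique _ H (cC k)).
have gC k : int1 (fun x => g x * cosi k x) = c k.
  apply/eqP; rewrite -subr_eq0 -normr_le0; apply/ler_addgt0Pr => e e0; rewrite add0r.
  have [N0 _ HN0] := tailA e e0; pose N := maxn N0 (absz k).+1.
  have HN x : `|g x - cospoly (sN N) x| <= e.
    rewrite sNE; apply: le_trans (gN x N) _; apply: le_trans HN0.
    by rewrite lerB // nda // leq_maxl.
  have := int1_mul_approx cg (@continuous_cosi _ k) (@cosi_le1 _ k) HN.
  rewrite (_ : int1 (fun x => cospoly _ x * _) = c k) // int1_cospoly_cosi big_map.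
  rewrite -[N in iota 0 N]subn0 -/(index_iota 0 N) big_mkord.
  have kN : (absz k < N)%N by rewrite leq_max ltnSn orbT.
  rewrite (bigD1 (Ordinal kN)) //= big1 ?addr0 => [|j jk]; last first.
    have jk' : (j : nat) != absz k by apply: contra jk => /eqP h; apply/eqP/val_inj.
    by rewrite natz_add_neq0 // natz_sub_neq0 // !mulr0 addr0 mulr0.
  have ck : c (absz k) = c k.
    by case: (intP k) => [|j|j]; rewrite ?absz_nat // abszN absz_nat c_opp.
  by rewrite /a ck mulrAC fweight_half mul1r.
have gper x : g (x + 1) = g x by rewrite -[1]/(1%:~R) (posdef_per _ _ pg).
(* [I] below is the convolution of [g] with a polynomial kernel, a finite combination of the [c k],
   hence the limit of the same convolutions of [G d]. These are small: once [d < dl + h], the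
   support of [G d] is at distance at least [h] from [x]. *)
have gz x : dl < dZ x -> g x = 0.
  move=> dx; pose h := (dZ x - dl) / 2.
  have h0 : 0 < h by rewrite divr_gt0 // subr_gt0.
  apply/eqP; rewrite -normr_le0; apply/ler_addgt0Pr => e e0; rewrite add0r.
  have e2 : 0 < e / 2 by rewrite divr_gt0.
  have [s [s0 s1 sp st sg]] := convolution_approx cg gper h0 e2.
  have := sg x; set I := int1 _ => gI.
  suff : `|I| <= e / 2.
    by move=> hI; have := ler_normD (g x - I) I; rewrite subrK; lra.
  have IE : I = \sum_(p <- s) p.1 * (cosi p.2 x * c p.2).
    rewrite /I int1_convolution //; apply: eq_bigr => p _.
    by rewrite gC (posdef_int1_sini _ pg) mulr0 addr0.
  have H : (fun d => `|\sum_(p <- s) p.1 * (cosi p.2 x * C p.2 d)|) @ U --> `|I|.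
    rewrite IE; apply: cvg_norm; apply: cvg_big => [|p _]; first exact: add_continuous.
    by apply: cvgM; [exact: cvg_cst|apply: cvgM; [exact: cvg_cst|exact: cC]].
  apply: (@closed_cvg _ _ U _ _ (fun y : R => y <= e / 2) _ _ _ H).
    exact: closed_le.
  have : \forall d \near U, d < dl + h.
    by apply: nearU; apply: nbhs_right_lt; rewrite ltrDl.
  apply: filterS2 nearU_gt => d d1 d2.
  have ag := HG _ d1; have [pG G0 Gs] := ag.
  have cG := posdef_continuous pG.
  have -> : \sum_(p <- s) p.1 * (cosi p.2 x * C p.2 d) =
      int1 (fun y => G d y * cospoly s (x - y)).
    rewrite int1_convolution //; apply: eq_bigr => p _.
    by rewrite (posdef_int1_sini _ pG) mulr0 addr0.
  apply: int1_norm_le => [|y _].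
    by apply: (continuous_mul cG); apply: continuous_reflection; exact: continuous_cospoly.
  have [dy|dy] := leP d (dZ y); first by rewrite Gs // mul0r normr0 ltW.
  rewrite normrM (ger0_norm (sp _)) -[leRHS]mul1r ler_pM //.
    exact: adm_norm_le1 (ltW m0) ag.
  apply: st; have := dZD (x - y) y; rewrite subrK /h in d2 *; lra.
have g0m : 0 < g 0 by apply: lt_le_trans (posdef_le0 pg).
(* Only [g 0 <= 1] is known in the limit; dividing by it can only raise the mean. *)
exists (fun x => (g 0)^-1 * g x); split.
- have gi : 0 <= (g 0)^-1 by rewrite invr_ge0 ltW.
  apply: posdef_le (posdef_scale gi pg).
  by rewrite ler_peMl ?(ltW m0) // invf_ge1.
- by rewrite mulVf // gt_eqF.
- by move=> x dx; rewrite (support_closed cg gper (ltW dl0) dl1 gz dx) mulr0.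
Qed.

End right_continuity.

(** * The Turan function: exact values, continuity, second-order behaviour *)

Section complex_turan.
Context {R : realType}.
Implicit Types (dl m x : R) (g : R -> R[i]) (u v : R -> R).
Local Open Scope complex_scope.

Let re_norm_le (z : R[i]) : (`|complex.Re z|)%:C <= `|z|.
Proof. exact: normc_ge_Re. Qed.

Let im_norm_le (z : R[i]) : (`|complex.Im z|)%:C <= `|z|.
Proof.
case: z => a b; rewrite normc_def /= lecR -sqrtr_sqr ler_wsqrtr //.
by rewrite lerDr sqr_ge0.
Qed.

Lemma continuous_Re g : continuous (g : R -> (R[i] : numFieldType)) ->
  continuous (fun x => complex.Re (g x)).
Proof.
move=> cg x; apply/cvgrPdist_le => e e0.
have e0' : 0 < e%:C by rewrite ltcR.
have /cvgrPdist_le /(_ _ e0') := cg x.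
apply: filterS => y h; rewrite -lecR; apply: le_trans h.
by rewrite -raddfB; exact: re_norm_le.
Qed.

Lemma continuous_Im g : continuous (g : R -> (R[i] : numFieldType)) ->
  continuous (fun x => complex.Im (g x)).
Proof.
move=> cg x; apply/cvgrPdist_le => e e0.
have e0' : 0 < e%:C by rewrite ltcR.
have /cvgrPdist_le /(_ _ e0') := cg x.
apply: filterS => y h; rewrite -lecR; apply: le_trans h.
by rewrite -raddfB; exact: im_norm_le.
Qed.

Lemma continuous_complex u : continuous u ->
  continuous ((fun x => (u x)%:C) : R -> (R[i] : numFieldType)).
Proof.
move=> cu x; apply/cvgrPdist_le => e e0.
have /andP[/eqP ei er] : (complex.Im e == 0) && (0 < complex.Re e).
  by move: e0; rewrite ltcE /= eq_sym.
have eE : e = (complex.Re e)%:C by rewrite [LHS]complexE ei mulr0 addr0.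
have /cvgrPdist_le /(_ _ er) := cu x.
apply: filterS => y h; rewrite eE -rmorphB normc_def /= expr0n /= addr0 sqrtr_sqr.
by rewrite lecR.
Qed.

Lemma fourier_coef1E g k : continuous (fun x => complex.Re (g x)) ->
  continuous (fun x => complex.Im (g x)) ->
  fourier_coef1 g k =
  (int1 (fun x => complex.Re (g x) * cosi k x) +
   int1 (fun x => complex.Im (g x) * sini k x)) +i*
  (int1 (fun x => complex.Im (g x) * cosi k x) -
   int1 (fun x => complex.Re (g x) * sini k x)).
Proof.
move=> cu cv; rewrite -int1D -?int1B; try by apply: continuous_mul => //;
  (exact: continuous_cosi || exact: continuous_sini).
rewrite /fourier_coef1 /complex_integral; congr (_ +i* _);
  apply: eq_int1 => x _; rewrite /expi cosN sinN -/(cosi k x) -/(sini k x);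
  case: (g x) => a b /=; ring.
Qed.

(** The coefficients of [g] at [k] and [- k] are real and nonnegative. Adding them isolates the
    cosine coefficient of the real part, and comparing their imaginary parts kills its sine
    coefficient; so the real part alone competes, with the same mean. *)
Lemma turan_admissible_adm dl g : 0 < dl -> dl < 2^-1 -> turan_admissible dl g ->
  adm (complex.Re (fourier_coef1 g 0)) dl (fun x => complex.Re (g x)).
Proof.
move=> d0 d1 [gp cg gc gs g1].
have cu := continuous_Re cg; have cv := continuous_Im cg.
set u := (fun x => complex.Re (g x)) in cu *; set v := (fun x => complex.Im (g x)) in cv.
have up x : u (x + 1) = u x by rewrite /u gp.
have H k : 0 <= int1 (fun x => u x * cosi k x) /\ int1 (fun x => u x * sini k x) = 0.
  have := gc k; have := gc (- k).
  rewrite !fourier_coef1E // !lecE /= -/u -/v.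
  have EN w : int1 (fun x => w x * cosi (- k) x) = int1 (fun x => w x * cosi k x).
    by apply: eq_int1 => x _; rewrite cosiNk.
  have ES (w : R -> R) : continuous w ->
      int1 (fun x => w x * sini (- k) x) = - int1 (fun x => w x * sini k x).
    move=> cw; rewrite -[RHS]mulN1r -int1Z.
      by apply: eq_int1 => x _; rewrite siniNk mulrN mulN1r.
    by apply: continuous_mul => //; exact: continuous_sini.
  rewrite !EN !ES //; set a := int1 _; set b := int1 _; set c := int1 _; set d := int1 _.
  by move=> /andP[/eqP h1 h2] /andP[/eqP h3 h4]; split; lra.
split.
- have -> : complex.Re (fourier_coef1 g 0) = int1 u.
    rewrite fourier_coef1E //= -/u -/v.
    have -> : int1 (fun x => v x * sini 0 x) = 0.
      by rewrite -[RHS](int1_cst 0); apply: eq_int1 => x _; rewrite sini0 mulr0.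
    by rewrite addr0; apply: eq_int1 => x _; rewrite cosi0 mulr1.
  by apply: posdef_of_coefs => // k; case: (H k).
- by rewrite /u g1.
- apply: support_closed => //; first exact: ltW.
  move=> x dx; apply: contrapT => ux.
  have : closure [set x | g x != 0] x.
    by apply: subset_closure => /=; apply/eqP => gx; apply: ux; rewrite /u gx.
  move=> /gs [j]; rewrite /= in_itv /= -ler_norml => h.
  by have := le_trans (dZ_le x j) h; rewrite leNgt dx.
Qed.

Lemma adm_turan_admissible m dl u : 0 < dl -> adm m dl u ->
  turan_admissible dl (fun x => (u x)%:C) /\
  complex.Re (fourier_coef1 (fun x => (u x)%:C) 0) = int1 u.
Proof.
move=> d0 [pu u0 us]; have cu := posdef_continuous pu.
have c0 : continuous (fun x : R => 0 : R) := @continuous_cstf _ 0.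
have int0 (f : R -> R) : int1 (fun x => 0 * f x) = 0.
  by rewrite -[RHS](int1_cst 0); apply: eq_int1 => x _; rewrite mul0r.
have E k : fourier_coef1 (fun x => (u x)%:C) k =
    (int1 (fun x => u x * cosi k x)) +i* (0 : R).
  by rewrite fourier_coef1E //= !int0 addr0 (posdef_int1_sini _ pu) subr0.
split; last first.
  by rewrite E /=; apply: eq_int1 => x _; rewrite cosi0 mulr1.
split.
- by move=> x; rewrite -[1]/(1%:~R) (posdef_per _ _ pu).
- exact: continuous_complex.
- by move=> k; rewrite E lecE /= eqxx (posdef_int1_cosi _ pu).
- have cl : closed [set x : R | dZ x <= dl].
    have := @closed_le R dl; move/(closed_comp (f := @dZ R)); apply.
    by move=> x _; exact: continuous_dZ.
  have sub : [set x | (u x)%:C != 0] `<=` [set x : R | dZ x <= dl].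
    move=> x /=; rewrite leNgt; apply: contraNN => dx.
    by rewrite us // ltW.
  move=> x /(closure_subset sub); rewrite -(closure_id _).1 // => dx.
  by exists (rnd x); rewrite /= in_itv /= -ler_norml.
- by rewrite u0.
Qed.

Lemma turan_has_sup dl : 0 < dl -> dl < 2^-1 ->
  has_sup [set complex.Re (fourier_coef1 g 0) | g in turan_admissible dl].
Proof.
move=> d0 d1; split.
  have dh : 0 < dl <= 2^-1 by rewrite d0 ltW.
  have [h _] := adm_turan_admissible d0 (adm_tri dh).
  by eexists; eexists; first exact: h.
by exists 1 => _ [g hg <-]; exact: adm_le1 (turan_admissible_adm d0 d1 hg).
Qed.

Lemma adm_le_turan m dl u : 0 < dl -> dl < 2^-1 -> adm m dl u -> m <= turan dl.
Proof.
move=> d0 d1 au; have [h E] := adm_turan_admissible d0 au.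
have [pu _ _] := au; apply: (le_trans (posdef_le_int1 pu)).
by apply: (sup_upper_bound (turan_has_sup d0 d1)); rewrite -E; eexists; first exact: h.
Qed.

Lemma lt_turan_adm m dl : 0 < dl -> dl < 2^-1 -> m < turan dl ->
  exists u, adm m dl u.
Proof.
move=> d0 d1 mt; have e0 : 0 < turan dl - m by rewrite subr_gt0.
have [_ [g hg <-]] := sup_adherent e0 (turan_has_sup d0 d1).
rewrite -/(turan dl) opprB addrC subrK => h.
exists (fun x => complex.Re (g x)).
by apply: adm_le (turan_admissible_adm d0 d1 hg) => //; exact: ltW.
Qed.

Lemma turan_le c dl : 0 < dl -> dl < 2^-1 ->
  (forall m u, adm m dl u -> m <= c) -> turan dl <= c.
Proof.
move=> d0 d1 H; apply: ge_sup; first by have [] := turan_has_sup d0 d1.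
by move=> _ [g hg <-]; apply: H (turan_admissible_adm d0 d1 hg).
Qed.

Lemma turan_le1 dl : 0 < dl -> dl < 2^-1 -> turan dl <= 1.
Proof. by move=> d0 d1; apply: turan_le => // m u /adm_le1. Qed.

Lemma turan_ge dl : 0 < dl -> dl < 2^-1 -> dl <= turan dl.
Proof.
move=> d0 d1; have dh : 0 < dl <= 2^-1 by rewrite d0 ltW.
exact: adm_le_turan (adm_tri dh).
Qed.

Lemma turan_mono dl dl' : 0 < dl -> dl <= dl' -> dl' < 2^-1 ->
  turan dl <= turan dl'.
Proof.
move=> d0 dd d1; apply: turan_le => [||m u au] //; first exact: le_lt_trans d1.
by apply: (@adm_le_turan _ _ u) => //; [exact: lt_le_trans dd|exact: adm_le au].
Qed.

Lemma turan_inv (q : nat) : 2^-1 > q%:R^-1 :> R -> (0 < q)%N ->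
  turan (q%:R^-1 : R) = q%:R^-1.
Proof.
move=> q2 q0; have q1 : 0 < q%:R^-1 :> R by rewrite invr_gt0 ltr0n.
apply/eqP; rewrite eq_le turan_ge // andbT; apply: turan_le => // m u.
exact: adm_le_inv.
Qed.

Lemma turan_gt dl : 0 < dl -> dl < 2^-1 -> dl^-1 \isn't a Num.nat -> dl < turan dl.
Proof.
move=> d0 d1 /(adm_gt d0 d1)[m dm [g ag]].
exact: lt_le_trans dm (adm_le_turan d0 d1 ag).
Qed.

(** Otherwise competitors of mean at least [turan dl + e] exist for every larger support, and
    [adm_closed] produces one for [dl] itself. *)
Lemma turan_right dl (e : R) : 0 < dl -> dl < 2^-1 -> 0 < e ->
  exists2 d, dl < d & d < 2^-1 /\ turan d <= turan dl + e.
Proof.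
move=> d0 d1 e0; apply: contrapT => H.
have t0 : 0 < turan dl + e by rewrite addr_gt0 // (lt_le_trans d0) // turan_ge.
have [|g ag] := @adm_closed R (turan dl + e) dl t0 d0 d1.
  move=> d dd; pose d' := Num.min d ((dl + 2^-1) / 2).
  have dd' : dl < d' by rewrite lt_min dd /=; lra.
  have d'1 : d' < 2^-1 by rewrite gt_min; apply/orP; right; lra.
  have : turan dl + e < turan d'.
    by rewrite ltNge; apply/negP => h; apply: H; exists d'.
  move/(lt_turan_adm (lt_trans d0 dd') d'1) => [g ag].
  by exists g; apply: adm_le ag; rewrite // ge_min lexx.
by have := adm_le_turan d0 d1 ag; rewrite gerDl leNgt e0.
Qed.

(* One-sided Dirichlet approximation, by the pigeonhole principle. *)
Lemma dirichlet_above (d e : R) : 0 < d -> 0 < e ->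
  exists P M : nat, [/\ (0 < P)%N, P%:R * d <= M%:R & M%:R < P%:R * d + e].
Proof.
move=> d0 e0.
suff [P [k [P0 k1 k2]]] : exists (P : nat) (k : int),
    [/\ (0 < P)%N, P%:R * d <= k%:~R & k%:~R < P%:R * d + e].
  have k0 : 0 < k by rewrite -(ltr_int R) (lt_le_trans _ k1) // mulr_gt0 // ltr0n.
  by exists P, (absz k); split => //; rewrite natr_absz gtr0_norm.
pose N := (Num.truncn e^-1).+1.
have N0 : 0 < N%:R :> R by rewrite ltr0n.
have Ne : N%:R^-1 < e.
  rewrite -[e]invrK ltf_pV2 ?posrE ?invr_gt0 //.
  have ei : 0 <= e^-1 by rewrite invr_ge0 ltW.
  by have /andP[] := truncn_itv ei.
pose fr (n : nat) : R := n%:R * d - (Num.floor (n%:R * d))%:~R.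
have fr01 n : 0 <= fr n < 1.
  have := floor_itv (n%:R * d); rewrite intrD (_ : 1%:~R = 1) // /fr.
  by move=> /andP[h1 h2]; apply/andP; split; lra.
have bkt (n : nat) : (Num.truncn (N%:R * fr n) < N)%N.
  have /andP[f0 f1] := fr01 n.
  rewrite -(ltr_nat R); apply: (@le_lt_trans _ _ (N%:R * fr n)).
    by have /andP[] := truncn_itv (mulr_ge0 (ltW N0) f0).
  by rewrite -[ltRHS]mulr1 ltr_pM2l.
pose b (n : 'I_N.+1) := Ordinal (bkt n).
have /injectivePn[i [j ij]] : ~~ injectiveb b.
  by apply/negP => /injectiveP /leq_card; rewrite !card_ord ltnn.
move=> /(congr1 val) /= bij.
have clo : `|fr i - fr j| < e.
  have /andP[fi _] := fr01 i; have /andP[fj _] := fr01 j.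
  have := truncn_itv (mulr_ge0 (ltW N0) fi); rewrite bij.
  have := truncn_itv (mulr_ge0 (ltW N0) fj).
  rewrite -natr1; move: (Num.truncn _)%:R => t /andP[h1 h2] /andP[h3 h4].
  apply: lt_trans Ne; rewrite -(ltr_pM2l N0) divff ?gt_eqF //.
  rewrite -{1}[N%:R]ger0_norm ?ltW // -normrM mulrBr ltr_norml; apply/andP; split; lra.
wlog lij : i j ij bij clo / (j < i)%N.
  move=> H; have [h|h|h] := ltngtP i j.
  - by apply: (H j i) => //; [rewrite eq_sym|rewrite distrC].
  - exact: (H i j).
  - by case/eqP: ij; apply: val_inj.
pose q := (i - j)%N; have q0 : (0 < q)%N by rewrite subn_gt0.
have [k qd] : exists k : int, q%:R * d = k%:~R + (fr i - fr j).
  exists (Num.floor (i%:R * d) - Num.floor (j%:R * d)).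
  by rewrite /q natrB 1?ltnW // /fr rmorphB /=; ring.
move: clo qd; set t := fr i - fr j; rewrite ltr_norml => /andP[t1 t2] qd.
have [tn|tp] := leP t 0.
  by exists q, k; split => //; lra.
have tl1 : t < 1.
  have /andP[_ +] := fr01 i; have /andP[+ _] := fr01 j; rewrite /t; lra.
(* Here [q * d] exceeds the integer [k] by a small [t > 0]. The multiple [l * q * d] then exceeds
   [l * k] by more than [1 - t] and at most [1], so the integer [l * k + 1] is above it by less than
   [t < e]. *)
pose l := Num.truncn t^-1.
have ti0 : 0 <= t^-1 by rewrite invr_ge0 ltW.
have /andP[l1 l2] := truncn_itv ti0.
have l1' : l%:R * t <= 1 by rewrite -ler_pdivlMr // div1r.
have l2' : 1 < l%:R * t + t.
  by move: l2; rewrite -/l -natr1 -[t^-1]div1r ltr_pdivrMr // mulrDl mul1r.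
have l0 : (0 < l)%N.
  rewrite lt0n; apply/eqP => lz; move: l2'; rewrite lz mul0r; lra.
exists (l * q)%N, (l%:Z * k + 1).
rewrite muln_gt0 l0 q0 natrM -mulrA qd intrD intrM (_ : 1%:~R = 1) // mulrDr.
by split => //; rewrite -[(l%:Z)%:~R]/(l%:R); lra.
Qed.

(** On a grid with [M/P] just above [dl], a competitor for [dl] is active only up to the node
    [(M - 1)/P]. Hats of half-width [w] slightly below [1/P] then give support in [[-d, d]] with
    [d < dl], and the mean loses only the factor [P * w >= 1 - e]. *)
Lemma turan_left dl (e : R) : 0 < dl -> dl < 2^-1 -> 0 < e ->
  exists2 d, 0 < d < dl & turan dl - e <= turan d.
Proof.
move=> d0 d1 e0.
have [e1|e1] := leP 1 e.
  exists (dl / 2); first by rewrite divr_gt0 //=; lra.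
  apply: (@le_trans _ _ 0); first by have := turan_le1 d0 d1; lra.
  have h0 : 0 < dl / 2 by rewrite divr_gt0.
  by apply: (le_trans (ltW h0)); apply: turan_ge => //; lra.
have e4 : 0 < e / 4 by rewrite divr_gt0.
have [P [M [P0 M1 M2]]] := dirichlet_above d0 e4.
have Pr : 0 < P%:R :> R by rewrite ltr0n.
have M0 : (0 < M)%N by rewrite -(ltr_nat R) (lt_le_trans _ M1) // mulr_gt0.
have MM : M.-1%:R = M%:R - 1 :> R by rewrite -{2}(prednK M0) -natr1 addrK.
(* In units of the grid step this shift is at most [e / 4], as is the rounding of [P * dl] up to
   [M]; the cap [dl / 2] keeps [d] positive. *)
pose d := dl - Num.min (e / (4 * P%:R)) (dl / 2).
have s0 : 0 < Num.min (e / (4 * P%:R)) (dl / 2).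
  by rewrite lt_min !divr_gt0 // mulr_gt0.
have s1 : Num.min (e / (4 * P%:R)) (dl / 2) <= dl / 2 by rewrite ge_min lexx orbT.
have s2 : P%:R * Num.min (e / (4 * P%:R)) (dl / 2) <= e / 4.
  rewrite -ler_pdivlMl // ge_min; apply/orP; left.
  by rewrite le_eqVlt; apply/orP; left; apply/eqP; field; rewrite gt_eqF.
have dd : 0 < d < dl by rewrite /d; apply/andP; split; lra.
have /andP[dp dm] := dd; have d2 : d < 2^-1 := lt_trans dm d1.
exists d => //; rewrite lerBlDr; apply: turan_le => // m u au.
have [m0|m0] := leP m 0.
  apply: (le_trans m0); rewrite addr_ge0 ?(ltW e0) //.
  by apply: le_trans (turan_ge dp d2); exact: ltW.
pose w := d - M.-1%:R / P%:R.
have wE : P%:R * w = P%:R * d - M%:R + 1.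
  by rewrite /w mulrBr mulrCA divff ?gt_eqF // mulr1 MM; ring.
have Pd : P%:R * d >= P%:R * dl - e / 4 by rewrite /d mulrBr lerB.
have Pd' : P%:R * d <= P%:R * dl by rewrite ler_pM2l // ltW.
have w1 : 1 - e <= P%:R * w by rewrite wE; lra.
have w0 : 0 < w by rewrite -(pmulr_rgt0 _ Pr); lra.
have wP : w <= P%:R^-1 by rewrite -[leRHS]mul1r ler_pdivlMr // mulrC wE; lra.
have wd : w <= 2^-1.
  by apply: le_trans (ltW d2); rewrite /w lerBlDr lerDl divr_ge0.
have dM : dl <= M%:R / P%:R by rewrite ler_pdivlMr // mulrC.
have [g' ag'] := adm_grid P0 (ltW m0) au dM w0 wP wd.
have Ed : M.-1%:R / P%:R + w = d by rewrite /w addrC subrK.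
rewrite Ed in ag'; have h := adm_le_turan dp d2 ag'.
have : (1 - e) * m <= P%:R * m * w.
  by rewrite mulrAC ler_wpM2r // ltW.
have := adm_le1 au; nra.
Qed.

Lemma continuous_turan dl : 0 < dl -> dl < 2^-1 -> {for dl, continuous (@turan R)}.
Proof.
move=> d0 d1; apply/cvgrPdist_le => e e0.
have [a /andP[a0 a1] a2] := turan_left d0 d1 e0.
have [b b1 [b2 b3]] := turan_right d0 d1 e0.
near=> x.
have ax : a < x by near: x; exact: lt_nbhsr.
have xb : x < b by near: x; exact: lt_nbhsl.
have := turan_mono a0 (ltW ax) (lt_trans xb b2).
have := turan_mono (lt_trans a0 ax) (ltW xb) b2.
by rewrite ler_norml; lra.
Unshelve. all: end_near. Qed.

Lemma turan_second_order dl : 0 < dl -> dl <= 16^-1 ->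
  turan dl <= dl + 1537 * dl ^+ 3.
Proof.
move=> d0 d1; have d2 : dl < 2^-1 by lra.
apply: turan_le => // m u au.
have [m0|m0] := leP m 0.
  apply: (le_trans m0); have := exprn_gt0 3 d0; lra.
(* [K] is so large that rounding [dl] up to [M / (8 K)] adds at most [dl ^+ 3]; moreover [K >= 2]
   and [dl <= 1/16] give [M <= 8 K dl + 1 <= K / 2 + 1 <= K]. *)
pose K := (Num.truncn (8 * dl ^+ 3)^-1).+2.
have d3 : 0 < dl ^+ 3 by rewrite exprn_gt0.
have K0 : 0 < K%:R :> R by rewrite ltr0n.
have K1 : 1 < 8 * K%:R * dl ^+ 3.
  have h0 : 0 <= (8 * dl ^+ 3)^-1 by rewrite invr_ge0 mulr_ge0 // ltW.
  have /andP[_ h] := truncn_itv h0.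
  have : (8 * dl ^+ 3)^-1 < K%:R by apply: (lt_trans h); rewrite ltr_nat.
  by rewrite -div1r ltr_pdivrMr ?mulr_gt0 //; lra.
have K2 : 2 <= K%:R :> R by rewrite ler_nat.
pose M := (Num.truncn (8 * K%:R * dl)).+1.
have kd0 : 0 <= 8 * K%:R * dl by rewrite !mulr_ge0 // ltW.
have /andP[M1 M2] := truncn_itv kd0; rewrite -/M in M2.
have M3 : M%:R <= 8 * K%:R * dl + 1 by rewrite /M -natr1; lra.
have MK : (M <= K)%N.
  rewrite -(ler_nat R); apply: (le_trans M3).
  have := ler_wpM2l (ltW K0) d1; lra.
have dM : dl <= M%:R / (8 * K)%:R by rewrite natrM ler_pdivlMr ?mulr_gt0 //; lra.
have M0 : (0 < M)%N by [].
have := adm_tent_bound M0 MK (ltW m0) au dM.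
rewrite natrM; set k := K%:R in K0 K1 K2 M3 *; set c := M%:R in M2 M3 *.
pose t := c / (8 * k).
have cE : c = 8 * k * t by rewrite /t; field; rewrite gt_eqF.
have t0 : 0 <= t by rewrite divr_ge0 // mulr_ge0 // ltW.
have t1 : t <= dl + dl ^+ 3.
  by rewrite /t ler_pdivrMr ?mulr_gt0 //; lra.
have t2 : t <= 2 * dl.
  have : dl ^+ 3 <= dl.
    by rewrite exprS ler_piMr ?(ltW d0) // exprn_ile1 ?(ltW d0) //; lra.
  by lra.
(* The factor is [192 = 3 * 8 ^+ 3 / 8]; with [t <= 2 * dl] the cubic term is at most
   [1536 * dl ^+ 3], and the rounding of [dl] adds one more [dl ^+ 3]. *)
have -> : c + 3 * c ^+ 3 / k ^+ 2 = (t + 192 * t ^+ 3) * (8 * k).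
  by rewrite cE; field; rewrite gt_eqF.
rewrite ler_pM2r ?mulr_gt0 // => /le_trans; apply.
have : t ^+ 3 <= (2 * dl) ^+ 3 by rewrite lerXn2r // nnegrE // mulr_ge0 // ltW.
rewrite exprMn; lra.
Qed.

Lemma theta_ge0 dl : 0 < dl -> dl < 2^-1 -> 0 <= theta dl.
Proof.
move=> d0 d1; have h := turan_ge d0 d1.
by rewrite /theta subr_ge0 ler_pdivrMr ?mul1r // (lt_le_trans d0).
Qed.

Lemma continuous_theta dl : 0 < dl -> dl < 2^-1 -> {for dl, continuous (@theta R)}.
Proof.
move=> d0 d1; have t0 : turan dl != 0.
  by rewrite gt_eqF // (lt_le_trans d0) // turan_ge.
apply: cvgB; first exact: cvg_cst.
apply: cvgM; first exact: cvg_id.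
by apply: cvgV => //; exact: continuous_turan.
Qed.

Lemma theta_bigO : ((@theta R : R -> R^o) =O_ (0^'+) (fun dl : R => dl ^+ 2))%classic.
Proof.
apply/eqO_exP; exists 1537; first by rewrite ltr0n.
near=> x.
have x0 : 0 < x by near: x; exact: nbhs_right_gt.
have x1 : x < 16^-1 by near: x; apply: nbhs_right_lt; rewrite invr_gt0.
have x2 : x < 2^-1 by lra.
have tx := turan_ge x0 x2; have t0 := lt_le_trans x0 tx.
rewrite ger0_norm ?theta_ge0 // ger0_norm ?sqr_ge0 //.
rewrite /theta lerBlDr -lerBlDl ler_pdivlMr //.
have := turan_second_order x0 (ltW x1).
have : x ^+ 2 * x <= x ^+ 2 * turan x by rewrite ler_wpM2l // sqr_ge0.
rewrite exprS; lra.
Unshelve. all: end_near. Qed.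

Lemma theta_inv dl : 0 < dl -> dl < 2^-1 -> dl^-1 \is a Num.nat -> theta dl = 0.
Proof.
move=> d0 d1 /natrP[q qE].
have q0 : (0 < q)%N by rewrite -(ltr0n R) -qE invr_gt0.
have dE : dl = q%:R^-1 by rewrite -qE invrK.
rewrite dE in d1 *; rewrite /theta turan_inv // divff ?subrr //.
by rewrite invr_eq0 pnatr_eq0 -lt0n.
Qed.

Lemma theta_itv dl : 0 < dl -> dl < 2^-1 -> dl^-1 \isn't a Num.nat ->
  0 < theta dl < 1.
Proof.
move=> d0 d1 /(turan_gt d0 d1) h; have t0 := lt_trans d0 h.
by rewrite /theta subr_gt0 ltr_pdivrMr // mul1r h ltrBlDr ltrDl divr_gt0.
Qed.

End complex_turan.

(** * Approximate identities made of symmetric Markov kernels *)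

Section symmetric_kernels.
Context {d : measure_display} {T : measurableType d} {R : realType}.
Variable m : {sigma_finite_measure set T -> \bar R}.
Variable C : set T.
Hypothesis mC : measurable C.
Hypothesis finC : (m C < +oo)%E.
Implicit Types (K : T * T -> R) (u v w : T -> R) (A : set T).
Local Open Scope ereal_scope.

(* A symmetric Markov kernel density on [C]. *)
Definition skernel K : Prop :=
  [/\ measurable_fun setT K, forall z, (0 <= K z)%R,
      forall x y, K (x, y) = K (y, x) &
      forall x, \int[m]_y (K (x, y))%:E = (\1_C x)%:E].

(** The oscillation dominates the [L^1] distance on [C] between [w] and its smoothing. It depends
    only on [|w x - w y|], so pointwise inequalities between differences transfer to it, which suits
    set operations on indicators. *)
Definition osc K w : \bar R := \int[m \x m]_z (`|w z.1 - w z.2| * K z)%:E.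

Lemma measurable_osc_integrand K w : skernel K -> measurable_fun setT w ->
  measurable_fun setT (fun z : T * T => `|w z.1 - w z.2| * K z : R)%R.
Proof.
move=> [mK _ _ _] mw; apply: measurable_funM => //.
apply: measurableT_comp => //; apply: measurable_funB.
  exact: measurableT_comp.
exact: measurableT_comp.
Qed.

Lemma measurable_skernel_l K w : skernel K -> measurable_fun setT w ->
  measurable_fun setT (fun z : T * T => w z.1 * K z : R)%R.
Proof.
move=> [mK _ _ _] mw; apply: measurable_funM => //.
exact: measurableT_comp.
Qed.

Lemma measurable_skernel_r K w : skernel K -> measurable_fun setT w ->
  measurable_fun setT (fun z : T * T => w z.2 * K z : R)%R.
Proof.
move=> [mK _ _ _] mw; apply: measurable_funM => //.
exact: measurableT_comp.
Qed.

Lemma measurable_section_l K x : skernel K -> measurable_fun setT (fun y => K (x, y)).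
Proof. by case=> mK _ _ _; apply: (measurableT_comp mK); exact: measurable_pair1. Qed.

Lemma skernel_marginal_l K w : skernel K -> measurable_fun setT w ->
  (forall x, (0 <= w x)%R) ->
  \int[m \x m]_z (w z.1 * K z)%:E = \int[m]_x (w x * \1_C x)%:E.
Proof.
move=> sK mw w0; have [mK K0 Ks K1] := sK.
rewrite fubini_tonelli1; first last.
- by move=> z; rewrite lee_fin mulr_ge0.
- by apply/measurable_EFinP; exact: measurable_skernel_l.
apply: eq_integral => x _; rewrite /fubini_F /=.
under eq_integral do rewrite EFinM.
rewrite ge0_integralZl_EFin ?K1 ?EFinM //.
- by move=> y _; rewrite lee_fin.
- by apply/measurable_EFinP; exact: measurable_section_l.
Qed.

Lemma skernel_marginal_r K w : skernel K -> measurable_fun setT w ->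
  (forall x, (0 <= w x)%R) ->
  \int[m \x m]_z (w z.2 * K z)%:E = \int[m]_x (w x * \1_C x)%:E.
Proof.
move=> sK mw w0; have [mK K0 Ks K1] := sK.
rewrite fubini_tonelli2; first last.
- by move=> z; rewrite lee_fin mulr_ge0.
- by apply/measurable_EFinP; exact: measurable_skernel_r.
apply: eq_integral => y _; rewrite /fubini_G /=.
under eq_integral do rewrite Ks EFinM.
rewrite ge0_integralZl_EFin ?K1 ?EFinM //.
- by move=> x _; rewrite lee_fin.
- by apply/measurable_EFinP; exact: measurable_section_l.
Qed.

Lemma le_osc K w w1 w2 : skernel K -> measurable_fun setT w ->
  measurable_fun setT w1 -> measurable_fun setT w2 ->
  (forall x y, `|w x - w y| <= `|w1 x - w1 y| + `|w2 x - w2 y|)%R ->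
  osc K w <= osc K w1 + osc K w2.
Proof.
move=> sK mw mw1 mw2 H; have [mK K0 Ks K1] := sK.
rewrite /osc -ge0_integralD //; first last.
- by apply/measurable_EFinP; exact: measurable_osc_integrand.
- by move=> z _; rewrite lee_fin mulr_ge0.
- by apply/measurable_EFinP; exact: measurable_osc_integrand.
- by move=> z _; rewrite lee_fin mulr_ge0.
apply: ge0_le_integral => //.
- by move=> z _; rewrite lee_fin mulr_ge0.
- by apply/measurable_EFinP; exact: measurable_osc_integrand.
- by apply: emeasurable_funD; apply/measurable_EFinP; exact: measurable_osc_integrand.
- by move=> z _; rewrite -EFinD lee_fin -mulrDl ler_wpM2r.
Qed.

(** Both marginals of the kernel are the measure restricted to [C], and each of [|w x|] and [|w y|]
    is integrated against one of them. The bound is uniform in the kernel, so [vanishing] is stable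
    under [L^1] approximation on [C]. *)
Lemma osc_le_L1 K w : skernel K -> measurable_fun setT w ->
  osc K w <= 2%:E * \int[m]_x (`|w x| * \1_C x)%:E.
Proof.
move=> sK mw; have [mK K0 Ks K1] := sK.
have ma : measurable_fun setT (fun x => `|w x|)%R by exact: measurableT_comp.
rewrite (_ : 2%:E = 1 + 1); last by rewrite -EFinD -mulr2n.
rewrite ge0_muleDl // mul1e.
rewrite -{1}(skernel_marginal_l sK ma) // -(skernel_marginal_r sK ma) //.
rewrite -ge0_integralD //; first last.
- by apply/measurable_EFinP; exact: (measurable_skernel_r sK ma).
- by move=> z _; rewrite lee_fin mulr_ge0.
- by apply/measurable_EFinP; exact: (measurable_skernel_l sK ma).
- by move=> z _; rewrite lee_fin mulr_ge0.
apply: ge0_le_integral => //.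
- by move=> z _; rewrite lee_fin mulr_ge0.
- by apply/measurable_EFinP; exact: measurable_osc_integrand.
- by apply: emeasurable_funD; apply/measurable_EFinP;
    [exact: (measurable_skernel_l sK ma)|exact: (measurable_skernel_r sK ma)].
- by move=> z _; rewrite -EFinD lee_fin -mulrDl ler_wpM2r // ler_normB.
Qed.

Section approximate_identity.
Variable K : nat -> T * T -> R.
Hypothesis sK : forall N, skernel (K N).

Definition vanishing w := measurable_fun setT w /\
  forall e : R, (0 < e)%R -> \forall N \near \oo, osc (K N) w <= e%:E.

Lemma vanishing_le w w1 w2 : measurable_fun setT w ->
  (forall x y, `|w x - w y| <= `|w1 x - w1 y| + `|w2 x - w2 y|)%R ->
  vanishing w1 -> vanishing w2 -> vanishing w.
Proof.
move=> mw H [mw1 c1] [mw2 c2]; split => // e e0.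
have e2 : (0 < e / 2)%R by rewrite divr_gt0.
apply: filterS2 (c1 _ e2) (c2 _ e2) => N h1 h2.
apply: (le_trans (le_osc (sK N) mw mw1 mw2 H)).
by rewrite [e]splitr EFinD leeD.
Qed.

Lemma vanishing_cst (c : R) : vanishing (cst c).
Proof.
split; first exact: measurable_cst.
move=> e e0; apply: nearW => N; rewrite /osc integral0_eq ?lee_fin ?ltW // => z _.
by rewrite subrr normr0 mul0r.
Qed.

Lemma osc_scale N (c : R) w : measurable_fun setT w ->
  osc (K N) (fun x => c * w x)%R = `|c|%:E * osc (K N) w.
Proof.
move=> mw; rewrite /osc -ge0_integralZl_EFin //.
- by apply: eq_integral => z _; rewrite -mulrBr normrM -mulrA EFinM.
- by move=> z _; rewrite lee_fin mulr_ge0 //; case: (sK N).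
- by apply/measurable_EFinP; exact: measurable_osc_integrand.
Qed.

Lemma vanishing_scale (c : R) w : vanishing w -> vanishing (fun x => c * w x)%R.
Proof.
move=> [mw cw]; split; first exact: measurable_funM.
move=> e e0; have c1 : (0 < `|c| + 1)%R by rewrite ltr_wpDl.
apply: filterS (cw _ (divr_gt0 e0 c1)) => N h.
rewrite osc_scale //; apply: (le_trans (lee_wpmul2l _ h)); first by rewrite lee_fin.
by rewrite -EFinM lee_fin mulrCA ler_piMr ?ltW // ltr_pdivrMr // mul1r ltrDl.
Qed.

Lemma vanishing_add w1 w2 : vanishing w1 -> vanishing w2 ->
  vanishing (fun x => w1 x + w2 x)%R.
Proof.
move=> v1 v2; have [m1 _] := v1; have [m2 _] := v2.
apply: vanishing_le v1 v2; first exact: measurable_funD.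
move=> x y; have -> : (w1 x + w2 x - (w1 y + w2 y) = (w1 x - w1 y) + (w2 x - w2 y))%R.
  by ring.
exact: ler_normD.
Qed.

Lemma vanishing_approx w : measurable_fun setT w ->
  (forall e : R, (0 < e)%R -> exists2 s, vanishing s &
     \int[m]_x (`|w x - s x| * \1_C x)%:E <= e%:E) -> vanishing w.
Proof.
move=> mw H; split => // e e0.
have e4 : (0 < e / 4)%R by rewrite divr_gt0.
have e2 : (0 < e / 2)%R by rewrite divr_gt0.
have [s [ms vs] ws] := H _ e4.
apply: filterS (vs _ e2) => N h.
have mB : measurable_fun setT (fun x => w x - s x)%R by exact: measurable_funB.
apply: (@le_trans _ _ (osc (K N) s + osc (K N) (fun x => w x - s x)%R)).
  apply: le_osc => // x y.
  have -> : (w x - w y = (s x - s y) + ((w x - s x) - (w y - s y)))%R by ring.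
  exact: ler_normD.
rewrite [e]splitr EFinD leeD //.
apply: (le_trans (osc_le_L1 (sK N) mB)).
apply: (le_trans (lee_wpmul2l _ ws)); first by rewrite lee_fin.
rewrite -EFinM lee_fin; lra.
Qed.

Lemma vanishing_indicC A : measurable A -> vanishing \1_A -> vanishing \1_(~` A).
Proof.
move=> mA vA; apply: vanishing_le vA (vanishing_cst 0).
  by apply: measurable_indic; exact: measurableC.
move=> x y; rewrite subrr normr0 addr0 !indicE !in_setC.
by case: (x \in A); case: (y \in A); rewrite /= ?subrr ?normr0 ?subr0 ?sub0r ?normrN.
Qed.

Lemma vanishing_indicU A B : measurable A -> measurable B ->
  vanishing \1_A -> vanishing \1_B -> vanishing \1_(A `|` B).
Proof.
move=> mA mB; apply: vanishing_le.
  by apply: measurable_indic; exact: measurableU.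
move=> x y; rewrite !indicE !in_setU.
by case: (x \in A); case: (y \in A); case: (x \in B); case: (y \in B);
  rewrite /= ?subrr ?normr0 ?subr0 ?sub0r ?normrN ?normr1; lra.
Qed.

(** Finite unions are covered by [vanishing_indicU]; as [C] has finite measure, what they miss of
    the countable union inside [C] has measure tending to [0], and [vanishing_approx] applies. *)
Lemma vanishing_indic_bigcup (F : (set T)^nat) :
  (forall k, measurable (F k) /\ vanishing \1_(F k)) ->
  vanishing \1_(\bigcup_k F k).
Proof.
move=> HF; have mF k : measurable (F k) by case: (HF k).
pose G n := \big[setU/set0]_(k < n) F k.
have mG n : measurable (G n) by apply: bigsetU_measurable.
have vG n : vanishing \1_(G n).
  elim: n => [|n ih]; last first.
    rewrite /G big_ord_recr /= -/(G n).
    by apply: (vanishing_indicU (mG n) (mF n) ih); case: (HF n).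
  by rewrite /G big_ord0 indic0; exact: vanishing_cst.
have mU : measurable (\bigcup_k F k) by exact: bigcup_measurable.
pose H n := (\bigcup_k F k `\` G n) `&` C.
have mH n : measurable (H n) by apply: measurableI => //; exact: measurableD.
have H0 : m \o H @ \oo --> 0.
  have -> : 0 = m (\bigcap_n H n).
    rewrite (_ : \bigcap_n H n = set0) ?measure0 //.
    apply/seteqP; split => // x Hx; have [[k _ Fk] nG] := (Hx 0%N I).1.
    have [[_ h] _] := Hx k.+1 I; apply: h.
    by rewrite /G big_ord_recr /=; right.
  apply: nonincreasing_cvg_mu => //.
  - by apply: (le_lt_trans _ finC); apply: le_measure; rewrite ?inE //; exact: subIsetr.
  - exact: bigcap_measurable.
  - move=> p q pq; apply/subsetPset; apply: setSI; apply: setDS.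
    exact: subset_bigsetU.
apply: vanishing_approx; first exact: measurable_indic.
move=> e e0; have [n hn] : exists n, m (H n) <= e%:E.
  have := H0; move/fine_cvgP => [fH /cvgrPdist_le /(_ _ e0) cH].
  have [n _ hn] : \forall n \near \oo, m (H n) <= e%:E.
    apply: filterS2 fH cH => n fn /=; rewrite sub0r normrN ger0_norm ?fine_ge0 // => h.
    by rewrite -[m (H n)](fineK fn) lee_fin.
  by exists n; exact: hn n (leqnn n).
exists \1_(G n) => //; apply: le_trans hn.
rewrite -[H n]setIT -integral_indic //.
rewrite le_eqVlt; apply/orP; left; apply/eqP; apply: eq_integral => x _.
congr EFin; rewrite !indicE /H in_setI in_setD.
have GU : x \in G n -> x \in \bigcup_k F k.
  by rewrite !inE /G -bigcup_mkord => -[k _ Fk]; exists k.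
case: (x \in C); rewrite ?mulr0 ?andbF // mulr1 andbT.
case: (x \in G n) GU => [->//|_]; first by rewrite subrr normr0.
by case: (x \in _); rewrite /= subr0 ?normr1 ?normr0.
Qed.

(** Convergence of the smoothings is thus reduced to generating sets: once half-spaces are checked,
    all measurable sets follow, and then, through simple functions, all integrable functions. *)
Lemma vanishing_sigma_algebra :
  sigma_algebra setT [set A | measurable A /\ vanishing \1_A].
Proof.
split => [|B [mB vB]|F mF].
- split; first exact: measurable0.
  by rewrite indic0; exact: vanishing_cst.
- by rewrite setTD; split; [exact: measurableC|exact: vanishing_indicC].
- split; first by apply: bigcup_measurable => k _; case: (mF k).
  exact: vanishing_indic_bigcup.
Qed.

Import HBSimple.

Lemma vanishing_integrable u : (forall A, measurable A -> vanishing \1_A) ->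
  m.-integrable setT (EFin \o u) -> vanishing u.
Proof.
move=> vA iu; have mu : measurable_fun setT u.
  by apply/measurable_EFinP; exact: (measurable_int m iu).
apply: vanishing_approx => // e e0.
have [s [ints _ cs]] := approximation_sfun_integrable measurableT iu.
have [n hn] : exists n, \int[m]_x `|(u x)%:E - (s n x)%:E| <= e%:E.
  have := cs; move/fine_cvgP => [fH /cvgrPdist_le /(_ _ e0) cH].
  have [n _ hn] : \forall n \near \oo, \int[m]_x `|(u x)%:E - (s n x)%:E| <= e%:E.
    apply: filterS2 fH cH => n fn /=.
    rewrite sub0r normrN ger0_norm ?fine_ge0 ?integral_ge0 // => h.
    by rewrite -(fineK fn) lee_fin.
  by exists n; exact: hn n (leqnn n).
exists (s n).
  have E : (s n : T -> R) = (fun x => \sum_(y <- finmap.enum_fset (fset_set (range (s n))))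
      y * \1_(s n @^-1` [set y]) x)%R.
    by apply/funext => x; rewrite fimfunE fsbig_finite.
  rewrite E; elim: (finmap.enum_fset _) => [|y r ih].
    under eq_fun do rewrite big_nil; exact: vanishing_cst.
  under eq_fun do rewrite big_cons; apply: vanishing_add => //.
  by apply: vanishing_scale; apply: vA.
apply: le_trans hn; apply: ge0_le_integral => //.
- apply/measurable_EFinP; apply: measurable_funM; last exact: measurable_indic.
  by apply: measurableT_comp => //; exact: measurable_funB.
- apply: measurableT_comp => //; apply: emeasurable_funB; exact/measurable_EFinP.
- by move=> x _; rewrite -EFinB /= lee_fin ler_piMr.
Qed.

End approximate_identity.
End symmetric_kernels.

(** * Smoothing: local energy bounds and lower semicontinuity *)

Section smoothing.
Context {d : measure_display} {T : measurableType d} {R : realType}.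
Variable m : {sigma_finite_measure set T -> \bar R}.
Variable C : set T.
Hypothesis mC : measurable C.
Hypothesis finC : (m C < +oo)%E.
Implicit Types (K : T * T -> R) (u v w : T -> R) (A : set T).

Definition smooth K u x : R := \int[m]_y (u y * K (x, y)).

Section one_kernel.
Variables (K : T * T -> R) (b : R).
Hypothesis sK : skernel m C K.
Hypothesis bK : forall z, K z <= b.

Let K0 z : 0 <= K z. Proof. by case: sK. Qed.

Lemma kernel_mul_integrable u x : m.-integrable setT (EFin \o u) ->
  m.-integrable setT (EFin \o (fun y => u y * K (x, y))).
Proof.
move=> iu; have mu : measurable_fun setT u.
  by apply/measurable_EFinP; exact: (measurable_int m iu).
have b0 : 0 <= b by apply: le_trans (bK (x, x)).
apply: (@le_integrable _ _ _ _ _ measurableT _ (EFin \o (fun y => b * u y))).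
- apply/measurable_EFinP; apply: measurable_funM => //.
  exact: measurable_section_l sK.
- move=> y _; rewrite /= lee_fin !normrM mulrC ler_wpM2r //.
  by rewrite !ger0_norm.
- rewrite (_ : EFin \o _ = (fun y => b%:E * (EFin \o u) y)%E) //.
  exact: integrableZl.
Qed.

Lemma kernel_integrable x : C x -> m.-integrable setT (EFin \o (fun y => K (x, y))).
Proof.
move=> Cx; apply/integrableP; split.
  by apply/measurable_EFinP; exact: measurable_section_l sK.
have [_ _ _ K1] := sK.
rewrite (eq_integral (fun y => (K (x, y))%:E)); last first.
  by move=> y _; rewrite /= ger0_norm.
by rewrite K1 ltry.
Qed.

Lemma kernel_Rintegral x : C x -> \int[m]_y K (x, y) = 1.
Proof.
by move=> Cx; case: sK => _ _ _ K1; rewrite /Rintegral K1 /= indicE mem_set.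
Qed.

Lemma sub_smooth_le u x : m.-integrable setT (EFin \o u) -> C x ->
  (`|u x - smooth K u x|%:E <= \int[m]_y (`|u x - u y| * K (x, y))%:E)%E.
Proof.
move=> iu Cx; have iuK := kernel_mul_integrable x iu.
have iK := kernel_integrable Cx.
have iK' : m.-integrable setT (EFin \o (fun y => u x * K (x, y))).
  exact: (integrableZl measurableT (u x) iK).
have -> : u x - smooth K u x = \int[m]_y (u x * K (x, y) - u y * K (x, y)).
  by rewrite RintegralB // RintegralZl // kernel_Rintegral // mulr1.
have iB : m.-integrable setT (EFin \o (fun y => u x * K (x, y) - u y * K (x, y))).
  exact: (integrableB measurableT iK' iuK).
rewrite EFin_normr_Rintegral //.
apply: le_trans (le_abse_integral _ _ (measurable_int m iB)) _ => //.
rewrite le_eqVlt; apply/orP; left; apply/eqP; apply: eq_integral => y _ /=.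
by rewrite -mulrBl normrM (ger0_norm (K0 _)).
Qed.

Lemma measurable_smooth u : m.-integrable setT (EFin \o u) ->
  measurable_fun setT (smooth K u).
Proof.
move=> iu; have mu : measurable_fun setT u.
  by apply/measurable_EFinP; exact: (measurable_int m iu).
have mF : measurable_fun setT (EFin \o (fun z : T * T => u z.2 * K z)).
  by apply/measurable_EFinP; exact: (measurable_skernel_r sK mu).
have iF : (m \x m)%E.-integrable setT (EFin \o (fun z : T * T => u z.2 * K z)).
  apply/integrableP; split => //.
  have ma : measurable_fun setT (fun x => `|u x|) by exact: measurableT_comp.
  rewrite (eq_integral (fun z : T * T => (`|u z.2| * K z)%:E)); last first.
    by move=> z _; rewrite /= normrM (ger0_norm (K0 _)).
  rewrite (skernel_marginal_r sK ma) //.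
  have /integrableP[_] := iu; apply: le_lt_trans.
  apply: ge0_le_integral => //.
  - by apply/measurable_EFinP; apply: measurable_funM => //; exact: measurable_indic.
  - by apply: measurableT_comp => //; exact/measurable_EFinP.
  - by move=> x _; rewrite /= lee_fin ler_piMr // indic_le1.
have := measurable_fubini_F iF.
rewrite /fubini_F /= => h.
rewrite (_ : smooth K u = fine \o (fun x => \int[m]_y (u y * K (x, y))%:E)%E) //.
exact: measurableT_comp.
Qed.

Lemma L1_sub_smooth_le u : m.-integrable setT (EFin \o u) ->
  (\int[m]_x (`|u x - smooth K u x| * \1_C x)%:E <= osc m K u)%E.
Proof.
move=> iu; have mu : measurable_fun setT u.
  by apply/measurable_EFinP; exact: (measurable_int m iu).
have mo := measurable_osc_integrand sK mu.
rewrite /osc fubini_tonelli1; last 2 first.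
- exact/measurable_EFinP.
- by move=> z; rewrite lee_fin mulr_ge0.
apply: ge0_le_integral => //.
- apply/measurable_EFinP; apply: measurable_funM; last exact: measurable_indic.
  by apply: measurableT_comp => //; apply: measurable_funB => //; exact: measurable_smooth.
- apply: measurable_fun_fubini_tonelli_F; first exact/measurable_EFinP.
  by move=> z; rewrite lee_fin mulr_ge0.
- move=> x _; rewrite indicE; have [xC|xC] := boolP (x \in C); last first.
    by rewrite mulr0; apply: integral_ge0 => y _; rewrite lee_fin mulr_ge0.
  by rewrite mulr1; apply: sub_smooth_le => //; rewrite inE in xC.
Qed.

(** The integral is split along [D]. Inside, Jensen's inequality holds for the probability density
    [K (x, .)]; outside, where [u] is only integrable, the kernel is at most [tau]. The parts
    recombine by [(p + q)^2 <= (1 + eta) p^2 + (1 + eta^-1) q^2]. *)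
Lemma smooth_sq_le u (D : set T) (tau eta : R) x : measurable D ->
  m.-integrable setT (EFin \o u) -> m.-integrable setT (EFin \o (fun y => u y ^+ 2 * \1_D y)) ->
  0 < eta -> 0 <= tau -> C x ->
  (forall y, ~ D y -> u y != 0 -> K (x, y) <= tau) ->
  smooth K u x ^+ 2 <= (1 + eta) * (\int[m]_y (u y ^+ 2 * \1_D y * K (x, y))) +
    (1 + eta^-1) * (tau * \int[m]_y `|u y|) ^+ 2.
Proof.
move=> mD iu iu2 eta0 tau0 Cx Ktau.
have mu : measurable_fun setT u.
  by apply/measurable_EFinP; exact: (measurable_int m iu).
have mI : measurable_fun setT (\1_D : T -> R) by exact: measurable_indic.
have iuD : m.-integrable setT (EFin \o (fun y => u y * \1_D y)).
  apply: (le_integrable _ _ _ iu) => //.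
    by apply/measurable_EFinP; exact: measurable_funM.
  by move=> y _ /=; rewrite lee_fin normrM ler_piMr // ger0_norm // indic_le1.
have iuD' : m.-integrable setT (EFin \o (fun y => u y * (1 - \1_D y))).
  apply: (le_integrable _ _ _ iu) => //.
    by apply/measurable_EFinP; apply: measurable_funM => //; exact: measurable_funB.
  move=> y _ /=; rewrite lee_fin normrM ler_piMr //.
  by rewrite indicE; case: (y \in D); rewrite ?subrr ?normr0 ?subr0 ?normr1.
have ia := kernel_mul_integrable x iuD; have ib := kernel_mul_integrable x iuD'.
have i2 := kernel_mul_integrable x iu2; have iK := kernel_integrable Cx.
set p := \int[m]_y (u y * \1_D y * K (x, y)) in ia *.
pose q := \int[m]_y (u y * (1 - \1_D y) * K (x, y)).
have -> : smooth K u x = p + q.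
  rewrite -RintegralD //; apply: eq_Rintegral => y _; ring.
have qle : `|q| <= tau * \int[m]_y `|u y|.
  have iau : m.-integrable setT (EFin \o (fun y => `|u y|)) by exact: integrable_norm.
  apply: (le_trans (le_normr_Rintegral _ ib)) => //; rewrite -RintegralZl //.
  apply: le_Rintegral => //.
  - exact: integrable_norm.
  - exact: (integrableZl measurableT tau iau).
  - move=> y _; rewrite !normrM (ger0_norm (K0 _)).
    have [->|uy] := eqVneq (u y) 0; first by rewrite normr0 !mul0r mulr0.
    rewrite indicE; have [yD|yD] := boolP (y \in D).
      by rewrite subrr normr0 mulr0 mul0r mulr_ge0.
    rewrite subr0 normr1 mulr1 mulrC ler_wpM2r //; apply: Ktau => //.
    by move=> Dy; move/negP: yD; apply; rewrite inE.
have ple : p ^+ 2 <= \int[m]_y (u y ^+ 2 * \1_D y * K (x, y)).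
  (* Jensen's inequality by integrating [2 p v - p ^+ 2 <= v ^+ 2] against the kernel, with [v] the
     part of [u] in [D]. *)
  pose F y := 2 * p * (u y * \1_D y * K (x, y)) - p ^+ 2 * K (x, y).
  have i1 : m.-integrable setT (EFin \o (fun y => 2 * p * (u y * \1_D y * K (x, y)))).
    exact: (integrableZl measurableT (2 * p) ia).
  have i3 : m.-integrable setT (EFin \o (fun y => p ^+ 2 * K (x, y))).
    exact: (integrableZl measurableT (p ^+ 2) iK).
  have -> : p ^+ 2 = \int[m]_y F y.
    rewrite RintegralB // !RintegralZl // kernel_Rintegral // -/p; ring.
  apply: le_Rintegral => //.
    exact: (integrableB measurableT i1 i3).
  move=> y _; rewrite /F indicE mulrA -mulrBl ler_wpM2r //.
  case: (y \in D); have := sqr_ge0 (u y - p); have := sqr_ge0 p; rewrite /=; lra.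
have q2 : q ^+ 2 <= (tau * \int[m]_y `|u y|) ^+ 2.
  rewrite -[leLHS]real_normK ?num_real // lerXn2r // ?nnegrE //.
  by rewrite mulr_ge0 // Rintegral_ge0.
have pq : (p + q) ^+ 2 <= (1 + eta) * p ^+ 2 + (1 + eta^-1) * q ^+ 2.
  rewrite -subr_ge0.
  have -> : (1 + eta) * p ^+ 2 + (1 + eta^-1) * q ^+ 2 - (p + q) ^+ 2 =
      eta * (p - eta^-1 * q) ^+ 2 by field; rewrite gt_eqF.
  by rewrite mulr_ge0 ?sqr_ge0 ?ltW.
apply: (le_trans pq); apply: lerD; rewrite ler_wpM2l // addr_ge0 ?invr_ge0 ?ltW //.
Qed.

(** The pointwise bound is integrated over [D'] and the order of integration exchanged; by symmetry
    the kernel has mass at most one in the other variable too, so the energy over [D] grows only by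
    the factor [1 + eta]. *)
Lemma smooth_local u (D D' : set T) (tau eta : R) :
  measurable D -> measurable D' -> D' `<=` C ->
  m.-integrable setT (EFin \o u) -> m.-integrable setT (EFin \o (fun y => u y ^+ 2 * \1_D y)) ->
  0 < eta -> 0 <= tau ->
  (forall x y, D' x -> ~ D y -> u y != 0 -> K (x, y) <= tau) ->
  (\int[m]_x (smooth K u x ^+ 2 * \1_D' x)%:E <=
   (1 + eta)%:E * \int[m]_y (u y ^+ 2 * \1_D y)%:E +
   ((1 + eta^-1) * (tau * \int[m]_y `|u y|) ^+ 2)%:E * m C)%E.
Proof.
move=> mD mD' DC iu iu2 eta0 tau0 Kt.
have mu : measurable_fun setT u.
  by apply/measurable_EFinP; exact: (measurable_int m iu).
have mI : measurable_fun setT (\1_D : T -> R) by exact: measurable_indic.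
have mu2 : measurable_fun setT (fun y => u y ^+ 2 * \1_D y).
  by apply: measurable_funM => //; exact: measurable_funX.
have u20 y : 0 <= u y ^+ 2 * \1_D y by rewrite mulr_ge0 ?sqr_ge0.
have ms := measurable_smooth iu; have ms2 := measurable_smooth iu2.
set c := (1 + eta^-1) * _.
have c0 : 0 <= c by rewrite mulr_ge0 ?sqr_ge0 // addr_ge0 // invr_ge0 ltW.
have e0 : 0 <= 1 + eta by rewrite addr_ge0 // ltW.
have s0 x : 0 <= smooth K (fun y => u y ^+ 2 * \1_D y) x.
  by apply: Rintegral_ge0 => y _; rewrite mulr_ge0.
apply: (@le_trans _ _ (\int[m]_x (((1 + eta) *
   (smooth K (fun y => u y ^+ 2 * \1_D y) x * \1_C x))%:E + (c * \1_C x)%:E))%E).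
  apply: ge0_le_integral => //.
  - by move=> x _; rewrite lee_fin mulr_ge0 // sqr_ge0.
  - by apply/measurable_EFinP; apply: measurable_funM;
      [exact: measurable_funX|exact: measurable_indic].
  - apply: emeasurable_funD; apply/measurable_EFinP; last first.
      by apply: measurable_funM => //; exact: measurable_indic.
    apply: measurable_funM => //; apply: measurable_funM => //; exact: measurable_indic.
  - move=> x _; rewrite -EFinD lee_fin !indicE.
    have [xD|xD] := boolP (x \in D'); last first.
      by rewrite mulr0 addr_ge0 // mulr_ge0 // mulr_ge0.
    rewrite inE in xD; have xC : x \in C by rewrite inE; exact: DC.
    rewrite xC !mulr1; apply: smooth_sq_le => //; first exact: DC.
    by move=> y; exact: Kt.
rewrite ge0_integralD //; last 4 first.
- by move=> x _; rewrite lee_fin !mulr_ge0.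
- by apply/measurable_EFinP; apply: measurable_funM => //; apply: measurable_funM => //;
    exact: measurable_indic.
- by move=> x _; rewrite lee_fin mulr_ge0.
- by apply/measurable_EFinP; apply: measurable_funM => //; exact: measurable_indic.
apply: leeD; last first.
  under eq_integral do rewrite EFinM.
  rewrite ge0_integralZl_EFin //; last first.
    by apply/measurable_EFinP; exact: measurable_indic.
  by rewrite integral_indic // setIT.
under eq_integral do rewrite EFinM.
rewrite ge0_integralZl_EFin //; last 2 first.
- by move=> x _; rewrite lee_fin mulr_ge0.
- by apply/measurable_EFinP; apply: measurable_funM => //; exact: measurable_indic.
apply: lee_wpmul2l; first by rewrite lee_fin.
apply: (@le_trans _ _ (\int[m \x m]_z (u z.2 ^+ 2 * \1_D z.2 * K z)%:E)%E).
  rewrite fubini_tonelli1; last 2 first.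
  - by apply/measurable_EFinP; exact: (measurable_skernel_r sK mu2).
  - by move=> z; rewrite lee_fin mulr_ge0.
  apply: ge0_le_integral => //.
  - by move=> x _; rewrite lee_fin mulr_ge0.
  - by apply/measurable_EFinP; apply: measurable_funM => //; exact: measurable_indic.
  - apply: measurable_fun_fubini_tonelli_F.
      by apply/measurable_EFinP; exact: (measurable_skernel_r sK mu2).
    by move=> z; rewrite lee_fin mulr_ge0.
  - move=> x _; apply: (@le_trans _ _ (smooth K (fun y => u y ^+ 2 * \1_D y) x)%:E).
      by rewrite lee_fin ler_piMr // indic_le1.
    rewrite /smooth /Rintegral fineK //.
    by apply: integrable_fin_num => //; exact: kernel_mul_integrable.
rewrite (skernel_marginal_r sK mu2) //.
apply: ge0_le_integral => //.
- by move=> x _; rewrite lee_fin mulr_ge0.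
- by apply/measurable_EFinP; apply: measurable_funM => //; exact: measurable_indic.
- exact/measurable_EFinP.
- by move=> x _; rewrite lee_fin ler_piMr // indic_le1.
Qed.

End one_kernel.

(** Truncation makes the square Lipschitz: on [[0, M]] its slope is at most [2 * M], so an [L^1]
    error controls truncated squares although it does not control squares. *)
Lemma min_sq_le (a b M : R) : 0 <= M ->
  Num.min `|a| M ^+ 2 <= b ^+ 2 + 2 * M * `|a - b|.
Proof.
move=> M0; set t := Num.min `|a| M.
have t0 : 0 <= t by rewrite le_min normr_ge0.
have ta : t <= `|a| by rewrite ge_min lexx.
have tM : t <= M by rewrite ge_min lexx orbT.
have h : `|a| <= `|b| + `|a - b|.
  by rewrite -[X in `|X| <= _](subrK b) addrC ler_normD.
have n0 := normr_ge0 (a - b).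
have b2 : b ^+ 2 = `|b| ^+ 2 by rewrite real_normK ?num_real.
rewrite b2; move: (normr_ge0 b); move: `|b| `|a - b| h n0 => x y h n0 x0.
have : t * y <= M * y by rewrite ler_wpM2r.
have : t * t <= t * (x + y) by rewrite ler_wpM2l // (le_trans ta).
have := sqr_ge0 (t - x).
nra.
Qed.

(** The smoothings converge only in [L^1], so squares are truncated at height [M] and compared by
    [min_sq_le]; the kernel index goes to infinity first, then [M] by monotone convergence. [u] and
    [v] are treated together because the bound [B] is for the sum of their energies. *)
Lemma smooth_lsc (K : nat -> T * T -> R) (b : nat -> R) u v (B : R) :
  (forall N, skernel m C (K N)) -> (forall N z, K N z <= b N) ->
  m.-integrable setT (EFin \o u) -> m.-integrable setT (EFin \o v) ->
  vanishing m K u -> vanishing m K v ->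
  (forall e, 0 < e -> \forall N \near \oo,
    (\int[m]_x ((smooth (K N) u x ^+ 2 + smooth (K N) v x ^+ 2) * \1_C x)%:E <=
     (B + e)%:E)%E) ->
  (\int[m]_x ((u x ^+ 2 + v x ^+ 2) * \1_C x)%:E <= B%:E)%E.
Proof.
move=> sK bK iu iv [mu vu] [mv vv] HB.
pose f (M : nat) x := (Num.min `|u x| M%:R ^+ 2 + Num.min `|v x| M%:R ^+ 2) * \1_C x.
have mmin w (M : nat) : measurable_fun setT w ->
    measurable_fun setT (fun x => Num.min `|w x| (M%:R : R) ^+ 2).
  move=> mw; apply: measurable_funX; apply: measurable_minr => //.
  exact: measurableT_comp.
have mf M : measurable_fun setT (f M).
  apply: measurable_funM; last exact: measurable_indic.
  by apply: measurable_funD; exact: mmin.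
have f0 M x : 0 <= f M x by rewrite mulr_ge0 // addr_ge0 // sqr_ge0.
have fB M : (\int[m]_x (f M x)%:E <= B%:E)%E.
  apply/lee_addgt0Pr => e e0.
  have M0 : 0 <= (M%:R : R) by [].
  have e2 : 0 < e / 2 by rewrite divr_gt0.
  have t0 : 0 < e / (8 * (M%:R + 1)) by rewrite divr_gt0 // mulr_gt0 // ltr_wpDl.
  have : \forall N \near \oo, (\int[m]_x (f M x)%:E <= B%:E + e%:E)%E.
    apply: filterS3 (HB _ e2) (vu _ t0) (vv _ t0) => N hB hu hv.
    have msu := measurable_smooth (sK N) iu.
    have msv := measurable_smooth (sK N) iv.
    have mdiff w : measurable_fun setT w -> measurable_fun setT (smooth (K N) w) ->
        measurable_fun setT (fun x => `|w x - smooth (K N) w x| * \1_C x).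
      move=> mw msw; apply: measurable_funM; last exact: measurable_indic.
      by apply: measurableT_comp => //; exact: measurable_funB.
    have mS : measurable_fun setT (fun x =>
        (smooth (K N) u x ^+ 2 + smooth (K N) v x ^+ 2) * \1_C x).
      apply: measurable_funM; last exact: measurable_indic.
      by apply: measurable_funD; exact: measurable_funX.
    have mDD : measurable_fun setT (fun x => `|u x - smooth (K N) u x| * \1_C x +
        `|v x - smooth (K N) v x| * \1_C x).
      by apply: measurable_funD; exact: mdiff.
    apply: (@le_trans _ _ (\int[m]_x (((smooth (K N) u x ^+ 2 +
        smooth (K N) v x ^+ 2) * \1_C x)%:E + (2 * M%:R)%:E *
        (`|u x - smooth (K N) u x| * \1_C x + `|v x - smooth (K N) v x| * \1_C x)%:E))%E).
      apply: ge0_le_integral => //.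
      - by move=> x _; rewrite lee_fin.
      - exact/measurable_EFinP.
      - apply: emeasurable_funD; first exact/measurable_EFinP.
        by apply/measurable_EFinP; exact: measurable_funM.
      - move=> x _; rewrite -EFinM -EFinD lee_fin /f indicE; case: (x \in C).
          have := min_sq_le (u x) (smooth (K N) u x) M0.
          have := min_sq_le (v x) (smooth (K N) v x) M0.
          rewrite !mulr1; lra.
        by rewrite !mulr0 !addr0 mulr0.
    rewrite ge0_integralD //; last 3 first.
    - by move=> x _; rewrite lee_fin mulr_ge0 // addr_ge0 // sqr_ge0.
    - exact/measurable_EFinP.
    - by apply/measurable_EFinP; exact: measurable_funM.
    rewrite ge0_integralZl_EFin //; last exact/measurable_EFinP.
    under [X in (_ + _ * X)%E]eq_integral do rewrite EFinD.
    rewrite ge0_integralD //; last 2 first.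
    - by apply/measurable_EFinP; exact: mdiff.
    - by apply/measurable_EFinP; exact: mdiff.
    apply: (@le_trans _ _ ((B + e / 2)%:E + (2 * M%:R)%:E *
       ((e / (8 * (M%:R + 1)))%:E + (e / (8 * (M%:R + 1)))%:E))%E).
      apply: leeD => //; apply: lee_wpmul2l; first by rewrite lee_fin mulr_ge0.
      apply: leeD; apply: le_trans (L1_sub_smooth_le (sK N) (bK N) _) _ => //.
    rewrite -[X in (_ + _ * X)%E]EFinD -EFinM -!EFinD lee_fin -addrA lerD2l.
    have -> : 2 * M%:R * (e / (8 * (M%:R + 1)) + e / (8 * (M%:R + 1))) =
        e / 2 * (M%:R / (M%:R + 1)) :> R.
      by field; rewrite gt_eqF // ltr_wpDl.
    have : e / 2 * (M%:R / (M%:R + 1)) <= e / 2.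
      by rewrite ler_piMr ?ltW // ltr_pdivrMr ?ltr_wpDl // mul1r ltrDl.
    lra.
  by move=> [N _ h]; exact: h N (leqnn N).
have nd x : {homo (fun M => (f M x)%:E) : p q / (p <= q)%N >-> (p <= q)%E}.
  move=> p q pq; rewrite lee_fin ler_wpM2r // lerD // lerXn2r // ?nnegrE ?le_min ?normr_ge0 //=;
    by rewrite ge_min lexx /= ge_min ler_nat pq orbT.
have lim x : limn (fun M => (f M x)%:E) = ((u x ^+ 2 + v x ^+ 2) * \1_C x)%:E.
  apply/cvg_lim => //; apply: cvg_near_cst.
  pose M0 := (Num.truncn (`|u x| + `|v x|)).+1.
  exists M0 => // M /= M0M.
  have h : `|u x| + `|v x| <= M%:R.
    have /andP[_ h] := truncn_itv (addr_ge0 (normr_ge0 (u x)) (normr_ge0 (v x))).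
    by apply: (le_trans (ltW h)); rewrite ler_nat.
  have nu := normr_ge0 (u x); have nv := normr_ge0 (v x).
  rewrite /f (min_idPl (_ : `|u x| <= M%:R)); last by lra.
  rewrite (min_idPl (_ : `|v x| <= M%:R)); last by lra.
  by rewrite !real_normK ?num_real.
have -> : (\int[m]_x ((u x ^+ 2 + v x ^+ 2) * \1_C x)%:E =
    \int[m]_x limn (fun M => (f M x)%:E))%E.
  by apply: eq_integral => x _; rewrite lim.
have mono := @monotone_convergence _ _ _ m setT measurableT (fun M x => (f M x)%:E).
rewrite mono //; last 2 first.
- by move=> M; exact/measurable_EFinP.
- by move=> M x _; rewrite lee_fin.
apply: lime_le; last exact: nearW.
apply: ereal_nondecreasing_is_cvgn => p q pq; apply: ge0_le_integral => //.
- by move=> x _; rewrite lee_fin.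
- exact/measurable_EFinP.
- exact/measurable_EFinP.
- by move=> x _; exact: nd.
Qed.

End smoothing.

(** * Integrals of products over n-tuples *)

Section tuple_integrals.
Context {R : realType}.
Local Notation mu := (@lebesgue_measure R).
Implicit Types (n : nat) (nu : int).

(** Frequencies are functions on ['I_n], so that tails and differences of frequency vectors are
    written directly. *)
Definition phase n (nu : 'I_n -> int) (x : n.-tuple R) : R :=
  2 * pi * (\sum_(i < n) (nu i)%:~R * tnth x i).

Lemma integrable_mul_indic d (T : measurableType d) (m : {measure set T -> \bar R})
    (A : set T) (f : T -> R) : measurable A ->
  m.-integrable A (EFin \o f) -> m.-integrable setT (EFin \o (fun x => f x * \1_A x)).
Proof.
move=> mA /(integrable_mkcond _ mA); apply: eq_integrable => // x _.
by rewrite /= patchE indicE; case: ifP => _; rewrite ?mulr1 ?mulr0.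
Qed.

Lemma Rintegral_mul_indic d (T : measurableType d) (m : {measure set T -> \bar R})
    (A : set T) (f : T -> R) :
  \int[m]_(x in A) f x = \int[m]_x (f x * \1_A x).
Proof.
rewrite Rintegral_mkcond; apply: eq_Rintegral => x _.
by rewrite patchE indicE; case: ifP => _; rewrite ?mulr1 ?mulr0.
Qed.

Lemma measurable_tnth_comp n (i : 'I_n) (f : R -> R) : measurable_fun setT f ->
  measurable_fun setT (fun x : n.-tuple R => f (tnth x i)).
Proof. by move=> mf; apply: measurableT_comp => //; exact: measurable_tnth. Qed.

Lemma measurable_prod_tnth n (phi : 'I_n -> R -> R) :
  (forall i, measurable_fun setT (phi i)) ->
  measurable_fun setT (fun x : n.-tuple R => \prod_(i < n) phi i (tnth x i)).
Proof.
by move=> mphi; apply: measurable_prod => i _; exact: measurable_tnth_comp.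
Qed.

Lemma measurable_phase n (nu : 'I_n -> int) : measurable_fun setT (phase nu).
Proof.
apply: measurable_funM => //; apply: measurable_sum => i.
by apply: measurable_funM => //; exact: measurable_tnth.
Qed.

Lemma tuple_integral_step n (F : n.+1.-tuple R -> \bar R) :
  measurable_fun setT F -> (forall x, 0 <= F x)%E ->
  (\int[tuple_lebesgue n.+1]_x F x =
   \int[mu]_a \int[tuple_lebesgue n]_t F (tuple_cons (a, t)))%E.
Proof.
move=> mF F0; rewrite /= /tuple_lebesgue_step.
have E := @ge0_integral_pushforward _ _ (measurableTypeR R * n.-tuple R)%type _ R
  _ (@measurable_tuple_cons R n) (mu \x tuple_lebesgue n)%E setT F measurableT mF (fun y _ => F0 y).
apply: etrans E _.
rewrite preimage_setT fubini_tonelli1 //.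
- by apply: measurableT_comp => //; exact: measurable_tuple_cons.
- by move=> z /=.
Qed.

Lemma prod_tuple_cons n (phi : 'I_n.+1 -> R -> R) a t :
  \prod_(i < n.+1) phi i (tnth (tuple_cons (a, t)) i) =
  phi ord0 a * \prod_(i < n) phi (lift ord0 i) (tnth t i).
Proof.
rewrite big_ord_recl; congr (_ * _).
by apply: eq_bigr => i _; rewrite /tuple_cons /= tnthS.
Qed.

Lemma integral_prod n (phi : 'I_n -> R -> R) (a : 'I_n -> R) :
  (forall i, measurable_fun setT (phi i)) -> (forall i x, 0 <= phi i x) ->
  (forall i, \int[mu]_x (phi i x)%:E = (a i)%:E)%E ->
  (\int[tuple_lebesgue n]_x (\prod_(i < n) phi i (tnth x i))%:E =
   (\prod_(i < n) a i)%:E)%E.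
Proof.
elim: n phi a => [|n ih] phi a mphi phi0 phia.
  under eq_integral do rewrite big_ord0.
  by rewrite big_ord0 /= integral_cst // mul1e /= diracT.
rewrite tuple_integral_step; last 2 first.
- by apply/measurable_EFinP; exact: measurable_prod_tnth.
- by move=> x; rewrite lee_fin prodr_ge0.
transitivity (\int[mu]_x ((phi ord0 x)%:E * (\prod_(i < n) a (lift ord0 i))%:E))%E.
  apply: eq_integral => x _; under eq_integral do rewrite prod_tuple_cons EFinM.
  rewrite ge0_integralZl_EFin //.
  - by rewrite (ih (fun i => phi (lift ord0 i)) (fun i => a (lift ord0 i))).
  - by move=> t _; rewrite lee_fin prodr_ge0.
  - by apply/measurable_EFinP; exact: (measurable_prod_tnth (fun i => mphi (lift ord0 i))).
have a0 i : 0 <= a i.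
  by rewrite -lee_fin -phia; apply: integral_ge0 => x _; rewrite lee_fin.
rewrite ge0_integralZr //.
- by rewrite phia big_ord_recl EFinM.
- by have /measurable_EFinP := mphi ord0.
- by move=> x _; rewrite lee_fin.
- by rewrite lee_fin prodr_ge0.
Qed.

Lemma integrable_prod_bounded n (phi : 'I_n -> R -> R) (h : n.-tuple R -> R) :
  (forall i, mu.-integrable setT (EFin \o phi i)) ->
  measurable_fun setT h -> (forall x, `|h x| <= 1) ->
  (tuple_lebesgue n).-integrable setT
    (EFin \o (fun x => \prod_(i < n) phi i (tnth x i) * h x)).
Proof.
move=> iphi mh h1.
have mphi i : measurable_fun setT (phi i).
  by apply/measurable_EFinP; exact: (measurable_int mu (iphi i)).
have mprod := measurable_prod_tnth mphi.
apply/integrableP; split.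
  by apply/measurable_EFinP; exact: measurable_funM.
have na i : (\int[mu]_x `|phi i x|%:E = (\int[mu]_x `|phi i x|)%:E)%E.
  rewrite /Rintegral fineK //; apply: integrable_fin_num => //.
  exact: integrable_norm (iphi i).
have nm i : measurable_fun setT (fun x => `|phi i x|) by exact: measurableT_comp.
have n0 i x : 0 <= `|phi i x| by [].
have := integral_prod nm n0 na.
move=> E; apply: (@le_lt_trans _ _ (\int[tuple_lebesgue n]_x
  (\prod_(i < n) `|phi i (tnth x i)|)%:E)%E); last by rewrite E ltry.
apply: ge0_le_integral => //.
- by apply/measurable_EFinP; apply: measurableT_comp => //; exact: measurable_funM.
- by apply/measurable_EFinP; exact: (measurable_prod_tnth nm).
- by move=> x _; rewrite /= lee_fin normrM -normr_prod ler_piMr.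
Qed.

(** The constant [c] carries the induction: the first coordinate is absorbed into the constant phase
    of the remaining ones, and after the inner integral the addition formula splits it off again,
    its sine part integrating to zero. *)
Lemma Rintegral_prod_cos n (phi : 'I_n -> R -> R) (nu : 'I_n -> int) (a : 'I_n -> R) (c : R) :
  (forall i, mu.-integrable setT (EFin \o phi i)) ->
  (forall i, \int[mu]_x (phi i x * cosi (nu i) x) = a i) ->
  (forall i, \int[mu]_x (phi i x * sini (nu i) x) = 0) ->
  \int[tuple_lebesgue n]_x (\prod_(i < n) phi i (tnth x i) * cos (c + phase nu x)) =
  cos c * \prod_(i < n) a i.
Proof.
elim: n phi nu a c => [|n ih] phi nu a c iphi phia phi0.
  rewrite (@eq_Rintegral _ _ _ _ _ (fun=> cos c)).
    by rewrite big_ord0 mulr1 /Rintegral /= integral_cst // [X in (_ * X)%E]diracT mule1.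
  by move=> x _; rewrite /phase !big_ord0 mulr0 addr0 mul1r.
have mcos (k : nat) (v : 'I_k -> int) (b : R) :
    measurable_fun setT (fun x : k.-tuple R => cos (b + phase v x)).
  apply: measurableT_comp; first exact: continuous_measurable_fun (@continuous_cos R).
  by apply: measurable_funD => //; exact: measurable_phase.
have cos1 (b : R) : `|cos b| <= 1 by rewrite ler_norml cos_geN1 cos_le1.
pose F (x : n.+1.-tuple R) := \prod_(i < n.+1) phi i (tnth x i) * cos (c + phase nu x).
have iF : (tuple_lebesgue n.+1).-integrable setT (EFin \o F).
  exact: integrable_prod_bounded.
have mF : measurable_fun setT (EFin \o F) by exact: (measurable_int _ iF).
have FE x t : F (tuple_cons (x, t)) = phi ord0 x *
    (\prod_(i < n) phi (lift ord0 i) (tnth t i) *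
     cos ((c + 2 * pi * ((nu ord0)%:~R * x)) + phase (fun i => nu (lift ord0 i)) t)).
  rewrite /F prod_tuple_cons -mulrA; congr (_ * (_ * cos _)).
  rewrite /phase big_ord_recl -addrA; congr (_ + _).
  rewrite [tnth _ _]/= (mulrDr (2 * pi)); congr (_ + _ * _).
  by apply: eq_bigr => i _; rewrite /tuple_cons tnthS.
have iF' : (mu \x tuple_lebesgue n)%E.-integrable setT (EFin \o F \o @tuple_cons R n).
  apply/integrableP; split.
    by apply: measurableT_comp => //; exact: measurable_tuple_cons.
  move/integrableP : iF => [_].
  rewrite [X in (X < _)%E -> _]
    (@ge0_integral_pushforward _ _ (measurableTypeR R * n.-tuple R)%type _ R
     _ (@measurable_tuple_cons R n) (mu \x tuple_lebesgue n)%E) //.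
  exact: measurableT_comp.
rewrite -/F {1}/Rintegral.
rewrite [X in fine X](@integral_pushforward _ _ (measurableTypeR R * n.-tuple R)%type _ R
  _ (@measurable_tuple_cons R n) (mu \x tuple_lebesgue n)%E) //.
rewrite preimage_setT -(integral12_prod_meas1 iF').
set P := \prod_(i < n) a (lift ord0 i).
have inner x : (\int[tuple_lebesgue n]_t (EFin \o F \o @tuple_cons R n) (x, t) =
    (P * (phi ord0 x * (cos c * cosi (nu ord0) x - sin c * sini (nu ord0) x)))%:E)%E.
  under eq_integral do rewrite /comp FE.
  pose G (t : n.-tuple R) := \prod_(i < n) phi (lift ord0 i) (tnth t i) *
     cos ((c + 2 * pi * ((nu ord0)%:~R * x)) + phase (fun i => nu (lift ord0 i)) t).
  have iG : (tuple_lebesgue n).-integrable setT (EFin \o G).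
    exact: (integrable_prod_bounded (fun i => iphi (lift ord0 i))).
  have iG' := integrableZl measurableT (phi ord0 x) iG.
  rewrite -[LHS]fineK; last exact: (integrable_fin_num _ iG').
  rewrite -/(Rintegral _ _ _) RintegralZl // (ih (fun i => phi (lift ord0 i)) _ (fun i => a (lift ord0 i))) ?cosD //.
  by congr EFin; rewrite mulrA mulrC.
rewrite /fubini_F; under eq_integral do rewrite inner.
rewrite -/(Rintegral mu setT _).
have ic : mu.-integrable setT (EFin \o (fun x => phi ord0 x * cosi (nu ord0) x)).
  apply: (le_integrable _ _ _ (iphi ord0)) => //.
    apply/measurable_EFinP; apply: measurable_funM.
      by apply/measurable_EFinP; exact: (measurable_int mu (iphi ord0)).
    exact: (continuous_measurable_fun (@continuous_cosi R _)).
  by move=> x _; rewrite /= lee_fin normrM ler_piMr // cos1.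
have isn : mu.-integrable setT (EFin \o (fun x => phi ord0 x * sini (nu ord0) x)).
  apply: (le_integrable _ _ _ (iphi ord0)) => //.
    apply/measurable_EFinP; apply: measurable_funM.
      by apply/measurable_EFinP; exact: (measurable_int mu (iphi ord0)).
    exact: (continuous_measurable_fun (@continuous_sini R _)).
  by move=> x _; rewrite /= lee_fin normrM ler_piMr // ler_norml sin_geN1 sin_le1.
have ic' := integrableZl measurableT (cos c) ic.
have isn' := integrableZl measurableT (sin c) isn.
transitivity (\int[mu]_x (P * (cos c * (phi ord0 x * cosi (nu ord0) x) -
    sin c * (phi ord0 x * sini (nu ord0) x)))).
  by apply: eq_Rintegral => x _; ring.
have iB := integrableB measurableT ic' isn'.
rewrite RintegralZl // RintegralB // !RintegralZl // phia phi0 big_ord_recl.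
by rewrite mulr0 subr0 -/P; ring.
Qed.

End tuple_integrals.

(** * Product kernels on the torus *)

Section torus_kernels.
Context {R : realType}.
Local Notation mu := (@lebesgue_measure R).
Implicit Types (n : nat).
Local Notation cell := [set` `[(- 2^-1 : R), 2^-1[].

(** The product sigma-algebra is generated by the preimages of rays under the coordinates, and the
    good sets form a sigma-algebra. *)
Lemma vanishing_tuple n (m : {sigma_finite_measure set (n.-tuple R) -> \bar R})
    (C : set (n.-tuple R)) (K : nat -> n.-tuple R * n.-tuple R -> R) :
  measurable C -> (m C < +oo)%E -> (forall N, skernel m C (K N)) ->
  (forall i a, vanishing m K \1_[set x | a <= tnth x i]) ->
  forall A, measurable A -> vanishing m K \1_A.
Proof.
move=> mC finC sK rays A mA.
pose G := [set A | measurable A /\ vanishing m K \1_A].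
have sG : sigma_algebra setT G by exact: vanishing_sigma_algebra sK.
suff : measurable `<=` G by move=> /(_ _ mA)[].
apply: smallest_sub => //.
elim/big_ind: _ => [//|P Q HP HQ|i _ B [Y mY <-]]; first by rewrite subUset.
suff : measurable `<=` image_set_system setT (fun x : n.-tuple R => tnth x i) G by apply.
rewrite [X in X `<=` _](RGenCInfty.measurableE R).
apply: smallest_sub; first exact: sigma_algebra_image.
move=> _ [a ->]; rewrite /image_set_system /= setTI.
have E : (fun x : n.-tuple R => tnth x i) @^-1` `[a, +oo[ = [set x | a <= tnth x i].
  by apply/seteqP; split => x /=; rewrite in_itv /= andbT.
rewrite E; split; last exact: rays.
rewrite -E -[X in measurable X]setTI; apply: measurable_tnth => //.
Qed.

Definition box n (J : 'I_n -> set R) : set (n.-tuple R) :=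
  [set x | forall i, J i (tnth x i)].

Lemma measurable_box n (J : 'I_n -> set R) : (forall i, measurable (J i)) ->
  measurable (box J).
Proof.
move=> mJ; rewrite (_ : box J = \bigcap_(i in [set: 'I_n]) ((fun x => tnth x i) @^-1` J i)).
  apply: fin_bigcap_measurable => // i _.
  by rewrite -[X in measurable X]setTI; exact: measurable_tnth.
by apply/seteqP; split => x h => [i _|i]; exact: h.
Qed.

Lemma indic_box n (J : 'I_n -> set R) x :
  \1_(box J) x = \prod_(i < n) \1_(J i) (tnth x i) :> R.
Proof.
rewrite indicE; have [|xB] := boolP (x \in box J).
  by rewrite inE => xB; rewrite big1 // => i _; rewrite indicE mem_set.
have [i nJ] : exists i, ~ J i (tnth x i).
  by apply/existsNP => h; move/negP : xB; apply; rewrite inE.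
by rewrite (bigD1 i) //= indicE memNset // mul0r.
Qed.

Lemma measure_box n (J : 'I_n -> set R) (a : 'I_n -> R) :
  (forall i, measurable (J i)) -> (forall i, mu (J i) = (a i)%:E) ->
  (tuple_lebesgue n (box J) = (\prod_(i < n) a i)%:E)%E.
Proof.
move=> mJ Ja; rewrite -[box J]setIT -integral_indic //; last exact: measurable_box.
under eq_integral do rewrite indic_box.
apply: (@integral_prod _ _ (fun i => \1_(J i))) => // i.
by rewrite integral_indic; [rewrite setIT; exact: Ja|by []|exact: (mJ i)].
Qed.

Lemma torus_cellE n : torus_cell n = box (fun=> cell).
Proof. by []. Qed.

Lemma indic_torus_cell n (x : n.-tuple R) :
  \1_(torus_cell n) x = \prod_(i < n) \1_cell (tnth x i) :> R.
Proof. exact: (indic_box (fun=> cell)). Qed.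

Lemma measurable_torus_cell n : measurable (torus_cell n : set (n.-tuple R)).
Proof. by rewrite torus_cellE; apply: (@measurable_box n (fun=> cell)) => i; exact: measurable_itv. Qed.

Lemma torus_cell_measure n : tuple_lebesgue n (torus_cell n : set (n.-tuple R)) = 1%E.
Proof.
rewrite torus_cellE (measure_box (a := fun=> 1)) //; last by move=> _; exact: cell_measure.
by rewrite big1_eq.
Qed.

Lemma indic_cell_integrable (f : R -> R) : continuous f ->
  mu.-integrable setT (EFin \o (fun x => f x * \1_cell x)).
Proof.
by move=> cf; apply: (integrable_mul_indic _ (cell_integrable cf)); exact: measurable_itv.
Qed.

Lemma int1E (f : R -> R) : int1 f = \int[mu]_x (f x * \1_cell x).
Proof. exact: Rintegral_mul_indic. Qed.

(** Convolution kernel of the torus, cut off to pairs in the cell. As [cospoly s] is periodic and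
    the cell represents every point once, for a point of the cell the mass in the other variable is
    the [n]-th power of the mean of [cospoly s]. *)
Definition torus_kernel n (s : seq (R * int)) (z : n.-tuple R * n.-tuple R) : R :=
  \prod_(i < n) cospoly s (tnth z.1 i - tnth z.2 i) *
  (\1_(torus_cell n) z.1 * \1_(torus_cell n) z.2).

Section one_kernel.
Variables (n : nat) (s : seq (R * int)) (M : R).
Hypothesis s1 : ctp s = 1.
Hypothesis sM : forall x, 0 <= cospoly s x <= M.

Lemma torus_kernel_skernel : skernel (tuple_lebesgue n) (torus_cell n) (@torus_kernel n s).
Proof.
have s0 x : 0 <= cospoly s x by case/andP: (sM x).
have mc : measurable_fun setT (\1_(torus_cell n) : n.-tuple R -> R).
  by apply: measurable_indic; exact: measurable_torus_cell.
split.
- apply: measurable_funM; last first.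
    by apply: measurable_funM; [exact: (measurableT_comp mc measurable_fst)|
      exact: (measurableT_comp mc measurable_snd)].
  apply: measurable_prod => i _; apply: measurableT_comp.
    exact: (continuous_measurable_fun (@continuous_cospoly R _)).
  by apply: measurable_funB; [exact: (measurableT_comp (measurable_tnth i) measurable_fst)|
    exact: (measurableT_comp (measurable_tnth i) measurable_snd)].
- by move=> z; rewrite mulr_ge0 ?mulr_ge0 // prodr_ge0.
- move=> x y; rewrite /torus_kernel /= [X in _ * X]mulrC; congr (_ * _).
  by apply: eq_bigr => i _; rewrite -cospolyN opprB.
- move=> x; pose phi i y := cospoly s (tnth x i - y) * \1_cell y.
  transitivity (\int[tuple_lebesgue n]_y ((\1_(torus_cell n) x)%:E *
      (\prod_(i < n) phi i (tnth y i))%:E))%E.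
    apply: eq_integral => y _; rewrite -EFinM /torus_kernel /=; congr EFin.
    by rewrite (indic_torus_cell y) mulrCA -big_split.
  have cphi i : continuous (fun y => cospoly s (tnth x i - y)).
    by move=> y; apply: continuous_reflection; exact: continuous_cospoly.
  have mphi i : measurable_fun setT (phi i).
    apply: measurable_funM; last exact: measurable_indic.
    exact: (continuous_measurable_fun (cphi i)).
  have phi0 i y : 0 <= phi i y by rewrite mulr_ge0.
  rewrite ge0_integralZl_EFin //; last 2 first.
  - by move=> y _; rewrite lee_fin prodr_ge0.
  - by apply/measurable_EFinP; exact: (measurable_prod_tnth mphi).
  rewrite (@integral_prod _ _ phi (fun=> 1)) // => [|i]; first by rewrite big1_eq mule1.
  rewrite -s1 -(@int1_kernel R s (tnth x i)) int1E /Rintegral fineK //.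
  exact: (integrable_fin_num _ (indic_cell_integrable (cphi i))).
Qed.

Lemma torus_kernel_le (z : n.-tuple R * n.-tuple R) : torus_kernel s z <= M ^+ n.
Proof.
have s0 x : 0 <= cospoly s x by case/andP: (sM x).
have P0 : 0 <= \prod_(i < n) cospoly s (tnth z.1 i - tnth z.2 i) by rewrite prodr_ge0.
apply: (@le_trans _ _ (\prod_(i < n) cospoly s (tnth z.1 i - tnth z.2 i))).
  by rewrite ler_piMr // mulr_ile1 // indic_le1.
rewrite -[X in _ <= _ ^+ X]card_ord -prodr_const.
by apply: ler_prod => i _; exact: sM.
Qed.

Lemma torus_kernel_tail (h e : R) (z : n.-tuple R * n.-tuple R) i :
  (forall x, h <= dZ x -> cospoly s x * M ^+ n <= e) ->
  h <= dZ (tnth z.1 i - tnth z.2 i) -> torus_kernel s z <= e.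
Proof.
move=> tail hi; have s0 x : 0 <= cospoly s x by case/andP: (sM x).
(* Apart from the far coordinate there are only [n - 1] factors, each at most [M]; [M >= 1], forced
   by the mean, supplies the spare factor in [M ^+ n]. *)
have M1 : 1 <= M.
  rewrite -s1 -int1_cospoly -[leRHS]int1_cst; apply: le_int1.
  - exact: continuous_cospoly.
  - exact: continuous_cstf.
  - by move=> x; case/andP: (sM x).
apply: le_trans (tail _ hi).
have P0 : 0 <= \prod_(i < n) cospoly s (tnth z.1 i - tnth z.2 i) by rewrite prodr_ge0.
apply: (@le_trans _ _ (\prod_(i < n) cospoly s (tnth z.1 i - tnth z.2 i))).
  by rewrite ler_piMr // mulr_ile1 // indic_le1.
rewrite (bigD1 i) //= ler_wpM2l //.
apply: (@le_trans _ _ (\prod_(j < n) M)); last by rewrite prodr_const card_ord.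
rewrite [leRHS](bigD1 i) //= -[leLHS]mul1r ler_pM ?prodr_ge0 //.
by apply: ler_prod => j _; exact: sM.
Qed.

End one_kernel.
End torus_kernels.

(** * Convergence of the smoothings on the torus *)

Section torus_approximation.
Context {R : realType}.
Local Notation mu := (@lebesgue_measure R).
Local Notation cell := [set` `[(- 2^-1 : R), 2^-1[].

Definition strip n (i : 'I_n) (b h : R) : set (n.-tuple R) :=
  [set x | `|tnth x i - b| <= h].

Lemma measurable_strip n (i : 'I_n) b h : measurable (strip i b h).
Proof.
rewrite (_ : strip i b h = (fun x => tnth x i) @^-1` `[b - h, b + h]).
  by rewrite -[X in measurable X]setTI; exact: measurable_tnth.
by apply/seteqP; split => x; rewrite /strip /= in_itv /= ler_distl.
Qed.

Lemma strip_measure_le n (i : 'I_n) (b h : R) : 0 <= h ->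
  (\int[tuple_lebesgue n]_x (\1_(strip i b h) x * \1_(torus_cell n) x)%:E <= (2 * h)%:E)%E.
Proof.
move=> h0; pose I := [set` `[b - h, b + h]] : set R.
pose phi j x : R := if j == i then \1_I x * \1_cell x else \1_cell x.
pose c := \int[mu]_x (\1_I x * \1_cell x).
have mI : measurable_fun setT (\1_I : R -> R) by apply: measurable_indic; exact: measurable_itv.
have mc : measurable_fun setT (\1_cell : R -> R) by apply: measurable_indic; exact: measurable_itv.
have iI : mu.-integrable setT (EFin \o (fun x => \1_I x * \1_cell x)).
  have h1 := @indic_cell_integrable R (fun=> 1) (@continuous_cstf R 1).
  apply: (le_integrable _ _ _ h1) => //.
    by apply/measurable_EFinP; exact: measurable_funM.
  move=> x _; rewrite /= lee_fin !normrM ler_wpM2r // normr1 ger0_norm // indic_le1.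
have c2 : c <= 2 * h.
  rewrite -lee_fin /c /Rintegral fineK; last exact: (integrable_fin_num _ iI).
  apply: (@le_trans _ _ (\int[mu]_x (\1_I x)%:E)%E).
    apply: ge0_le_integral => //.
    - by apply/measurable_EFinP; exact: measurable_funM.
    - exact/measurable_EFinP.
    - by move=> x _; rewrite lee_fin ler_piMr // indic_le1.
  rewrite integral_indic //; [|exact: measurable_itv].
  rewrite setIT [X in (X <= _)%E]lebesgue_measure_itv /= lte_fin.
  case: ifP => _; last by rewrite lee_fin mulr_ge0.
  by rewrite -EFinB lee_fin; lra.
rewrite (_ : (fun x => (\1_(strip i b h) x * \1_(torus_cell n) x)%:E) =
  (fun x => (\prod_(j < n) phi j (tnth x j))%:E)); last first.
  apply/funext => x; rewrite indic_torus_cell (bigD1 i) //= [in RHS](bigD1 i) //=.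
  rewrite {1}/phi eqxx mulrA; congr (EFin (_ * _ * _)).
    by rewrite !indicE; congr (nat_of_bool _)%:R; apply/idP/idP;
      rewrite !inE /strip /I /= in_itv /= ler_distl.
  by apply: eq_bigr => j ji; rewrite /phi (negbTE ji).
rewrite (@integral_prod _ _ phi (fun j => if j == i then c else 1)).
- rewrite lee_fin (bigD1 i) //= eqxx big1 ?mulr1 // => j ji; first by rewrite (negbTE ji).
- by move=> j; rewrite /phi; case: eqP => _ //; exact: measurable_funM.
- by move=> j x; rewrite /phi; case: eqP => _ //; rewrite mulr_ge0.
- move=> j; rewrite /phi; case: eqP => _.
    by rewrite /c /Rintegral fineK //; exact: (integrable_fin_num _ iI).
  rewrite integral_indic //.
  by rewrite setIT; exact: cell_measure.
Qed.

Variables (n : nat) (s : nat -> seq (R * int)) (M : nat -> R).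
Hypothesis s1 : forall N, ctp (s N) = 1.
Hypothesis sM : forall N x, 0 <= cospoly (s N) x <= M N.
Hypothesis tail : forall N x, N.+1%:R^-1 <= dZ x -> cospoly (s N) x * M N ^+ n <= N.+1%:R^-1.
Let K N := @torus_kernel R n (s N).

Let sK N : skernel (tuple_lebesgue n) (torus_cell n) (K N).
Proof. exact: torus_kernel_skernel (s1 N) (sM N). Qed.

(* A nearby pair modulo Z^n is separated by [x_i = a] only if [x_i] is close to [a],
   or close to the boundary of the cell. *)
Lemma straddle (x y a h : R) : - 2^-1 <= x < 2^-1 -> - 2^-1 <= y < 2^-1 ->
  (x < a <= y) || (y < a <= x) -> dZ (x - y) < h ->
  [\/ `|x - a| <= h, `|x - - 2^-1| <= h | `|x - 2^-1| <= h].
Proof.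
move=> /andP[x1 x2] /andP[y1 y2] xy; rewrite /dZ.
have [k1 | k1] := leP 1%Z (rnd (x - y)).
  have : 1 <= (rnd (x - y))%:~R :> R by rewrite (ler_int R 1).
  by rewrite ltr_norml => k2 /andP[h1 h2]; apply: Or33; rewrite ler_norml; lra.
have [k2 | k2] := leP (rnd (x - y)) (- 1)%Z.
  have : (rnd (x - y))%:~R <= - 1 :> R by rewrite (ler_int R _ (- 1)).
  by rewrite ltr_norml => k3 /andP[h1 h2]; apply: Or32; rewrite ler_norml; lra.
have -> : rnd (x - y) = 0 by lia.
rewrite subr0 ltr_norml => /andP[h1 h2]; apply: Or31; rewrite ler_norml.
by case/orP : xy => /andP[]; lra.
Qed.

(** A pair of points of the cell separated by the half-space is either far apart on the circle in
    coordinate [i], where the kernel is at most [h], or close, and then [straddle] puts its first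
    point into one of three strips of measure at most [2 * h]. The oscillation is at most
    [7 * h]. *)
Lemma vanishing_ray (i : 'I_n) (a : R) :
  vanishing (tuple_lebesgue n) K \1_[set x | a <= tnth x i].
Proof.
set A := [set x | _].
have mA : measurable A.
  rewrite (_ : A = (fun x => tnth x i) @^-1` `[a, +oo[).
    by rewrite -[X in measurable X]setTI; exact: measurable_tnth.
  by apply/seteqP; split => x; rewrite /A /= in_itv /= andbT.
have mw : measurable_fun setT (\1_A : n.-tuple R -> R) by exact: measurable_indic.
split => // e e0.
have e7 : 0 < e / 7 by rewrite divr_gt0.
apply: filterS (near_infty_natSinv_lt (PosNum e7)) => N /= hN.
set h := N.+1%:R^-1 in hN; have h0 : 0 <= h by rewrite invr_ge0.
(* The kernel of the constant polynomial [1] is the indicator of pairs in the cell; it carries the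
   contribution [h] of the far pairs. *)
pose K0 := @torus_kernel R n [:: (1, 0%Z)].
have c1 x : cospoly [:: (1, 0%Z)] x = 1 :> R by rewrite /cospoly big_seq1 /= cosi0 mulr1.
have sK0 : skernel (tuple_lebesgue n) (torus_cell n) K0.
  apply: (@torus_kernel_skernel _ _ _ 1); last by move=> x; rewrite c1 ler01 lexx.
  by rewrite /ctp big_cons /= big_nil addr0.
have [mK K00 _ _] := sK N; have [mK0 K000 _ _] := sK0.
pose S b := \1_(strip i b h) : n.-tuple R -> R.
have mS b : measurable_fun setT (S b) by apply: measurable_indic; exact: measurable_strip.
pose F x := S a x + S (- 2^-1) x + S 2^-1 x.
have mF : measurable_fun setT F.
  by apply: measurable_funD => //; apply: measurable_funD.
have F0 x : 0 <= F x by rewrite !addr_ge0.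
have mh : measurable_fun setT ((fun=> h) : n.-tuple R -> R) by exact: measurable_cst.
apply: (@le_trans _ _ (\int[tuple_lebesgue n \x tuple_lebesgue n]_z
    ((F z.1 * K N z)%:E + (h * K0 z)%:E))%E).
  apply: ge0_le_integral => //.
  - by move=> z _; rewrite lee_fin mulr_ge0.
  - by apply/measurable_EFinP; exact: (measurable_osc_integrand (sK N)).
  - apply: emeasurable_funD; apply/measurable_EFinP.
      exact: (measurable_skernel_l (sK N)).
    exact: (measurable_skernel_l sK0 mh).
  - move=> [x y] _; rewrite -EFinD lee_fin /=.
    have [E|NE] := eqVneq (\1_A x) (\1_A y : R).
      by rewrite E subrr normr0 mul0r addr_ge0 // mulr_ge0.
    have d1 : `|\1_A x - \1_A y| <= 1 :> R.
      by rewrite !indicE; case: (x \in A); case: (y \in A);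
        rewrite /= ?subrr ?subr0 ?sub0r ?normrN ?normr1 ?normr0.
    have [xyC|xyC] := boolP ((x \in torus_cell n) && (y \in torus_cell n)); last first.
      have -> : K N (x, y) = 0.
        rewrite /K /torus_kernel /= !indicE; move: xyC; rewrite negb_and.
        by case: (x \in _); case: (y \in _); rewrite ?mulr0 ?mul0r ?mulr0.
      by rewrite !mulr0 add0r mulr_ge0.
    case/andP : xyC => xC yC.
    have K01 : K0 (x, y) = 1.
      rewrite /K0 /torus_kernel /= !indicE xC yC !mulr1 big1 // => j _; exact: c1.
    rewrite K01 mulr1; have [hd|hd] := leP h (dZ (tnth x i - tnth y i)).
      have tK : K N (x, y) <= h.
        exact: (@torus_kernel_tail R n (s N) (M N) (s1 N) (sM N) h h (x, y) i (@tail N) hd).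
      apply: (@le_trans _ _ h); last by rewrite lerDr mulr_ge0.
      by apply: le_trans tK; rewrite ler_piMl.
    suff F1 : 1 <= F x.
      apply: (@le_trans _ _ (K N (x, y))); first by rewrite ler_piMl.
      by apply: (@le_trans _ _ (F x * K N (x, y))); [rewrite ler_peMl|rewrite lerDl].
    have sep : (tnth x i < a <= tnth y i) || (tnth y i < a <= tnth x i).
      move: NE; rewrite !indicE.
      have -> : (x \in A) = (a <= tnth x i) by apply/idP/idP; rewrite inE.
      have -> : (y \in A) = (a <= tnth y i) by apply/idP/idP; rewrite inE.
      by rewrite !ltNge; case: (a <= tnth x i); case: (a <= tnth y i); rewrite //= eqxx.
    have xi : - 2^-1 <= tnth x i < 2^-1 by move: xC; rewrite inE => /(_ i); rewrite in_itv.
    have yi : - 2^-1 <= tnth y i < 2^-1 by move: yC; rewrite inE => /(_ i); rewrite in_itv.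
    have S1 b : `|tnth x i - b| <= h -> S b x = 1.
      by move=> hb; rewrite /S indicE mem_set.
    have S0 b : 0 <= S b x by [].
    have := S0 a; have := S0 (- 2^-1); have := S0 2^-1; rewrite /F.
    by case: (straddle xi yi sep hd) => /S1 ->; move: (S _ x) (S _ x) => p q; lra.
rewrite ge0_integralD //; last 4 first.
- by move=> z _; rewrite lee_fin mulr_ge0.
- by apply/measurable_EFinP; exact: (measurable_skernel_l (sK N)).
- by move=> z _; rewrite lee_fin mulr_ge0.
- by apply/measurable_EFinP; exact: (measurable_skernel_l sK0 mh).
rewrite (skernel_marginal_l (sK N)) // (skernel_marginal_l sK0 mh) //.
have mC := @measurable_torus_cell R n.
have mc : measurable_fun setT (\1_(torus_cell n) : n.-tuple R -> R) by exact: measurable_indic.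
apply: (@le_trans _ _ ((2 * h)%:E + (2 * h)%:E + (2 * h)%:E + h%:E)%E); last first.
  by rewrite -!EFinD lee_fin; move: hN; lra.
apply: leeD; last first.
  under eq_integral do rewrite EFinM.
  rewrite ge0_integralZl_EFin //; last exact/measurable_EFinP.
  by rewrite integral_indic // setIT [X in (_ * X <= _)%E]torus_cell_measure mule1.
rewrite /F; under eq_integral do rewrite !mulrDl !EFinD.
have mSC b : measurable_fun setT (fun x => (S b x * \1_(torus_cell n) x)%:E).
  by apply/measurable_EFinP; exact: measurable_funM.
have S0 b x : (0 <= (S b x * \1_(torus_cell n) x)%:E)%E by rewrite lee_fin mulr_ge0.
rewrite ge0_integralD //; last 2 first.
- by move=> x _; rewrite adde_ge0.
- exact: (emeasurable_funD (mSC a) (mSC (- 2^-1))).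
rewrite ge0_integralD //.
by apply: leeD; [apply: leeD|]; exact: strip_measure_le.
Qed.

Lemma vanishing_torus (u : n.-tuple R -> R) :
  (tuple_lebesgue n).-integrable setT (EFin \o u) -> vanishing (tuple_lebesgue n) K u.
Proof.
have mC := @measurable_torus_cell R n.
have finC : (tuple_lebesgue n (torus_cell n : set (n.-tuple R)) < +oo)%E.
  by rewrite torus_cell_measure ltry.
have vA := vanishing_tuple mC finC sK vanishing_ray.
by move=> iu; exact: (vanishing_integrable mC sK vA iu).
Qed.

End torus_approximation.

(** * Exponential sums with nonnegative coefficients *)

Section trigonometric_polynomials.
Context {R : realType}.
Local Notation mu := (@lebesgue_measure R).
Local Notation cell := [set` `[(- 2^-1 : R), 2^-1[].

Lemma integrable_sumr d (T : measurableType d) (m : {measure set T -> \bar R})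
    (I : Type) (r : seq I) (F : I -> T -> R) :
  (forall i, m.-integrable setT (EFin \o F i)) ->
  m.-integrable setT (EFin \o (fun x => \sum_(i <- r) F i x)).
Proof.
move=> iF; elim: r => [|i r ih].
  have -> : EFin \o (fun x : T => \sum_(i <- [::]) F i x) = cst 0%E.
    by apply/funext => x /=; rewrite big_nil.
  exact: integrable0.
have -> : EFin \o (fun x : T => \sum_(j <- i :: r) F j x) =
    (fun x => (F i x)%:E + (\sum_(j <- r) F j x)%:E)%E.
  by apply/funext => x; rewrite /= big_cons EFinD.
exact: (integrableD measurableT (iF i) ih).
Qed.

Lemma Rintegral_sumr d (T : measurableType d) (m : {measure set T -> \bar R})
    (I : Type) (r : seq I) (F : I -> T -> R) :
  (forall i, m.-integrable setT (EFin \o F i)) ->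
  \int[m]_x (\sum_(i <- r) F i x) = \sum_(i <- r) \int[m]_x F i x.
Proof.
move=> iF; elim: r => [|i r ih].
  rewrite big_nil -[RHS](mul0r (fine (m setT))) -Rintegral_cst //.
  by apply: eq_Rintegral => x _; rewrite big_nil.
rewrite big_cons -ih -RintegralD //; last exact: integrable_sumr.
by apply: eq_Rintegral => x _; rewrite big_cons.
Qed.

Lemma phase_cons n (k : int) (nu : n.-tuple int) (a : R) (t : n.-tuple R) :
  phase (tnth [tuple of k :: nu]) [tuple of a :: t] =
  2 * pi * (k%:~R * a) + phase (tnth nu) t.
Proof.
rewrite /phase big_ord_recl (mulrDr (2 * pi)); congr (_ + 2 * pi * _).
by apply: eq_bigr => i _; rewrite !tnthS.
Qed.

Lemma phaseB n (nu : n.-tuple int) (x y : n.-tuple R) :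
  phase (tnth nu) [tuple tnth x i - tnth y i | i < n] =
  phase (tnth nu) x - phase (tnth nu) y.
Proof.
rewrite /phase -(mulrBr (2 * pi)) -sumrB; congr (_ * _).
by apply: eq_bigr => i _; rewrite tnth_mktuple mulrBr.
Qed.

Lemma phase_sub n (nu nu' : n.-tuple int) (x : n.-tuple R) :
  phase (fun i => tnth nu i - tnth nu' i) x = phase (tnth nu) x - phase (tnth nu') x.
Proof.
rewrite /phase -(mulrBr (2 * pi)) -sumrB; congr (_ * _).
by apply: eq_bigr => i _; rewrite rmorphB mulrBl.
Qed.

(* The complex exponential sum attached to [L] is real: this is what allows the real and
   imaginary parts of a function to be smoothed simultaneously. *)
Lemma prod_cospoly_expand n (s : seq (R * int)) : nnegp s ->
  exists2 L : seq (R * n.-tuple int), all (fun p => 0 <= p.1) L &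
    forall x : n.-tuple R,
      \prod_(i < n) cospoly s (tnth x i) = \sum_(p <- L) p.1 * cos (phase (tnth p.2) x) /\
      \sum_(p <- L) p.1 * sin (phase (tnth p.2) x) = 0.
Proof.
move=> s0; elim: n => [|n [L L0 HL]].
  exists [:: (1, [tuple])]; first by rewrite /= ler01.
  by move=> x; rewrite !big_seq1 big_ord0 /phase big_ord0 mulr0 cos0 sin0 mulr1 mulr0.
(* Each cosine is split into its two exponentials, for [e = 1] and [e = -1], with half the
   coefficient; their imaginary parts cancel in the full sum. *)
pose L1 (e : int) : seq (R * n.+1.-tuple int) :=
  [seq (p.1 * q.1 / 2, [tuple of (e * p.2)%R :: q.2]) |
    p : (R * int)%type <- s, q : (R * n.-tuple int)%type <- L].
exists (L1 1 ++ L1 (-1)).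
  apply/allP => p; rewrite mem_cat => /orP[] /allpairsP[[a b] /= [sa Lb ->]] /=;
    by rewrite divr_ge0 // mulr_ge0 //; [exact: (allP s0)|exact: (allP L0)].
case/tupleP => a t; have [Ec Es] := HL t.
have E (h : R -> R) (e : int) :
    \sum_(p <- L1 e) p.1 * h (phase (tnth p.2) [tuple of a :: t]) =
    \sum_(p <- s) \sum_(q <- L)
       p.1 * q.1 / 2 * h (2 * pi * ((e * p.2)%:~R * a) + phase (tnth q.2) t).
  rewrite big_allpairs_dep; apply: eq_bigr => p _; apply: eq_bigr => q _.
  by rewrite phase_cons.
have cN (p : R * int) : 2 * pi * ((-1 * p.2)%:~R * a) = - (2 * pi * (p.2%:~R * a)).
  by rewrite mulN1r rmorphN mulNr mulrN.
rewrite !big_cat /= !E -!big_split /=; split.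
  rewrite (prod_tuple_cons (fun=> cospoly s)) Ec /cospoly mulr_suml; apply: eq_bigr => p _.
  rewrite -big_split mulr_sumr; apply: eq_bigr => q _.
  by rewrite mul1r cN !cosD cosN sinN /cosi /=; lra.
rewrite big1 // => p _; rewrite -big_split /=.
rewrite (eq_bigr (fun q => p.1 * cosi p.2 a * (q.1 * sin (phase (tnth q.2) t)))).
  by rewrite -mulr_sumr Es mulr0.
by move=> q _; rewrite mul1r cN !sinD cosN sinN /cosi; lra.
Qed.

(** [cossum] and [sinsum] are the real and imaginary parts of one exponential sum, and [energy]
    below is its squared modulus. *)
Definition cossum n (L : seq (R * n.-tuple int)) (x : n.-tuple R) : R :=
  \sum_(p <- L) p.1 * cos (phase (tnth p.2) x).
Definition sinsum n (L : seq (R * n.-tuple int)) (x : n.-tuple R) : R :=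
  \sum_(p <- L) p.1 * sin (phase (tnth p.2) x).

Lemma mul_bounded_integrable d (T : measurableType d) (m : {measure set T -> \bar R})
    (u h : T -> R) : m.-integrable setT (EFin \o u) -> measurable_fun setT h ->
  (forall x, `|h x| <= 1) -> m.-integrable setT (EFin \o (fun x => u x * h x)).
Proof.
move=> iu mh h1; apply: (le_integrable _ _ _ iu) => //.
  apply/measurable_EFinP; apply: measurable_funM => //.
  by apply/measurable_EFinP; exact: (measurable_int m iu).
by move=> x _; rewrite /= lee_fin normrM ler_piMr.
Qed.

Lemma measurable_cos_phase n (nu : 'I_n -> int) :
  measurable_fun setT (fun x : n.-tuple R => cos (phase nu x)).
Proof.
apply: measurableT_comp; first exact: continuous_measurable_fun (@continuous_cos R).
exact: measurable_phase.
Qed.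

Lemma measurable_sin_phase n (nu : 'I_n -> int) :
  measurable_fun setT (fun x : n.-tuple R => sin (phase nu x)).
Proof.
apply: measurableT_comp; first exact: continuous_measurable_fun (@continuous_sin R).
exact: measurable_phase.
Qed.

Lemma cos_bound (x : R) : `|cos x| <= 1.
Proof. by rewrite ler_norml cos_geN1 cos_le1. Qed.

Lemma sin_bound (x : R) : `|sin x| <= 1.
Proof. by rewrite ler_norml sin_geN1 sin_le1. Qed.

Section smoothing_fourier.
Variables (n : nat) (s : seq (R * int)) (U V : n.-tuple R -> R).
Local Notation m := (tuple_lebesgue n).
Hypothesis s0 : nnegp s.
Hypothesis iU : m.-integrable setT (EFin \o U).
Hypothesis iV : m.-integrable setT (EFin \o V).
Hypothesis U0 : forall x, ~ torus_cell n x -> U x = 0.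
Hypothesis V0 : forall x, ~ torus_cell n x -> V x = 0.
Let Re (nu : n.-tuple int) :=
  \int[m]_y (U y * cos (phase (tnth nu) y) + V y * sin (phase (tnth nu) y)).
Let Im (nu : n.-tuple int) :=
  \int[m]_y (V y * cos (phase (tnth nu) y) - U y * sin (phase (tnth nu) y)).
Hypothesis Re_ge0 : forall nu, 0 <= Re nu.
Hypothesis Im0 : forall nu, Im nu = 0.

(** Convolution with a real even kernel multiplies the Fourier coefficients of [U + i V] by the
    nonnegative coefficients of the kernel. Those of [U + i V] are [Re nu], with no imaginary part,
    so on the cell the smoothing is an exponential sum with nonnegative coefficients. *)
Lemma smooth_trigonometric : exists2 L : seq (R * n.-tuple int), all (fun p => 0 <= p.1) L &
  forall x, torus_cell n x ->
    smooth m (torus_kernel s) U x = cossum L x /\ smooth m (torus_kernel s) V x = sinsum L x.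
Proof.
have [L L0 HL] := prod_cospoly_expand n s0.
exists [seq (p.1 * Re p.2, p.2) | p <- L].
  by apply/allP => p /mapP[q qL ->] /=; rewrite mulr_ge0 //; exact: (allP L0).
move=> x Cx; pose c nu (y : n.-tuple R) := cos (phase (tnth nu) y).
pose sn nu (y : n.-tuple R) := sin (phase (tnth nu) y).
have ic nu w : m.-integrable setT (EFin \o w) -> m.-integrable setT (EFin \o (fun y => w y * c nu y)).
  move=> iw; apply: mul_bounded_integrable => // [|y]; last exact: cos_bound.
  exact: measurable_cos_phase.
have isn nu w : m.-integrable setT (EFin \o w) -> m.-integrable setT (EFin \o (fun y => w y * sn nu y)).
  move=> iw; apply: mul_bounded_integrable => // [|y]; last exact: sin_bound.
  exact: measurable_sin_phase.
have iZ (F : n.-tuple R -> R) k : m.-integrable setT (EFin \o F) ->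
    m.-integrable setT (EFin \o (fun y => k * F y)).
  by move=> iF; exact: (integrableZl measurableT k iF).
have iA (F G : n.-tuple R -> R) : m.-integrable setT (EFin \o F) -> m.-integrable setT (EFin \o G) ->
    m.-integrable setT (EFin \o (fun y => F y + G y)).
  by move=> iF iG; exact: (integrableD measurableT iF iG).
have iSub (F G : n.-tuple R -> R) : m.-integrable setT (EFin \o F) -> m.-integrable setT (EFin \o G) ->
    m.-integrable setT (EFin \o (fun y => F y - G y)).
  by move=> iF iG; exact: (integrableB measurableT iF iG).
have EK (w : n.-tuple R -> R) y : (forall x, ~ torus_cell n x -> w x = 0) ->
    w y * torus_kernel s (x, y) =
    \sum_(p <- L) p.1 * (c p.2 x * (w y * c p.2 y) + sn p.2 x * (w y * sn p.2 y)).
  move=> w0; have [Cy|nCy] := pselect (torus_cell n y); last first.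
    rewrite w0 // mul0r big1 // => p _; rewrite !mul0r !mulr0 addr0 mulr0 //.
  rewrite /torus_kernel /= !indicE !mem_set // !mulr1.
  have [E _] := HL [tuple tnth x i - tnth y i | i < n].
  under eq_bigr do rewrite -(tnth_mktuple (fun i => tnth x i - tnth y i)).
  rewrite E mulr_sumr; apply: eq_bigr => p _.
  by rewrite phaseB cosB /c /sn; ring.
(* The sine sum of the kernel vanishes identically. Combining this zero, formed with one of [U] and
   [V], with the cosine expansion of the other is what groups the integrals into [Re] and [Im]. *)
have E0 (w : n.-tuple R -> R) y : \sum_(p <- L) p.1 *
    (sn p.2 x * (w y * c p.2 y) - c p.2 x * (w y * sn p.2 y)) = 0.
  have [_ E] := HL [tuple tnth x i - tnth y i | i < n].
  apply: etrans (_ : w y * 0 = 0); last exact: mulr0.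
  rewrite -[X in w y * X]E mulr_sumr; apply: eq_bigr => p _.
  by rewrite phaseB sinB /c /sn; ring.
have smE w : m.-integrable setT (EFin \o w) -> (forall x, ~ torus_cell n x -> w x = 0) ->
    smooth m (torus_kernel s) w x = \sum_(p <- L) p.1 *
      (c p.2 x * (\int[m]_y (w y * c p.2 y)) + sn p.2 x * (\int[m]_y (w y * sn p.2 y))).
  move=> iw w0; rewrite /smooth (eq_Rintegral _ (fun y _ => EK w y w0)).
  have i1 p := iZ _ (c p x) (ic p w iw); have i2 p := iZ _ (sn p x) (isn p w iw).
  have i3 p := iA _ _ (i1 p) (i2 p).
  rewrite (Rintegral_sumr _ (fun p => iZ _ p.1 (i3 p.2))); apply: eq_bigr => p _.
  by rewrite RintegralZl // RintegralD // !RintegralZl //; auto.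
have s0E w : m.-integrable setT (EFin \o w) -> 0 = \sum_(p <- L) p.1 *
      (sn p.2 x * (\int[m]_y (w y * c p.2 y)) - c p.2 x * (\int[m]_y (w y * sn p.2 y))).
  move=> iw; transitivity (\int[m]_y (\sum_(p <- L) p.1 *
    (sn p.2 x * (w y * c p.2 y) - c p.2 x * (w y * sn p.2 y)))).
    rewrite -[LHS](mul0r (fine (m setT))) -Rintegral_cst //.
    by apply: eq_Rintegral => y _; rewrite E0.
  have i1 p := iZ _ (sn p x) (ic p w iw); have i2 p := iZ _ (c p x) (isn p w iw).
  have i3 p := iSub _ _ (i1 p) (i2 p).
  rewrite (Rintegral_sumr _ (fun p => iZ _ p.1 (i3 p.2))); apply: eq_bigr => p _.
  by rewrite RintegralZl // RintegralB // !RintegralZl //; auto.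
have ReE nu : Re nu = \int[m]_y (U y * c nu y) + \int[m]_y (V y * sn nu y).
  by rewrite /Re RintegralD //; [exact: ic|exact: isn].
have ImE nu : \int[m]_y (V y * c nu y) = \int[m]_y (U y * sn nu y).
  by apply/eqP; rewrite -subr_eq0 -RintegralB // ?[X in X == _](Im0 nu) //; [exact: ic|exact: isn].
rewrite (smE U) // (smE V) // /cossum /sinsum !big_map; split.
  rewrite -[LHS]subr0 [X in _ - X](s0E V iV) -sumrB; apply: eq_bigr => p _ /=.
  by rewrite ReE ImE -/(c _ _); ring.
rewrite -[LHS]addr0 [X in _ + X](s0E U iU) -big_split /=; apply: eq_bigr => p _ /=.
by rewrite ReE ImE -/(sn _ _); ring.
Qed.

End smoothing_fourier.

Definition energy n (L : seq (R * n.-tuple int)) (x : n.-tuple R) : R :=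
  cossum L x ^+ 2 + sinsum L x ^+ 2.

Lemma energyE n (L : seq (R * n.-tuple int)) x :
  energy L x =
  \sum_(p <- L) \sum_(q <- L) p.1 * q.1 * cos (phase (fun i => tnth p.2 i - tnth q.2 i) x).
Proof.
rewrite /energy !expr2 /cossum /sinsum !big_distrlr -big_split /=; apply: eq_bigr => p _.
by rewrite -big_split /=; apply: eq_bigr => q _; rewrite phase_sub cosB /=; ring.
Qed.

(** The squared modulus is a double sum of cosines of frequency differences, and each cosine
    integrates to a product because the sine coefficients of [psi] vanish. *)
Lemma Rintegral_energy n (L : seq (R * n.-tuple int)) (psi : R -> R) :
  continuous psi -> (forall k, int1 (fun x => psi x * sini k x) = 0) ->
  let F x := \prod_(i < n) (psi (tnth x i) * \1_cell (tnth x i)) * energy L x in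
  (tuple_lebesgue n).-integrable setT (EFin \o F) /\
  \int[tuple_lebesgue n]_x F x = \sum_(p <- L) \sum_(q <- L) p.1 * q.1 *
    \prod_(i < n) int1 (fun x => psi x * cosi (tnth p.2 i - tnth q.2 i) x).
Proof.
move=> cpsi psi0 F; pose phi (i : 'I_n) x := psi x * \1_cell x.
pose G (p q : R * n.-tuple int) x := \prod_(i < n) phi i (tnth x i) *
  cos (phase (fun i => tnth p.2 i - tnth q.2 i) x).
have iphi i : mu.-integrable setT (EFin \o phi i) by exact: indic_cell_integrable.
have iG p q : (tuple_lebesgue n).-integrable setT (EFin \o G p q).
  apply: integrable_prod_bounded => // [|x]; last exact: cos_bound.
  exact: measurable_cos_phase.
have iZG p q : (tuple_lebesgue n).-integrable setT (EFin \o (fun x => p.1 * q.1 * G p q x)).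
  exact: (integrableZl measurableT (p.1 * q.1) (iG p q)).
have iS p : (tuple_lebesgue n).-integrable setT
    (EFin \o (fun x => \sum_(q <- L) p.1 * q.1 * G p q x)) by exact: integrable_sumr.
have FE : F = fun x => \sum_(p <- L) \sum_(q <- L) p.1 * q.1 * G p q x.
  apply/funext => x; rewrite /F energyE mulr_sumr; apply: eq_bigr => p _.
  by rewrite mulr_sumr; apply: eq_bigr => q _; rewrite /G mulrCA.
rewrite FE; split; first exact: integrable_sumr.
rewrite Rintegral_sumr //; apply: eq_bigr => p _.
rewrite Rintegral_sumr //; apply: eq_bigr => q _.
rewrite RintegralZl //; congr (_ * _).
rewrite -[RHS]mul1r -[X in X * _]cos0.
under eq_Rintegral do rewrite /G -[phase _ _]add0r.
apply: Rintegral_prod_cos => // i.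
  rewrite int1E; apply: eq_Rintegral => x _; rewrite /phi; ring.
rewrite -[RHS](psi0 (tnth p.2 i - tnth q.2 i)) int1E; apply: eq_Rintegral => x _.
rewrite /phi; ring.
Qed.

End trigonometric_polynomials.

(** * Comparison of energies on the cell and on a cube *)

Section energy_comparison.
Context {R : realType}.
Local Notation mu := (@lebesgue_measure R).
Local Notation cell := [set` `[(- 2^-1 : R), 2^-1[].

Lemma measurable_scaled_cube n (dl : R) : measurable (scaled_cube n dl).
Proof. by apply: (@measurable_box R n (fun=> [set` `[- dl, dl]])) => i; exact: measurable_itv. Qed.

Lemma scaled_cube_cell n (dl : R) : dl < 2^-1 -> scaled_cube n dl `<=` torus_cell n.
Proof. by move=> d2 x h i; have := h i; rewrite !in_itv /=; lra. Qed.

Lemma energy_comparison n (L : seq (R * n.-tuple int)) (m dl : R) (g : R -> R) :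
  all (fun p => 0 <= p.1) L -> adm m dl g -> 0 <= m -> dl < 2^-1 ->
  ((m ^+ n)%:E * \int[tuple_lebesgue n]_x (energy L x * \1_(torus_cell n) x)%:E <=
   \int[tuple_lebesgue n]_x (energy L x * \1_(scaled_cube n dl) x)%:E)%E.
Proof.
move=> L0 ag m0 d2; have [pg _ gs] := ag; pose E := @energy R n L; rewrite -/E.
pose F psi (x : n.-tuple R) := \prod_(i < n) (psi (tnth x i) * \1_cell (tnth x i)) * E x.
pose F1 := F (fun=> 1); pose Fg := F g.
have [i1 I1] := @Rintegral_energy R n L (fun=> 1) (@continuous_cstf R 1)
  (fun k => etrans (eq_int1 (fun x _ => mul1r _)) (@int1_sini R k)).
rewrite -/(F (fun=> 1)) -/F1 in i1 I1.
have [ig Ig] := @Rintegral_energy R n L g (posdef_continuous pg)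
  (fun k => posdef_int1_sini k pg).
rewrite -/(F g) -/Fg in ig Ig.

have E0 x : 0 <= E x by rewrite /E /energy addr_ge0 ?sqr_ge0.
have F1E x : F1 x = E x * \1_(torus_cell n) x.
  rewrite /F1 indic_torus_cell mulrC; congr (_ * _).
  by apply: eq_bigr => i _; rewrite mul1r.
have iD : (tuple_lebesgue n).-integrable setT (EFin \o (fun x => E x * \1_(scaled_cube n dl) x)).
  have mD := @measurable_scaled_cube n dl.
  rewrite (_ : _ \o _ = EFin \o (fun x => F1 x * \1_(scaled_cube n dl) x)).
    apply: mul_bounded_integrable => //.
    by move=> x; rewrite ger0_norm // indic_le1.
  apply/funext => x /=; rewrite F1E -mulrA; congr ((_ * _)%R%:E).
  rewrite !indicE; case: (boolP (x \in scaled_cube n dl)) => [|_]; last by rewrite mulr0.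
  by rewrite inE => /(scaled_cube_cell d2) xC; rewrite mem_set // mul1r.
have finD : (\int[tuple_lebesgue n]_x (E x * \1_(scaled_cube n dl) x)%:E =
    (\int[tuple_lebesgue n]_x (E x * \1_(scaled_cube n dl) x))%:E)%E.
  by rewrite /Rintegral fineK //; exact: (integrable_fin_num _ iD).
have -> : (\int[tuple_lebesgue n]_x (E x * \1_(torus_cell n) x)%:E =
    (\int[tuple_lebesgue n]_x F1 x)%:E)%E.
  rewrite /Rintegral fineK //; last exact: (integrable_fin_num _ i1).
  by apply: eq_integral => x _; rewrite F1E.
rewrite finD -EFinM lee_fin; apply: (@le_trans _ _ (\int[tuple_lebesgue n]_x Fg x)); last first.
  apply: le_Rintegral => // x _; rewrite /Fg -/(E x) [leLHS]mulrC; apply: ler_wpM2l => //.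
  rewrite indicE; have [xD|xD] := boolP (x \in scaled_cube n dl).
    apply: (le_trans (ler_norm _)); rewrite normr_prod /=.
    apply: prodr_ile1 => i _; rewrite normrM mulr_ge0 //=.
    rewrite mulr_ile1 //; first exact: (adm_norm_le1 _ m0 ag).
    by rewrite ger0_norm // indic_le1.
  have [xC|xC] := pselect (torus_cell n x); last first.
    have [i ni] : exists i, ~ (tnth x i \in `[- 2^-1, 2^-1[) by apply/existsNP.
    by rewrite (bigD1 i) //= indicE memNset ?mulr0 ?mul0r.
  have [i ni] : exists i, ~ (tnth x i \in `[- dl, dl]).
    by apply/existsNP => h; move/negP : xD; apply; rewrite inE.
  rewrite (bigD1 i) //= gs ?mul0r //.
  have := xC i; rewrite in_itv /= => xi; have ai : `|tnth x i| <= 2^-1 by rewrite ler_norml; lra.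
  rewrite dZ_norm //; move: ni => /negP; rewrite in_itv /= -ler_norml -ltNge; exact: ltW.
(* Both integrals are now double sums over pairs of frequencies with nonnegative weights
   [p.1 * q.1], so factors are compared: [m] if the difference [k] is zero and [0] otherwise,
   against the coefficient of [g] at [k]. *)
rewrite I1 Ig mulr_sumr; rewrite big_seq [leRHS]big_seq; apply: ler_sum => p pL.
rewrite mulr_sumr; rewrite big_seq [leRHS]big_seq.
apply: ler_sum => q qL; rewrite mulrCA ler_wpM2l //.
  by rewrite mulr_ge0 //; exact: (allP L0).
rewrite -[X in m ^+ X]card_ord -prodr_const -big_split /=; apply: ler_prod => i _.
set k := tnth p.2 i - tnth q.2 i.
have -> : int1 (fun x : R => 1 * cosi k x) = (k == 0)%:R.
  rewrite -[RHS](@int1_cosi R k); apply: eq_int1 => x _; exact: mul1r.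
rewrite mulr_ge0 //=; have [->|k0] := eqVneq k 0; last by rewrite mulr0 (posdef_int1_cosi _ pg).
rewrite mulr1; apply: (le_trans (posdef_le_int1 pg)).
by rewrite le_eqVlt; apply/orP; left; apply/eqP; apply: eq_int1 => x _; rewrite cosi0 mulr1.
Qed.

End energy_comparison.

(** * The energy inequality for integrable f with nonnegative coefficients *)

Section wiener_bound.
Context {R : realType} {n : nat}.
Variables (f : n.-tuple R -> R[i]) (dl : R).
Hypothesis dl0 : 0 < dl.
Hypothesis dl2 : dl < 2^-1.
Hypothesis Lf : L1plus f.
Local Notation m := (tuple_lebesgue n).
Local Notation C := (torus_cell n : set (n.-tuple R)).
Local Notation D := (scaled_cube n dl : set (n.-tuple R)).
Hypothesis finS : (sq_integral m D f < +oo)%E.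

Let U x := complex.Re (f x) * \1_C x.
Let V x := complex.Im (f x) * \1_C x.
Let mC : measurable C. Proof. exact: measurable_torus_cell. Qed.
Let mD : measurable D. Proof. exact: measurable_scaled_cube. Qed.
Let DC : D `<=` C. Proof. exact: scaled_cube_cell. Qed.

Let iU : m.-integrable setT (EFin \o U).
Proof. by case: Lf => _ [h _] _; exact: integrable_mul_indic. Qed.
Let iV : m.-integrable setT (EFin \o V).
Proof. by case: Lf => _ [_ h] _; exact: integrable_mul_indic. Qed.
Let mU : measurable_fun setT U.
Proof. by apply/measurable_EFinP; exact: (measurable_int m iU). Qed.
Let mV : measurable_fun setT V.
Proof. by apply/measurable_EFinP; exact: (measurable_int m iV). Qed.

Let U0 x : ~ C x -> U x = 0.
Proof. by move=> nC; rewrite /U indicE memNset // mulr0. Qed.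
Let V0 x : ~ C x -> V x = 0.
Proof. by move=> nC; rewrite /V indicE memNset // mulr0. Qed.

Lemma fourier_coef_re_im (nu : n.-tuple int) :
  0 <= \int[m]_y (U y * cos (phase (tnth nu) y) + V y * sin (phase (tnth nu) y)) /\
  \int[m]_y (V y * cos (phase (tnth nu) y) - U y * sin (phase (tnth nu) y)) = 0.
Proof.
case: Lf => _ _ /(_ nu); rewrite lecE => /andP[/eqP im0 re0]; split.
  move: re0; rewrite [complex.Re (fourier_coef _ _)]Rintegral_mul_indic => re0.
  apply: (le_trans re0).
  rewrite le_eqVlt; apply/orP; left; apply/eqP; apply: eq_Rintegral => x _.
  by rewrite /expi /U /V -/(phase _ _) cosN sinN; case: (f x) => a b /=; ring.
move: im0; rewrite [complex.Im (fourier_coef _ _)]Rintegral_mul_indic => im0.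
apply: etrans im0; apply: eq_Rintegral => x _.
by rewrite /expi /U /V -/(phase _ _) cosN sinN; case: (f x) => a b /=; ring.
Qed.

Lemma sq_integralE (A : set (n.-tuple R)) : A `<=` C ->
  (sq_integral m A f = \int[m]_x ((U x ^+ 2 + V x ^+ 2) * \1_A x)%:E)%E.
Proof.
move=> AC; rewrite /sq_integral integral_mkcond; apply: eq_integral => x _.
rewrite patchE [in RHS]indicE; case: ifPn => [|_]; last by rewrite mulr0.
rewrite inE => /AC Cx; rewrite mulr1 /U /V indicE mem_set // !mulr1; congr EFin.
by case: (f x) => a b /=; rewrite sqr_sqrtr // addr_ge0 ?sqr_ge0.
Qed.

Let mUD : measurable_fun setT (fun x => U x ^+ 2 * \1_D x).
Proof. by apply: measurable_funM; [exact: measurable_funX|exact: measurable_indic]. Qed.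
Let mVD : measurable_fun setT (fun x => V x ^+ 2 * \1_D x).
Proof. by apply: measurable_funM; [exact: measurable_funX|exact: measurable_indic]. Qed.

Let SD : (sq_integral m D f =
  \int[m]_x (U x ^+ 2 * \1_D x)%:E + \int[m]_x (V x ^+ 2 * \1_D x)%:E)%E.
Proof.
rewrite sq_integralE //; under eq_integral do rewrite mulrDl EFinD.
rewrite ge0_integralD //.
- by move=> x _; rewrite lee_fin mulr_ge0 ?sqr_ge0.
- exact/measurable_EFinP.
- by move=> x _; rewrite lee_fin mulr_ge0 ?sqr_ge0.
- exact/measurable_EFinP.
Qed.

Let iw2 (w : n.-tuple R -> R) : measurable_fun setT (fun x => w x ^+ 2 * \1_D x) ->
  (\int[m]_x (w x ^+ 2 * \1_D x)%:E <= sq_integral m D f)%E ->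
  m.-integrable setT (EFin \o (fun x => w x ^+ 2 * \1_D x)).
Proof.
move=> mw wS; apply/integrableP; split; first exact/measurable_EFinP.
apply: le_lt_trans finS; apply: le_trans wS; rewrite le_eqVlt; apply/orP; left; apply/eqP.
by apply: eq_integral => x _; rewrite /= ger0_norm // mulr_ge0 ?sqr_ge0.
Qed.

(** The slack between [t] and [turan dl] allows a smaller cube of half-width [d], by left
    continuity. Smoothed functions are compared on that cube, and the gap [dl - d] keeps the kernel,
    up to its tail, from importing mass from outside [D]. *)
Lemma truncated_energy_le (t eta : R) : 0 < t -> t < turan dl -> 0 < eta ->
  ((t ^+ n)%:E * sq_integral m C f <= (1 + eta)%:E * sq_integral m D f)%E.
Proof.
move=> t0 tt eta0.
have [d /andP[d0 d1] td] : exists2 d, 0 < d < dl & t < turan d.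
  have e0 : 0 < (turan dl - t) / 2 by rewrite divr_gt0 // subr_gt0.
  have [d dd td] := turan_left dl0 dl2 e0; exists d => //.
  by apply: lt_le_trans td; lra.
have d2 : d < 2^-1 by exact: lt_trans dl2.
have [g ag] := lt_turan_adm d0 d2 td.
have h0 (N : nat) : 0 < N.+1%:R^-1 :> R by rewrite invr_gt0.
pose P N := cosine_kernel n (h0 N) (h0 N).
have /choice[s /choice[M HM]] := P.
have s0 N : nnegp (s N) by case: (HM N).
have s1 N : ctp (s N) = 1 by case: (HM N).
have sM N x : 0 <= cospoly (s N) x <= M N by case: (HM N).
have tail N x : N.+1%:R^-1 <= dZ x -> cospoly (s N) x * M N ^+ n <= N.+1%:R^-1.
  by case: (HM N) => _ _ _; exact.
pose K N := @torus_kernel R n (s N).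
have sK N : skernel m C (K N) by exact: torus_kernel_skernel (s1 N) (sM N).
have bK N z : K N z <= M N ^+ n by exact: torus_kernel_le (sM N) z.
have SfinD : sq_integral m D f \is a fin_num.
  rewrite ge0_fin_numE //; apply: integral_ge0 => x _; rewrite lee_fin sqr_ge0 //.
set S := fine (sq_integral m D f).
have SE : sq_integral m D f = S%:E by rewrite /S fineK.
have tn0 : 0 < t ^+ n by rewrite exprn_gt0.
suff H : (sq_integral m C f <= ((1 + eta) * S / t ^+ n)%:E)%E.
  rewrite SE -EFinM; apply: (le_trans (lee_wpmul2l _ H)); first by rewrite lee_fin ltW.
  by rewrite -EFinM lee_fin mulrC divfK // gt_eqF.
rewrite sq_integralE //; apply: (smooth_lsc mC sK bK iU iV).
- exact: (vanishing_torus s1 sM tail iU).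
- exact: (vanishing_torus s1 sM tail iV).
move=> e e0.
pose c := (1 + eta^-1) * ((\int[m]_y `|U y|) ^+ 2 + (\int[m]_y `|V y|) ^+ 2).
have c0 : 0 <= c.
  by rewrite mulr_ge0 ?addr_ge0 ?sqr_ge0 // ?invr_ge0 ltW.
have te : 0 < e * t ^+ n / (c + 1) by rewrite divr_gt0 ?mulr_gt0 // ltr_wpDl.
have dd : 0 < dl - d by rewrite subr_gt0.
apply: filterS2 (near_infty_natSinv_lt (PosNum te)) (near_infty_natSinv_lt (PosNum dd)).
move=> N /= hN1 hN2; set h := N.+1%:R^-1 in hN1 hN2.
have [L L0 HL] := smooth_trigonometric (s0 N) iU iV U0 V0
  (fun nu => (fourier_coef_re_im nu).1) (fun nu => (fourier_coef_re_im nu).2).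
have comp := energy_comparison L0 ag (ltW t0) d2.
have mD' := @measurable_scaled_cube R n d.
have D'C : (scaled_cube n d : set (n.-tuple R)) `<=` C by exact: scaled_cube_cell.
(* Some coordinate of [y] exceeds [dl] in absolute value while that of [x] is at most [d]; both
   points lie in the cell, so on the circle these coordinates are more than [dl - d > h] apart and
   the tail bound applies. *)
have Kt (w : n.-tuple R -> R) x y : (forall x, ~ C x -> w x = 0) ->
    scaled_cube n d x -> ~ D y -> w y != 0 -> K N (x, y) <= h.
  move=> w0 Dx nDy wy; have Cy : C y by apply: contrapT => /w0 /eqP; rewrite (negbTE wy).
  have [i ni] : exists i, ~ (tnth y i \in `[- dl, dl]) by exact/existsNP.
  apply: (@torus_kernel_tail R n (s N) (M N) (s1 N) (sM N) h h (x, y) i (tail N)) => /=.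
  have := Cy i; rewrite in_itv /= => yi.
  have := Dx i; rewrite in_itv /= -ler_norml => xi.
  move: ni => /negP; rewrite in_itv /= -ler_norml -ltNge => yd.
  have yE : dZ (tnth y i) = `|tnth y i| by apply: dZ_norm; rewrite ler_norml; lra.
  have xE : dZ (tnth x i) = `|tnth x i| by apply: dZ_norm; lra.
  have := dZD (- (tnth x i - tnth y i)) (tnth x i); rewrite dZN.
  rewrite opprB subrK yE xE; lra.
pose SU := (\int[m]_x (U x ^+ 2 * \1_D x)%:E)%E.
pose SV := (\int[m]_x (V x ^+ 2 * \1_D x)%:E)%E.
have SUV : (sq_integral m D f = SU + SV)%E by exact: SD.
have SU0 : (0 <= SU)%E by apply: integral_ge0 => x _; rewrite lee_fin mulr_ge0 ?sqr_ge0.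
have SV0 : (0 <= SV)%E by apply: integral_ge0 => x _; rewrite lee_fin mulr_ge0 ?sqr_ge0.
have UleS : (SU <= sq_integral m D f)%E by rewrite SUV leeDl.
have VleS : (SV <= sq_integral m D f)%E by rewrite SUV leeDr.
have smU := smooth_local mC (sK N) (bK N) mD mD' D'C iU (iw2 mUD UleS) eta0 (ltW (h0 N))
  (fun x y => @Kt U x y U0).
have smV := smooth_local mC (sK N) (bK N) mD mD' D'C iV (iw2 mVD VleS) eta0 (ltW (h0 N))
  (fun x y => @Kt V x y V0).
rewrite -/SU in smU; rewrite -/SV in smV.
rewrite torus_cell_measure mule1 in smU; rewrite torus_cell_measure mule1 in smV.
have -> : (\int[m]_x ((smooth m (K N) U x ^+ 2 + smooth m (K N) V x ^+ 2) * \1_C x)%:E =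
    \int[m]_x (energy L x * \1_C x)%:E)%E.
  apply: eq_integral => x _; congr EFin; rewrite [\1_C x]indicE.
  have [|_] := boolP (x \in C); last by rewrite !mulr0.
  by rewrite inE => Cx; have [-> ->] := HL x Cx.
have ED : (\int[m]_x (energy L x * \1_(scaled_cube n d) x)%:E =
    \int[m]_x (smooth m (K N) U x ^+ 2 * \1_(scaled_cube n d) x)%:E +
    \int[m]_x (smooth m (K N) V x ^+ 2 * \1_(scaled_cube n d) x)%:E)%E.
  have ms w : m.-integrable setT (EFin \o w) -> measurable_fun setT
      (fun x => (smooth m (K N) w x ^+ 2 * \1_(scaled_cube n d) x)%:E).
    move=> iw; apply/measurable_EFinP; apply: measurable_funM; last exact: measurable_indic.
    by apply: measurable_funX; exact: (measurable_smooth mC (sK N) iw).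
  rewrite -ge0_integralD //; [|by move=> x _; rewrite lee_fin mulr_ge0 ?sqr_ge0|exact: ms|
    by move=> x _; rewrite lee_fin mulr_ge0 ?sqr_ge0|exact: ms].
  apply: eq_integral => x _; rewrite -EFinD -mulrDl; congr EFin; rewrite [\1_(scaled_cube n d) x]indicE.
  have [|_] := boolP (x \in scaled_cube n d); last by rewrite !mulr0.
  by rewrite inE => /D'C Cx; have [-> ->] := HL x Cx.
set X := (\int[m]_x (energy L x * \1_C x)%:E)%E in comp *.
have Y : ((t ^+ n)%:E * X <= ((1 + eta) * S + c * h ^+ 2)%:E)%E.
  apply: (le_trans comp); rewrite ED; apply: (le_trans (leeD smU smV)).
  have -> : (((1 + eta) * S + c * h ^+ 2)%:E =
      (1 + eta)%:E * sq_integral m D f + (c * h ^+ 2)%:E)%E by rewrite SE EFinD EFinM.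
  rewrite SUV (ge0_muleDr _ SU0 SV0) addeACA; apply: (leeD (lexx _)).
  rewrite -EFinD lee_fin -/h /c.
  by rewrite le_eqVlt; apply/orP; left; apply/eqP; ring.
have h1 : h <= 1 by rewrite invf_le1 ?ler1n.
have hc : c * h ^+ 2 <= e * t ^+ n.
  apply: (@le_trans _ _ ((c + 1) * h)); last by rewrite mulrC -ler_pdivlMr ?ltr_wpDl // ltW.
  rewrite expr2 mulrA; apply: ler_wpM2r; first exact: ltW (h0 N).
  by apply: (@le_trans _ _ c); [rewrite ler_piMr|rewrite lerDl].
have -> : (X = (t ^+ n)^-1%:E * ((t ^+ n)%:E * X))%E.
  by rewrite muleA -EFinM mulVf ?mul1e // gt_eqF.
apply: (le_trans (lee_wpmul2l _ Y)); first by rewrite lee_fin invr_ge0 ltW.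
rewrite -EFinM lee_fin mulrC ler_pdivrMr // [leRHS]mulrDl divfK ?gt_eqF //.
by rewrite lerD2l.
Qed.

Lemma energy_le : ((turan dl ^+ n)%:E * sq_integral m C f <= sq_integral m D f)%E.
Proof.
have a0 : 0 < turan dl by apply: lt_le_trans (turan_ge dl0 dl2).
have SfinD : sq_integral m D f \is a fin_num.
  by rewrite ge0_fin_numE //; apply: integral_ge0 => x _; rewrite lee_fin sqr_ge0.
set S := fine (sq_integral m D f).
have SE : sq_integral m D f = S%:E by rewrite /S fineK.
have S0 : 0 <= S by apply: fine_ge0; apply: integral_ge0 => x _; rewrite lee_fin sqr_ge0.
have T0 : (0 <= sq_integral m C f)%E by apply: integral_ge0 => x _; rewrite lee_fin sqr_ge0.
(* Finiteness on the whole cell comes from one crude instance, [t] half the Turan value and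
   [eta = 1]; after that [eta] and [t] go to their limits within real numbers. *)
have finT : sq_integral m C f \is a fin_num.
  rewrite ge0_fin_numE //; pose t := turan dl / 2.
  have t0 : 0 < t by rewrite divr_gt0.
  have tt : t < turan dl by rewrite /t; lra.
  have H := truncated_energy_le t0 tt ltr01.
  rewrite ltey; apply/eqP => E; move: H; rewrite E SE -EFinM gt0_muley ?lte_fin ?exprn_gt0 //.
set T := fine (sq_integral m C f).
have TE : sq_integral m C f = T%:E by rewrite /T fineK.
rewrite TE SE -EFinM lee_fin.
have H t : 0 < t -> t < turan dl -> t ^+ n * T <= S.
  move=> t0 tt; apply/ler_addgt0Pr => e e0.
  have eta0 : 0 < e / (S + 1) by rewrite divr_gt0 // ltr_wpDl.
  have := truncated_energy_le t0 tt eta0; rewrite TE SE -!EFinM lee_fin => h.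
  apply: (le_trans h); rewrite mulrDl mul1r lerD2l mulrAC ler_pdivrMr ?ltr_wpDl //.
  by rewrite ler_wpM2l ?(ltW e0) // lerDl.
have cv : (fun t : R => t ^+ n * T) x @[x --> (turan dl)^'-] --> turan dl ^+ n * T.
  apply: cvg_at_left_filter; apply: cvgMl; exact: exprn_continuous.
apply: (cvgr_to_le cv).
near=> t; apply: H; near: t; [exact: nbhs_left_gt|exact: nbhs_left_lt].
Unshelve. all: by end_near. Qed.

End wiener_bound.

(** * The bound for the Wiener constant *)

Section wiener_constant_bound.
Context {R : realType}.

Lemma scaled_cube_measure n (dl : R) : 0 < dl ->
  tuple_lebesgue n (scaled_cube n dl) = ((2 * dl) ^+ n)%:E.
Proof.
move=> d0; rewrite (_ : scaled_cube n dl = box (fun=> [set` `[- dl, dl]])) //.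
rewrite (@measure_box R n (fun=> [set` `[- dl, dl]]) (fun=> 2 * dl)) => [|i|i].
- by rewrite prodr_const card_ord.
- exact: measurable_itv.
- rewrite lebesgue_measure_itv /= lte_fin ifT; last by lra.
  by rewrite -EFinB; congr EFin; lra.
Qed.

Lemma sq_integral_eq0 n (f : n.-tuple R -> R[i]) : L1plus f ->
  sq_integral (tuple_lebesgue n) (torus_cell n) f = 0%E -> torus_ae_zero f.
Proof.
move=> [_ [iRe iIm] _] S0; have mC := @measurable_torus_cell R n.
have nE (z : R[i]) : Normc.normc z ^+ 2 = complex.Re z ^+ 2 + complex.Im z ^+ 2.
  by case: z => a b /=; rewrite sqr_sqrtr // addr_ge0 ?sqr_ge0.
have mn : measurable_fun (torus_cell n)
    (fun x => (complex.Re (f x) ^+ 2 + complex.Im (f x) ^+ 2)%:E).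
  apply/measurable_EFinP; apply: measurable_funD; apply: measurable_funX.
    by apply/measurable_EFinP; exact: (measurable_int _ iRe).
  by apply/measurable_EFinP; exact: (measurable_int _ iIm).
have /(ae_eq_integral_abs _ mC mn) : (\int[tuple_lebesgue n]_(x in torus_cell n)
    `|(complex.Re (f x) ^+ 2 + complex.Im (f x) ^+ 2)%:E| = 0)%E.
  rewrite -S0 /sq_integral; apply: eq_integral => x _.
  by rewrite nE /= ger0_norm // addr_ge0 ?sqr_ge0.
apply: filterS => x + Cx => /(_ Cx) /= [/eqP].
rewrite paddr_eq0 ?sqr_ge0 // !sqrf_eq0.
by case: (f x) => a b /= /andP[/eqP -> /eqP ->].
Qed.

Lemma wiener_constant_le n (dl : R) : 0 < dl -> dl < 2^-1 ->
  (wiener_constant (scaled_cube n dl) <= (2 ^+ n * (1 - theta dl) ^+ n)%:E)%E.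
Proof.
move=> d0 d2; apply: ge_ereal_sup => _ [f [Lf nz finS ->]].
have a0 : 0 < turan dl by apply: lt_le_trans (turan_ge d0 d2).
have H := energy_le d0 d2 Lf finS.
have Sge0 (A : set (n.-tuple R)) : (0 <= sq_integral (tuple_lebesgue n) A f)%E.
  by apply: integral_ge0 => x _; rewrite lee_fin sqr_ge0.
have [S SE] : exists S, sq_integral (tuple_lebesgue n) (scaled_cube n dl) f = S%:E.
  by exists (fine (sq_integral (tuple_lebesgue n) (scaled_cube n dl) f)); rewrite fineK // ge0_fin_numE.
have an0 : 0 < turan dl ^+ n by rewrite exprn_gt0.
have [T TE] : exists T, sq_integral (tuple_lebesgue n) (torus_cell n) f = T%:E.
  exists (fine (sq_integral (tuple_lebesgue n) (torus_cell n) f)); rewrite fineK //.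
  rewrite ge0_fin_numE // ltey; apply/eqP => E; move: H.
  by rewrite E SE gt0_muley ?lte_fin.
rewrite TE SE -EFinM lee_fin in H.
have S0 : 0 <= S by rewrite -lee_fin -SE.
have T0 : 0 <= T by rewrite -lee_fin -TE.
(* Zero energy on the cube would force zero energy on the cell, hence [f = 0] almost everywhere; so
   all inverses below are of positive reals. *)
have Sn0 : 0 < S.
  rewrite lt_neqAle S0 andbT; apply/eqP => S0'; apply: nz; apply: sq_integral_eq0 => //.
  rewrite TE; congr EFin; apply/eqP; rewrite eq_le T0 andbT.
  by rewrite -(pmulr_rle0 _ an0) S0'.
have dn0 : 0 < (2 * dl) ^+ n by rewrite exprn_gt0 // mulr_gt0.
rewrite scaled_cube_measure // TE SE inver gt_eqF // -EFinM inver gt_eqF; last first.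
  by rewrite mulr_gt0 // invr_gt0.
(* [1 - theta dl] is [dl / turan dl], so the claimed bound is the measure of the cube divided by the
   [n]-th power of the Turan value. *)
have -> : 2 ^+ n * (1 - theta dl) ^+ n = (2 * dl) ^+ n / turan dl ^+ n.
  by rewrite /theta subKr -exprMn mulrA expr_div_n.
rewrite -EFinM lee_fin invfM invrK.
have -> : T * ((2 * dl) ^+ n / S) = (2 * dl) ^+ n * (T / S) by ring.
rewrite ler_wpM2l ?(ltW dn0) // ler_pdivrMr // mulrC ler_pdivlMr // mulrC.
exact: H.
Qed.

End wiener_constant_bound.

Theorem theorem3 (R : realType) (n : nat) (n_gt0 : (0 < n)%N) :
  [/\ forall delta : R, 0 < delta -> delta < 2^-1 ->
        (wiener_constant (scaled_cube n delta) <=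
         (2 ^+ n * (1 - theta delta) ^+ n)%:E)%E,
      {in `]0, 2^-1[, continuous (@theta R)} /\
      ((@theta R : R -> R^o) =O_ (0^'+) (fun delta : R => delta ^+ 2)),
      forall delta : R, 0 < delta -> delta < 2^-1 ->
        delta^-1 \is a Num.nat -> theta delta = 0 &
      forall delta : R, 0 < delta -> delta < 2^-1 ->
        delta^-1 \isn't a Num.nat -> 0 < theta delta < 1].
Proof.
split.
- by move=> delta d0 d1; exact: wiener_constant_le.
- split; last exact: theta_bigO.
  by move=> delta; rewrite in_itv /= => /andP[d0 d1]; exact: continuous_theta.
- by move=> delta d0 d1; exact: theta_inv.
- by move=> delta d0 d1; exact: theta_itv.
Qed.
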